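(* Let $r\ge2$ and let $\omega_1,\dots,\omega_r\in\mathbf{C}$ lie in the open upper half plane with $\arg(\omega_j)<\arg(\omega_k)$ for $j<k$. Let $z=\sum_{k=1}^ra_k\omega_k$ with $0<a_1,\dots,a_r<1$. Put $\boldsymbol{\omega}=(\omega_1,\dots,\omega_r)$, $z_k=z/\omega_k$ and $\omega_{jk}=\omega_j/\omega_k$. (1) For all integers $m\ge0$, $$B_{r,m}(z\mid\boldsymbol{\omega})=(-1)^r(2\pi i)^{r-1-m}\,m!\sum_{k=1}^r\omega_k^{m-r}\sum_{n\in\mathbf{Z}\setminus\{0\}}n^{r-1-m}e^{2\pi i n z_k}\prod_{1\le j\le r,\,j\ne k}(1-e^{2\pi i n\omega_{jk}})^{-1}.$$ (2) For all integers $m\ge1$, $$\sum_{k=1}^r\omega_k^{-(r+m)}\sum_{n\in\mathbf{Z}\setminus\{0\}}n^{r+m-1}e^{2\pi i n z_k}\prod_{1\le j\le r,\,j\ne k}(1-e^{2\pi i n\omega_{jk}})^{-1}=0.$$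
   Context: Arguments are taken in $(-\pi,\pi]$. The multiple Bernoulli polynomials $B_{r,k}(z\mid\boldsymbol{\omega})$ are defined by $$\frac{t^re^{zt}}{(e^{\omega_1t}-1)\cdots(e^{\omega_rt}-1)}=\sum_{k=0}^\infty B_{r,k}(z\mid\boldsymbol{\omega})\frac{t^k}{k!}.$$ *)

(* Defs.v *)
(* Stdlib reals and Coquelicot's complex numbers C; from MathComp only the
   ordinals 'I_r and the big operators. *)
From HB Require Import structures.
From mathcomp Require Import all_boot.
From Stdlib Require Import Reals ZArith Lra Lia ClassicalEpsilon.
From Coquelicot Require Import Coquelicot.

Set Implicit Arguments.
Unset Strict Implicit.
Unset Printing Implicit Defensive.

Open Scope C_scope.

HB.instance Definition _ :=
  Monoid.isComLaw.Build C (RtoC 0) Cplus Cplus_assoc Cplus_comm Cplus_0_l.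
HB.instance Definition _ :=
  Monoid.isComLaw.Build C (RtoC 1) Cmult Cmult_assoc Cmult_comm Cmult_1_l.

Definition Cexp (w : C) : C :=
  ((exp (Re w) * cos (Im w))%R, (exp (Re w) * sin (Im w))%R).

(* The argument in (-PI, PI], see [Carg_spec]; its value at 0 is irrelevant. *)
Definition Carg (w : C) : R :=
  if Rle_dec 0 (Im w) then acos (Re w / Cmod w) else (- acos (Re w / Cmod w))%R.

Lemma Carg_spec (w : C) : w <> 0 ->
  (- PI < Carg w <= PI)%R /\ w = RtoC (Cmod w) * Cexp (Ci * RtoC (Carg w)).
Proof.
move=> w0.
have m0 : (0 < Cmod w)%R by apply/Cmod_gt_0.
have sq : (Cmod w * Cmod w = Re w * Re w + Im w * Im w)%R.
  rewrite /Cmod sqrt_sqrt /Re /Im /=; first ring.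
  by move: (Rle_0_sqr (fst w)) (Rle_0_sqr (snd w)); rewrite /Rsqr; lra.
have wE : w = (Re w, Im w) by case: w {w0 m0 sq}.
set x := (Re w / Cmod w)%R.
have xm : (x * Cmod w = Re w)%R by rewrite /x; field; lra.
have x1 : (-1 <= x <= 1)%R.
  have : (x * x <= 1)%R.
    apply: (Rmult_le_reg_r (Cmod w * Cmod w)); first nra.
    have -> : (x * x * (Cmod w * Cmod w) = (x * Cmod w) * (x * Cmod w))%R by ring.
    rewrite xm sq; nra.
  nra.
have x2 : (0 <= 1 - x²)%R.
  have := Rmult_le_pos (1 - x) (1 + x) ltac:(lra) ltac:(lra).
  by rewrite /Rsqr; lra.
have s2 : (sqrt (1 - x²) * Cmod w = Rabs (Im w))%R.
  have -> : (sqrt (1 - x²) * Cmod w = sqrt ((1 - x²) * (Cmod w * Cmod w)))%R.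
    by rewrite sqrt_mult_alt // sqrt_square //; lra.
  rewrite -sqrt_Rsqr_abs; congr sqrt.
  have -> : ((1 - x²) * (Cmod w * Cmod w)
             = Cmod w * Cmod w - (x * Cmod w) * (x * Cmod w))%R.
    by rewrite /Rsqr; ring.
  by rewrite xm sq /Rsqr; ring.
have ab := acos_bound x.
have cE : cos (acos x) = x by apply: cos_acos.
have sE : sin (acos x) = sqrt (1 - x²) by apply: sin_acos.
have eE t : RtoC (Cmod w) * Cexp (Ci * RtoC t)
            = ((cos t * Cmod w)%R, (sin t * Cmod w)%R).
  have -> : Ci * RtoC t = (0%R, t) by rewrite /Ci /RtoC /Cmult /=; f_equal; ring.
  by rewrite /Cexp /RtoC /Cmult /= exp_0; f_equal; ring.
rewrite /Carg -/x; case: Rle_dec => [ip|ineg] /=; rewrite eE.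
- split; first by have pi0 := PI_RGT_0; split; lra.
  by rewrite cE sE xm s2 {1}wE Rabs_pos_eq.
- have iw := Rnot_le_lt _ _ ineg.
  have xlt : (acos x <> PI)%R.
    move=> e; move: sE; rewrite e sin_PI => s0; move: s2.
    by rewrite -s0 Rmult_0_l Rabs_left // => ?; lra.
  split; first by split; lra.
  rewrite cos_neg sin_neg cE sE xm {1}wE; f_equal.
  by rewrite Ropp_mult_distr_l_reverse s2 Rabs_left //; lra.
Qed.

Definition Czpow (w : C) (n : Z) : C :=
  match n with
  | Z0 => 1
  | Zpos p => Cpow w (Pos.to_nat p)
  | Zneg p => / Cpow w (Pos.to_nat p)
  end.

Definition CSeries (u : nat -> C) : C :=
  (Series (fun n => Re (u n)), Series (fun n => Im (u n))).

(* Absolute convergence of the family f over Z \ {0}, and its sum. *)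
Definition summable_nz (f : Z -> C) : Prop :=
  ex_series (fun n : nat => Cmod (f (Z.of_nat n.+1))) /\
  ex_series (fun n : nat => Cmod (f (- Z.of_nat n.+1)%Z)).

Definition sum_nz (f : Z -> C) : C :=
  CSeries (fun n : nat => f (Z.of_nat n.+1)) +
  CSeries (fun n : nat => f (- Z.of_nat n.+1)%Z).

Lemma CSeries_correct (u : nat -> C) :
  ex_series (fun n => Cmod (u n)) -> is_series u (CSeries u).
Proof.
move=> ?.
have hr : ex_series (fun n => Re (u n)).
  apply: (ex_series_le (K := R_AbsRing) (V := R_CompleteNormedModule) _
    (fun n => Cmod (u n))) => // n.
  by apply: Rle_trans (Rmax_l _ _) (Rmax_Cmod _).
have hi : ex_series (fun n => Im (u n)).
  apply: (ex_series_le (K := R_AbsRing) (V := R_CompleteNormedModule) _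
    (fun n => Cmod (u n))) => // n.
  by apply: Rle_trans (Rmax_r _ _) (Rmax_Cmod _).
have sE n : sum_n u n = (sum_n (fun n => Re (u n)) n, sum_n (fun n => Im (u n)) n).
  elim: n => [|n IH]; first by rewrite !sum_O; case: (u O).
  by rewrite !sum_Sn IH; case: (u n.+1).
apply: (filterlim_ext
  (fun n => (sum_n (fun n => Re (u n)) n, sum_n (fun n => Im (u n)) n))) => //.
move=> P [e he].
have br := Series_correct _ hr.
have bi := Series_correct _ hi.
have := br _ (locally_ball (Series (fun n => Re (u n))) e).
have := bi _ (locally_ball (Series (fun n => Im (u n))) e).
rewrite /filtermap => -[N1 h1] [N2 h2].
exists (Nat.add N1 N2) => n hn; apply: he; split => /=; [apply: h2|apply: h1]; lia.
Qed.

(* B k is the k-th coefficient in the generating function, which has a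
   removable singularity at t = 0. *)
Definition is_multiple_bernoulli (r : nat) (omega : 'I_r -> C) (z : C)
    (B : nat -> C) : Prop :=
  exists eps : R, (0 < eps)%R /\
    forall t : C, t <> 0 -> (Cmod t < eps)%R ->
      is_series (K := C_AbsRing) (V := C_NormedModule)
        (fun k : nat => B k * Cpow t k / RtoC (INR (Factorial.fact k)))
        (Cpow t r * Cexp (z * t) /
           \big[Cmult/RtoC 1]_(j < r) (Cexp (omega j * t) - 1)).

Definition multiple_bernoulli (r : nat) (k : nat) (z : C) (omega : 'I_r -> C) : C :=
  epsilon (inhabits (fun _ : nat => RtoC 0)) (is_multiple_bernoulli omega z) k.

(* n^e * exp(2 pi i n z_k) / prod_(j <> k) (1 - exp(2 pi i n omega_jk)). *)
Definition exp_term (r : nat) (omega : 'I_r -> C) (z : C) (e : Z) (k : 'I_r)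
    (n : Z) : C :=
  Czpow (RtoC (IZR n)) e
  * Cexp (2 * RtoC PI * Ci * RtoC (IZR n) * (z / omega k))
  * \big[Cmult/RtoC 1]_(j < r | j != k)
      / (1 - Cexp (2 * RtoC PI * Ci * RtoC (IZR n) * (omega j / omega k))).

(* Main.v *)
(* Let E(t) = e^{zt} / prod_j (e^{omega_j t} - 1).  Writing z = sum_j a_j omega_j
   makes E a product of factors e^{a_j s} / (e^s - 1), s = omega_j t, each of which
   decays exponentially in |Re s|.  As the omega_j lie on distinct lines through 0,
   E decays exponentially away from its poles 2 pi i n / omega_k, these are simple
   for n <> 0, and their residues decay exponentially in n.  Subtracting from E the
   absolutely convergent sum S of its polar parts at the nonzero poles and its
   principal part at 0 leaves an entire function that vanishes at infinity, hence 0
   by the maximum principle.  Expanding E = S + (principal part) at t = 0 gives the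
   Bernoulli numbers of index m >= r.  Letting t -> oo along the ray -iR, where E is
   exponentially small, identifies the moments of the residues with the
   coefficients of the principal part: this gives the indices m < r, and (2).

   The maximum principle is obtained without contour integrals: if F has Taylor
   expansions of order 3 at every point, then
   F(p+h) + F(p-h) + F(p+ih) + F(p-ih) - 4 F(p) = O(h^3), so Re F + eta |t|^2 with
   eta > 0 has no local maximum. *)
Require Import Defs.
From mathcomp Require Import all_boot.
From Stdlib Require Import Reals ZArith Lra Lia ClassicalEpsilon.
From Coquelicot Require Import Coquelicot.

(** * The complex exponential *)

Section ComplexExponential.
Local Open Scope R_scope.
Local Open Scope C_scope.

(** One family of numbers carries both parts of the theorem. For e in Z let [moment e] be the sum of
    residue times pole^e over the nonzero poles, and let S_e be the polar sum with these weights, so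
    that S_0 is S. Then t S_e = moment e + S_(e+1). Read upwards from S_0 this is the expansion at
    infinity, read downwards the expansion at 0; together they give B_(r,m)/m! = -moment (r-1-m) for
    all m, and moment e = 0 for e >= r.

    Division by zero gives E and S arbitrary values at the poles, although their difference must be
    treated as entire. Hence a Taylor expansion at a point ignores the value there, and the values
    are restored once, as limits, before the maximum principle is used.

    Decay is known only at a distance from the poles, which themselves tend to infinity. Each remote
    pole is therefore surrounded by an annulus on which the decay holds, and the maximum principle
    carries the bound inside; a large disc is treated only afterwards.

    As [multiple_bernoulli] is chosen by [epsilon], uniqueness of power series coefficients is also
    needed. *)

Lemma C_eq (x y : C) : Re x = Re y -> Im x = Im y -> x = y.
Proof. by case: x y => [a b] [c d] /= -> ->. Qed.

Lemma Re_mult (x y : C) : Re (x * y) = (Re x * Re y - Im x * Im y)%R.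
Proof. by []. Qed.

Lemma Im_mult (x y : C) : Im (x * y) = (Re x * Im y + Im x * Re y)%R.
Proof. by []. Qed.

Lemma im_le_Cmod (x : C) : Rabs (Im x) <= Cmod x.
Proof. exact: Rle_trans (Rmax_r _ _) (Rmax_Cmod x). Qed.

Lemma Cmod_le_Re_Im (x : C) : Cmod x <= Rabs (Re x) + Rabs (Im x).
Proof.
have -> : x = RtoC (Re x) + Ci * RtoC (Im x).
  by apply: C_eq; rewrite /= ; ring.
apply: Rle_trans (Cmod_triangle _ _) _.
rewrite Cmod_mult Cmod_Ci !Cmod_R /=.
have -> : (Re x + (0 * Im x - 1 * 0) = Re x)%R by ring.
have -> : (0 + (0 * 0 + 1 * Im x) = Im x)%R by ring.
lra.
Qed.

Lemma Cmod_sub_rev (x y : C) : Cmod x - Cmod y <= Cmod (x - y).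
Proof.
have := Cmod_triangle (x - y) y.
have -> : x - y + y = x by ring.
lra.
Qed.

Lemma Cexp_add (x y : C) : Cexp (x + y) = Cexp x * Cexp y.
Proof.
by case: x y => [a b] [c d]; apply: C_eq;
  rewrite /Cexp /= exp_plus ?cos_plus ?sin_plus; ring.
Qed.

Lemma Cexp_0 : Cexp 0 = 1.
Proof. by apply: C_eq; rewrite /Cexp /= exp_0 ?cos_0 ?sin_0; ring. Qed.

Lemma Cmod_Cexp (w : C) : Cmod (Cexp w) = exp (Re w).
Proof.
rewrite /Cmod /Cexp /=.
have -> : (exp (Re w) * cos (Im w) * (exp (Re w) * cos (Im w) * 1) +
   exp (Re w) * sin (Im w) * (exp (Re w) * sin (Im w) * 1)
   = exp (Re w) * exp (Re w))%R.
  have := sin2_cos2 (Im w); rewrite /Rsqr => h.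
  transitivity (exp (Re w) * exp (Re w) *
    (sin (Im w) * sin (Im w) + cos (Im w) * cos (Im w)))%R; first ring.
  by rewrite h; ring.
by rewrite sqrt_square //; apply: Rlt_le; apply: exp_pos.
Qed.

Lemma cos_2PI_Z (y : R) (n : Z) : cos (y + 2 * PI * IZR n) = cos y.
Proof.
case: (Z_le_gt_dec 0 n) => hn.
  rewrite -(cos_period y (Z.to_nat n)) INR_IZR_INZ Z2Nat.id //.
  by congr cos; ring.
rewrite -(cos_period (y + 2 * PI * IZR n) (Z.to_nat (- n))) INR_IZR_INZ Z2Nat.id; last lia.
by rewrite opp_IZR; congr cos; ring.
Qed.

Lemma sin_2PI_Z (y : R) (n : Z) : sin (y + 2 * PI * IZR n) = sin y.
Proof.
case: (Z_le_gt_dec 0 n) => hn.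
  rewrite -(sin_period y (Z.to_nat n)) INR_IZR_INZ Z2Nat.id //.
  by congr sin; ring.
rewrite -(sin_period (y + 2 * PI * IZR n) (Z.to_nat (- n))) INR_IZR_INZ Z2Nat.id; last lia.
by rewrite opp_IZR; congr sin; ring.
Qed.

Definition ipole (n : Z) : C := 2 * RtoC PI * Ci * RtoC (IZR n).

Lemma ipoleE (n : Z) : ipole n = (0%R, (2 * PI * IZR n)%R).
Proof. by rewrite /ipole /Ci /RtoC /Cmult /=; f_equal; ring. Qed.

Lemma Cexp_ipole_add (w : C) (n : Z) : Cexp (ipole n + w) = Cexp w.
Proof.
rewrite ipoleE; apply: C_eq; rewrite /Cexp /= Rplus_0_l Rplus_comm.
  by rewrite cos_2PI_Z.
by rewrite sin_2PI_Z.
Qed.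

Lemma Cexp_ipole (n : Z) : Cexp (ipole n) = 1.
Proof.
by rewrite -(Cplus_0_r (ipole n)) Cexp_ipole_add Cexp_0.
Qed.

(** The index counts terms: the degree is below [k], so the error against [Cexp] is of order w^k. *)
Fixpoint exp_poly (k : nat) (w : C) : C :=
  match k with
  | O => 0
  | S k' => exp_poly k' w + w ^ k' / RtoC (INR (Factorial.fact k'))
  end.

(** A real parameter is enough, since Taylor's estimate is proved along the segment from 0 to w;
    real calculus then applies to each component. *)
Definition is_derive_RC (f : R -> C) (s : R) (l : C) : Prop :=
  is_derive (fun u => Re (f u)) s (Re l) /\ is_derive (fun u => Im (f u)) s (Im l).

Lemma is_derive_RC_plus (f g : R -> C) (s : R) (l m : C) :
  is_derive_RC f s l -> is_derive_RC g s m ->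
  is_derive_RC (fun u => f u + g u) s (l + m).
Proof. by move=> [? ?] [? ?]; split; apply: is_derive_plus. Qed.

Lemma is_derive_RC_opp (f : R -> C) (s : R) (l : C) :
  is_derive_RC f s l -> is_derive_RC (fun u => - f u) s (- l).
Proof. by move=> [? ?]; split; apply: is_derive_opp. Qed.

Lemma is_derive_RC_pow (c : C) (k : nat) (s : R) :
  is_derive_RC (fun u => RtoC (u ^ k.+1)%R * c) s
    (RtoC (INR k.+1 * s ^ k)%R * c).
Proof.
split.
  apply: (is_derive_ext (fun u => (u ^ k.+1 * Re c)%R)).
    by move=> u; rewrite /Re /Im /=; ring.
  by auto_derive => //; rewrite -[match k with O => _ | S _ => _ end]/(INR k.+1) /Re /Im; cbn -[INR]; ring.
apply: (is_derive_ext (fun u => (u ^ k.+1 * Im c)%R)).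
  by move=> u; rewrite /Re /Im /=; ring.
by auto_derive => //; rewrite -[match k with O => _ | S _ => _ end]/(INR k.+1) /Re /Im; cbn -[INR]; ring.
Qed.

Lemma is_derive_RC_Cexp (w : C) (s : R) :
  is_derive_RC (fun u => Cexp (RtoC u * w)) s (w * Cexp (RtoC s * w)).
Proof.
split.
  apply: (is_derive_ext (fun u => (exp (u * Re w) * cos (u * Im w))%R)).
    by move=> u; rewrite /Cexp /=; f_equal; f_equal; rewrite /Re /Im /=; ring.
  auto_derive => //.
  rewrite Re_mult /Cexp /=.
  have -> : (s * fst w - 0 * snd w = s * Re w)%R by rewrite /Re; ring.
  have -> : (s * snd w + 0 * fst w = s * Im w)%R by rewrite /Im; ring.
  ring.
apply: (is_derive_ext (fun u => (exp (u * Re w) * sin (u * Im w))%R)).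
  by move=> u; rewrite /Cexp /=; f_equal; f_equal; rewrite /Re /Im /=; ring.
auto_derive => //.
rewrite Im_mult /Cexp /=.
have -> : (s * fst w - 0 * snd w = s * Re w)%R by rewrite /Re; ring.
have -> : (s * snd w + 0 * fst w = s * Im w)%R by rewrite /Im; ring.
ring.
Qed.

Lemma is_derive_RC_exp_poly (w : C) (k : nat) (s : R) :
  is_derive_RC (fun u => exp_poly k.+1 (RtoC u * w)) s
    (w * exp_poly k (RtoC s * w)).
Proof.
elim: k => [|k IH].
  split; rewrite /= ?Rmult_0_r.
    apply: (is_derive_ext (fun u => 1%R)); last first.
      by auto_derive => //; ring.
    by move=> u; rewrite /=; field.
  apply: (is_derive_ext (fun u => 0%R)); last first.
    by auto_derive => //; ring.
  by move=> u; rewrite /=; field.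
have h := is_derive_RC_pow (w ^ k.+1 / RtoC (INR (Factorial.fact k.+1))) k s.
have := is_derive_RC_plus _ _ _ _ _ IH h.
have e0 : RtoC (INR (Factorial.fact k)) <> 0.
  by move=> /RtoC_inj; apply: INR_fact_neq_0.
have e1 : RtoC (INR k.+1) <> 0.
  by move=> /RtoC_inj; apply: not_0_INR.
have -> : w * exp_poly k (RtoC s * w) +
   RtoC (INR k.+1 * s ^ k) * (w ^ k.+1 / RtoC (INR (Factorial.fact k.+1)))
  = w * exp_poly k.+1 (RtoC s * w).
  rewrite fact_simpl mult_INR !RtoC_mult RtoC_pow [exp_poly k.+1 _]/= Cpow_mult_l Cpow_S.
  by field.
have E u : exp_poly k.+2 (RtoC u * w) = exp_poly k.+1 (RtoC u * w) +
    RtoC (u ^ k.+1)%R * (w ^ k.+1 / RtoC (INR (Factorial.fact k.+1))).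
  have -> : exp_poly k.+2 (RtoC u * w) = exp_poly k.+1 (RtoC u * w) +
    (RtoC u * w) ^ k.+1 / RtoC (INR (Factorial.fact k.+1)) by [].
  by rewrite Cpow_mult_l RtoC_pow /Cdiv Cmult_assoc.
by case=> h1 h2; split; [apply: is_derive_ext h1 | apply: is_derive_ext h2] => u; rewrite E.
Qed.

(** The mean value theorem is applied to the real and imaginary parts, at different intermediate
    points; hence the factor 2. *)
Lemma Cmod_RC_mean_value (f df : R -> C) (M : R) :
  (forall s, is_derive_RC f s (df s)) ->
  (forall s, 0 <= s <= 1 -> Cmod (df s) <= M) ->
  Cmod (f 1%R - f 0%R) <= 2 * M.
Proof.
move=> hd hM.
apply: Rle_trans (Cmod_le_Re_Im _) _.
have aux (g dg : R -> R) : (forall s, is_derive g s (dg s)) ->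
    (forall s, 0 <= s <= 1 -> Rabs (dg s) <= M) -> Rabs (g 1 - g 0) <= M.
  move=> h1 h2.
  have [|x|c [hc ->]] := MVT_gen g 0 1 dg; first by move=> *.
    move=> _; apply/continuity_pt_filterlim.
    by apply: ex_derive_continuous; exists (dg x).
  rewrite Rmin_left in hc; last lra.
  rewrite Rmax_right in hc; last lra.
  by rewrite Rminus_0_r Rmult_1_r; apply: h2.
have h1 := aux (fun s => Re (f s)) (fun s => Re (df s)) (fun s => proj1 (hd s))
  (fun s hs => Rle_trans _ _ _ (re_le_Cmod _) (hM s hs)).
have h2 := aux (fun s => Im (f s)) (fun s => Im (df s)) (fun s => proj2 (hd s))
  (fun s hs => Rle_trans _ _ _ (im_le_Cmod _) (hM s hs)).
change (Rabs (Re (f 1%R) - Re (f 0%R)) + Rabs (Im (f 1%R) - Im (f 0%R)) <= 2 * M).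
cbv beta in h1, h2; lra.
Qed.

(** Along s |-> s w the remainder of order k+1 vanishes at s = 0 and has derivative w times the
    remainder of order k, so each order follows from the previous one by the mean value bound, at
    the price of doubling [M]. *)
Lemma Cexp_taylor (k : nat) : exists M : R, 0 <= M /\
  forall w : C, Cmod w <= 1 -> Cmod (Cexp w - exp_poly k w) <= M * Cmod w ^ k.
Proof.
elim: k => [|k [M [M0 IH]]].
  exists (exp 1); split; first by apply: Rlt_le; apply: exp_pos.
  move=> w hw; rewrite /= Rmult_1_r.
  have -> : Cexp w - 0 = Cexp w by ring.
  rewrite Cmod_Cexp.
  have := re_le_Cmod w; have := Rle_abs (Re w) => h1 h2.
  case: (Rle_lt_or_eq_dec (Re w) 1); first lra.
    by move=> ?; apply: Rlt_le; apply: exp_increasing.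
  by move=> ->; lra.
exists (2 * M)%R; split; first lra.
move=> w hw.
pose f s := Cexp (RtoC s * w) - exp_poly k.+1 (RtoC s * w).
pose df s := w * Cexp (RtoC s * w) - w * exp_poly k (RtoC s * w).
have hd s : is_derive_RC f s (df s).
  apply: is_derive_RC_plus; first exact: is_derive_RC_Cexp.
  by apply: is_derive_RC_opp; apply: is_derive_RC_exp_poly.
have f0 : f 0%R = 0.
  rewrite /f Cmult_0_l Cexp_0.
  have -> : exp_poly k.+1 0 = 1.
    elim: (k) => [|m IHm]; first by rewrite /=; field.
    have -> : exp_poly m.+2 0 = exp_poly m.+1 0 + 0 * 0 ^ m / RtoC (INR (Factorial.fact m.+1)).
      by [].
    by rewrite IHm /Cdiv !Cmult_0_l Cplus_0_r.
  ring.
have := Cmod_RC_mean_value f df (M * Cmod w ^ k.+1) hd.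
have -> : f 1%R - f 0%R = Cexp w - exp_poly k.+1 w.
  by rewrite f0 /f Cmult_1_l; ring.
rewrite Rmult_assoc.
apply=> s hs.
have -> : df s = w * (Cexp (RtoC s * w) - exp_poly k (RtoC s * w)) by rewrite /df; ring.
have hsw : Cmod (RtoC s * w) <= Cmod w.
  rewrite Cmod_mult Cmod_R Rabs_pos_eq; last by lra.
  by have := Cmod_ge_0 w; nra.
rewrite Cmod_mult /= Rmult_comm.
have := IH (RtoC s * w) (Rle_trans _ _ _ hsw hw).
have := pow_incr _ _ k (conj (Cmod_ge_0 _) hsw) => h1 h2.
have h3 : Cmod (Cexp (s * w) - exp_poly k (s * w)) <= M * Cmod w ^ k.
  apply: Rle_trans h2 _.
  exact: Rmult_le_compat_l.
have := Rmult_le_compat_r _ _ _ (Cmod_ge_0 w) h3; lra.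
Qed.
End ComplexExponential.

(** * Taylor expansions at 0 *)

Section Jets.
Local Open Scope R_scope.
Local Open Scope C_scope.

Definition near0 (P : C -> Prop) : Prop :=
  exists d : R, 0 < d /\ forall h : C, h <> 0 -> Cmod h < d -> P h.

Lemma near0_mono (P Q : C -> Prop) :
  (forall h : C, h <> 0 -> P h -> Q h) -> near0 P -> near0 Q.
Proof. by move=> PQ [d [d0 hP]]; exists d; split=> // h h0 hd; apply: PQ => //; apply: hP. Qed.

Lemma near0_and (P Q : C -> Prop) : near0 P -> near0 Q -> near0 (fun h => P h /\ Q h).
Proof.
move=> [d [d0 hP]] [e [e0 hQ]]; exists (Rmin d e); split; first exact: Rmin_pos.
move=> h h0 hm; split.
  by apply: hP => //; apply: Rlt_le_trans hm (Rmin_l _ _).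
by apply: hQ => //; apply: Rlt_le_trans hm (Rmin_r _ _).
Qed.

Lemma near0_and2 (P Q S : C -> Prop) :
  (forall h : C, h <> 0 -> P h -> Q h -> S h) -> near0 P -> near0 Q -> near0 S.
Proof. by move=> PQS p q; apply: near0_mono (near0_and _ _ p q) => h h0 []; apply: PQS. Qed.

Lemma near0_true (P : C -> Prop) : (forall h : C, h <> 0 -> P h) -> near0 P.
Proof. by move=> hP; exists 1%R; split; [lra | move=> h h0 _; apply: hP]. Qed.

Lemma near0_lt (e : R) : 0 < e -> near0 (fun h => Cmod h < e).
Proof. by exists e; split. Qed.

(* Taylor expansion to order [N] at [0]; the value at [0] itself is ignored, so
   that removable singularities are allowed. *)
Fixpoint jet (N : nat) (f : C -> C) : Prop :=
  match N with
  | O => exists M : R, near0 (fun h => Cmod (f h) <= M)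
  | S N' => exists (c : C) (g : C -> C), jet N' g /\ near0 (fun h => f h = c + h * g h)
  end.

(** [jet N.+1] with its constant term made visible: [c] is the limit of [f] at 0, which need not be
    [f 0]. *)
Definition jetc (N : nat) (c : C) (f : C -> C) : Prop :=
  exists g : C -> C, jet N g /\ near0 (fun h => f h = c + h * g h).

Lemma jetc_jet (N : nat) (c : C) (f : C -> C) : jetc N c f -> jet N.+1 f.
Proof. by exists c. Qed.

Lemma jet_ext (N : nat) (f g : C -> C) :
  near0 (fun h => f h = g h) -> jet N f -> jet N g.
Proof.
move=> e; case: N => [|N] /=.
  by move=> [M hM]; exists M; apply: near0_and2 e hM => h _ ->.
move=> [c [k [hk hc]]]; exists c, k; split=> //.
by apply: near0_and2 e hc => h _ ->.
Qed.

Lemma jetc_ext (N : nat) (c : C) (f g : C -> C) :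
  near0 (fun h => f h = g h) -> jetc N c f -> jetc N c g.
Proof.
move=> e [k [hk hc]]; exists k; split=> //.
by apply: near0_and2 e hc => h _ ->.
Qed.

Lemma jet_bounded (N : nat) (f : C -> C) : jet N f -> jet 0 f.
Proof.
elim: N f => [//|N IH] f [c [g [/IH [M hM] hc]]].
exists (Cmod c + Rmax M 0)%R.
apply: near0_and2 (near0_and _ _ hM (near0_lt 1 Rlt_0_1)) hc => h h0 [h1 h2] ->.
apply: Rle_trans (Cmod_triangle _ _) _; rewrite Cmod_mult.
have := Cmod_ge_0 h; have := Cmod_ge_0 (g h).
have := Rmax_l M 0; have := Rmax_r M 0; nra.
Qed.

Lemma jet_S (N : nat) (f : C -> C) : jet N.+1 f -> jet N f.
Proof.
elim: N f => [|N IH] f; first exact: jet_bounded.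
by move=> [c [g [/IH hg hc]]]; exists c, g.
Qed.

Lemma jet_plus (N : nat) (f g : C -> C) :
  jet N f -> jet N g -> jet N (fun h => f h + g h).
Proof.
elim: N f g => [|N IH] f g.
  move=> [M hM] [M' hM']; exists (M + M')%R; apply: near0_and2 hM hM' => h _ h1 h2.
  by apply: Rle_trans (Cmod_triangle _ _) _; lra.
move=> [c [f1 [jf cf]]] [d [g1 [jg cg]]]; exists (c + d), (fun h => f1 h + g1 h).
split; first exact: IH.
by apply: near0_and2 cf cg => h _ -> ->; ring.
Qed.

Lemma jet_const (N : nat) (c : C) : jet N (fun _ => c).
Proof.
elim: N c => [|N IH] c; first by exists (Cmod c); apply: near0_true => *; lra.
exists c, (fun=> 0); split; first exact: IH.
by apply: near0_true => h _; ring.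
Qed.

Lemma jet_id_mult (N : nat) (f : C -> C) : jet N f -> jet N (fun h => h * f h).
Proof.
move=> jf; apply: jet_S; exists 0, f; split=> //.
by apply: near0_true => h _; ring.
Qed.

Lemma jet_mult (N : nat) (f g : C -> C) :
  jet N f -> jet N g -> jet N (fun h => f h * g h).
Proof.
elim: N f g => [|N IH] f g.
  move=> [M hM] [M' hM']; exists (M * M')%R; apply: near0_and2 hM hM' => h _ h1 h2.
  by rewrite Cmod_mult; apply: Rmult_le_compat => //; apply: Cmod_ge_0.
move=> [c [f1 [jf cf]]] [d [g1 [jg cg]]].
exists (c * d), (fun h => c * g1 h + (d * f1 h + h * (f1 h * g1 h))); split.
  apply: jet_plus; first by apply: IH => //; apply: jet_const.
  apply: jet_plus; first by apply: IH => //; apply: jet_const.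
  by apply: jet_id_mult; apply: IH.
by apply: near0_and2 cf cg => h _ -> ->; ring.
Qed.

Lemma jet_scal (N : nat) (c : C) (f : C -> C) : jet N f -> jet N (fun h => c * f h).
Proof. by move=> jf; apply: jet_mult => //; apply: jet_const. Qed.

Lemma jet_minus (N : nat) (f g : C -> C) :
  jet N f -> jet N g -> jet N (fun h => f h - g h).
Proof.
move=> jf jg; apply: (jet_ext _ (fun h => f h + (- (1)) * g h)).
  by apply: near0_true => h _; ring.
by apply: jet_plus => //; apply: jet_scal.
Qed.

Lemma jetc_const (N : nat) (c : C) : jetc N c (fun _ => c).
Proof.
exists (fun=> 0); split; first exact: jet_const.
by apply: near0_true => h _; ring.
Qed.

Lemma jetc_mult (N : nat) (c d : C) (f g : C -> C) :
  jetc N c f -> jetc N d g -> jetc N (c * d) (fun h => f h * g h).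
Proof.
move=> [f1 [jf cf]] [g1 [jg cg]].
exists (fun h => c * g1 h + (d * f1 h + h * (f1 h * g1 h))); split.
  apply: jet_plus; first by apply: jet_scal.
  apply: jet_plus; first by apply: jet_scal.
  by apply: jet_id_mult; apply: jet_mult.
by apply: near0_and2 cf cg => h _ -> ->; ring.
Qed.

Lemma jetc_scal (N : nat) (c d : C) (f : C -> C) :
  jetc N d f -> jetc N (c * d) (fun h => c * f h).
Proof. exact/jetc_mult/jetc_const. Qed.

Lemma jetc_plus (N : nat) (c d : C) (f g : C -> C) :
  jetc N c f -> jetc N d g -> jetc N (c + d) (fun h => f h + g h).
Proof.
move=> [f1 [jf cf]] [g1 [jg cg]]; exists (fun h => f1 h + g1 h); split.
  exact: jet_plus.
by apply: near0_and2 cf cg => h _ -> ->; ring.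
Qed.

Lemma jetc_lim (N : nat) (c : C) (f : C -> C) :
  jetc N c f -> exists M : R, near0 (fun h => Cmod (f h - c) <= M * Cmod h).
Proof.
move=> [g [/jet_bounded [M hM] hg]]; exists M.
apply: near0_and2 hM hg => h _ h1 ->.
have -> : c + h * g h - c = h * g h by ring.
by rewrite Cmod_mult Rmult_comm; apply: Rmult_le_compat_r => //; apply: Cmod_ge_0.
Qed.

Lemma jetc_near (N : nat) (c : C) (f : C -> C) (e : R) :
  0 < e -> jetc N c f -> near0 (fun h => Cmod (f h - c) < e).
Proof.
move=> e0 /jetc_lim [M hM].
have p : 0 < Rabs M + 1 by have := Rabs_pos M; lra.
apply: near0_and2 hM (near0_lt (e / (Rabs M + 1)) _); last exact: Rdiv_lt_0_compat.
move=> h h0 h1 h2.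
have h3 : Cmod h * (Rabs M + 1) < e.
  apply: (Rlt_le_trans _ (e / (Rabs M + 1) * (Rabs M + 1))).
    exact: Rmult_lt_compat_r.
  by apply: Req_le; field; lra.
have := Rle_abs M; have := Cmod_ge_0 h; nra.
Qed.

Lemma near0_ex (P : C -> Prop) : near0 P -> exists h : C, h <> 0 /\ P h.
Proof.
move=> [d [d0 hd]]; exists (RtoC (d / 2)).
have h0 : RtoC (d / 2) <> 0 by move=> /RtoC_inj; lra.
by split=> //; apply: hd => //; rewrite Cmod_R Rabs_pos_eq; lra.
Qed.

Lemma jetc_bound (N : nat) (c : C) (f : C -> C) (B : R) :
  jetc N c f -> near0 (fun h => Cmod (f h) <= B) -> Cmod c <= B.
Proof.
move=> jf hB; apply: Rnot_lt_le => lt.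
have e0 : 0 < Cmod c - B by lra.
have [h [_ [h1 h2]]] := near0_ex _ (near0_and _ _ hB (jetc_near _ _ _ _ e0 jf)).
have := Cmod_sub_rev c (f h).
have -> : c - f h = - (f h - c) by ring.
by rewrite Cmod_opp; lra.
Qed.

Lemma jetc_unique (N : nat) (c d : C) (f : C -> C) : jetc N c f -> jetc N d f -> c = d.
Proof.
move=> jc jd.
have j := jetc_plus _ _ _ _ _ jc (jetc_scal _ (- (1)) _ _ jd).
have h : Cmod (c + - (1) * d) <= 0.
  apply: (jetc_bound _ _ _ _ j); apply: near0_true => h _.
  have -> : f h + - (1) * f h = 0 by ring.
  by rewrite Cmod_0; lra.
have e := Cmod_eq_0 _ (Rle_antisym _ _ h (Cmod_ge_0 _)).
have -> : c = c + - (1) * d + d by ring.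
by rewrite e; ring.
Qed.

Lemma jetc_neq0 (N : nat) (c : C) (f : C -> C) :
  c <> 0 -> jetc N c f -> near0 (fun h => Cmod c / 2 <= Cmod (f h)).
Proof.
move=> /Cmod_gt_0 c0 jf.
have := @jetc_near _ _ _ (Cmod c / 2) _ jf => nf.
have {}nf := nf ltac:(lra).
apply: near0_mono nf => h _ hh.
have := Cmod_sub_rev c (f h).
have -> : c - f h = - (f h - c) by ring.
by rewrite Cmod_opp; lra.
Qed.

(** If f = c + h g, then 1/f = 1/c - h (1/c) g (1/f): an expansion of 1/f to order N yields one to
    order N+1. The induction starts from boundedness of 1/f, as |f| >= |c|/2 near 0. *)
Lemma jetc_inv (N : nat) (c : C) (f : C -> C) :
  c <> 0 -> jetc N c f -> jetc N (/ c) (fun h => / f h).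
Proof.
move=> c0 jf.
have nz : near0 (fun h => f h <> 0).
  apply: near0_mono (jetc_neq0 _ _ _ c0 jf) => h _ hh e.
  by move: hh; rewrite e Cmod_0; move/Cmod_gt_0: c0; lra.
suff ji : jet N (fun h => / f h).
  have [g [jg hg]] := jf.
  exists (fun h => (- / c) * (g h * / f h)); split.
    by apply: jet_scal; apply: jet_mult.
  apply: near0_and2 nz hg => h _ f0 e.
  have e' : h * g h = f h - c by rewrite e; ring.
  have -> : h * (- / c * (g h * / f h)) = - / c * (h * g h) * / f h by ring.
  by rewrite e'; field.
elim: N jf => [|N IH] jf.
  have := jetc_neq0 _ _ _ c0 jf => h1.
  exists (/ (Cmod c / 2))%R; apply: near0_and2 h1 nz => h _ h1 h2.
  rewrite Cmod_inv //; apply: Rinv_le_contravar => //.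
  by move/Cmod_gt_0: c0; lra.
have [g [jg hg]] := jf.
have ji : jet N (fun h => / f h) by apply: IH; exists g; split=> //; apply: jet_S.
exists (/ c), (fun h => (- / c) * (g h * / f h)); split.
  by apply: jet_scal; apply: jet_mult => //; apply: jet_S.
apply: near0_and2 nz hg => h _ f0 e.
have e' : h * g h = f h - c by rewrite e; ring.
have -> : h * (- / c * (g h * / f h)) = - / c * (h * g h) * / f h by ring.
by rewrite e'; field.
Qed.

Lemma jetc_prod (N : nat) (I : finType) (P : pred I) (c : I -> C) (f : I -> C -> C) :
  (forall i, P i -> jetc N (c i) (f i)) ->
  jetc N (\big[Cmult/RtoC 1]_(i | P i) c i) (fun h => \big[Cmult/RtoC 1]_(i | P i) f i h).
Proof.
move=> H; rewrite unlock /reducebig /=.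
elim: index_enum => [|i s IH] /=; first exact: jetc_const.
case: (boolP (P i)) => // hi.
by apply: jetc_mult => //; apply: H.
Qed.

Lemma jetc_dilate (N : nat) (c b : C) (f : C -> C) :
  b <> 0 -> jetc N c f -> jetc N c (fun h => f (b * h)).
Proof.
move=> b0.
have nd P : near0 P -> near0 (fun h => P (b * h)).
  move=> [d [d0 hd]]; exists (d / Cmod b)%R.
  have bp : 0 < Cmod b by apply/Cmod_gt_0.
  split; first by apply: Rdiv_lt_0_compat.
  move=> h h0 hh; apply: hd; first exact: Cmult_neq_0.
  rewrite Cmod_mult.
  apply: (Rlt_le_trans _ (Cmod b * (d / Cmod b))).
    exact: Rmult_lt_compat_l.
  by apply: Req_le; field; lra.
have jd M g : jet M g -> jet M (fun h => g (b * h)).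
  elim: M g => [|M IH] g; first by move=> [K /nd hK]; exists K.
  move=> [e [g1 [/IH j1 /nd h1]]]; exists e, (fun h => b * g1 (b * h)); split.
    exact: jet_scal.
  by apply: near0_mono h1 => h _ ->; ring.
move=> [g [/jd jg /nd hg]]; exists (fun h => b * g (b * h)); split.
  exact: jet_scal.
by apply: near0_mono hg => h _ ->; ring.
Qed.

Lemma Csum_scal (I : finType) (c : C) (F : I -> C) :
  \big[Cplus/RtoC 0]_i (c * F i) = c * \big[Cplus/RtoC 0]_i F i.
Proof.
rewrite unlock /reducebig /=; elim: index_enum => [|i s /= ->]; first by rewrite /=; ring.
ring.
Qed.

Definition polyn (c : nat -> C) (m : nat) (t : C) : C :=
  \big[Cplus/RtoC 0]_(i < m) (c i * t ^ i).

Lemma polynS (c : nat -> C) (m : nat) (t : C) : polyn c m.+1 t = polyn c m t + c m * t ^ m.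
Proof. by rewrite /polyn big_ord_recr. Qed.

Lemma jetc_pow (N : nat) (p : C) (i : nat) : jetc N (p ^ i) (fun h => (p + h) ^ i).
Proof.
elim: i => [|i IH]; first exact: jetc_const.
apply: (jetc_mult _ _ _ (fun h => p + h)) => //.
exists (fun=> 1); split; first exact: jet_const.
by apply: near0_true => h _; ring.
Qed.

Lemma jetc_polyn (N : nat) (c : nat -> C) (m : nat) (p : C) :
  jetc N (polyn c m p) (fun h => polyn c m (p + h)).
Proof.
elim: m => [|m IH].
  have -> : polyn c 0 p = 0 by rewrite /polyn big_ord0.
  apply: (jetc_ext _ _ _ _ _ (jetc_const N 0)).
  by apply: near0_true => h _; rewrite /polyn big_ord0.
rewrite polynS; apply: jetc_ext (jetc_plus _ _ _ _ _ IH (jetc_scal _ (c m) _ _ (jetc_pow N p m))).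
by apply: near0_true => h _; rewrite polynS.
Qed.

Lemma jet_polyn_expansion (m N : nat) (f : C -> C) : jet (m + N) f ->
  exists (c : nat -> C) (g : C -> C), jet N g /\
    near0 (fun h => f h = polyn c m h + h ^ m * g h).
Proof.
elim: m f => [|m IH] f.
  move=> jf; exists (fun=> 0), f; split=> //; apply: near0_true => h _.
  by rewrite /polyn big_ord0 /=; ring.
move=> [c0 [f1 [/IH [c [g [jg hg]]] h1]]].
exists (fun i => if i is i'.+1 then c i' else c0), g; split=> //.
apply: near0_and2 hg h1 => h _ e ->.
rewrite e /polyn big_ord_recl /=.
have -> : \big[Cplus/RtoC 0]_(i < m) (c i * (h * h ^ i)) =
    h * \big[Cplus/RtoC 0]_(i < m) (c i * h ^ i).
  by rewrite -Csum_scal; apply: eq_bigr => i _; ring.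
set X := \big[Cplus/RtoC 0]_(i < m) _.
change (c0 + h * (X + h ^ m * g h) = c0 * 1 + h * X + h * h ^ m * g h); ring.
Qed.

(** For h <> 0 this is the sum of h^j / (j+k)! over j >= 0. Removing its constant term and dividing
    by h gives the tail of index k+1, so boundedness of all tails yields expansions of every
    order. *)
Definition exp_tail (k : nat) (h : C) : C := (Cexp h - exp_poly k h) / h ^ k.

Lemma exp_tailS (k : nat) (h : C) : h <> 0 ->
  exp_tail k h = / RtoC (INR (Factorial.fact k)) + h * exp_tail k.+1 h.
Proof.
move=> h0; rewrite /exp_tail /=.
have := Cpow_nz _ k h0 => hk.
have e0 : RtoC (INR (Factorial.fact k)) <> 0.
  by move=> /RtoC_inj; apply: INR_fact_neq_0.
by field.
Qed.

Lemma jet_exp_tail (N k : nat) : jet N (exp_tail k).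
Proof.
elim: N k => [|N IH] k.
  have [M [M0 hM]] := Cexp_taylor k.
  exists M; apply: near0_mono (near0_lt 1 Rlt_0_1) => h h0 h1.
  have hk := Cpow_nz _ k h0.
  rewrite /exp_tail Cmod_div // Cmod_pow.
  have hp : 0 < Cmod h ^ k by apply: pow_lt; apply/Cmod_gt_0.
  apply/Rle_div_l => //; apply: hM; lra.
exists (/ RtoC (INR (Factorial.fact k))), (exp_tail k.+1); split; first exact: IH.
by apply: near0_true => h h0; apply: exp_tailS.
Qed.

Lemma jetc_Cexp (N : nat) (b : C) : b <> 0 -> jetc N 1 (fun h => Cexp (b * h)).
Proof.
move=> b0; apply: (jetc_dilate _ _ _ Cexp) => //.
exists (exp_tail 1); split; first exact: jet_exp_tail.
by apply: near0_true => h h0; rewrite /exp_tail /=; field.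
Qed.

Lemma jetc_Cexp_sub1 (N : nat) (b : C) :
  b <> 0 -> jetc N b (fun h => (Cexp (b * h) - 1) / h).
Proof.
move=> b0.
have j1 : jetc N 1 (exp_tail 1).
  exists (exp_tail 2); split; first exact: jet_exp_tail.
  apply: near0_true => h h0; rewrite exp_tailS //=.
  by field.
have := jetc_scal _ b _ _ (jetc_dilate _ _ _ _ b0 j1).
rewrite Cmult_1_r; apply: jetc_ext; apply: near0_true => h h0.
by rewrite /exp_tail /=; field.
Qed.
End Jets.

(** * The maximum principle *)

Section MaximumPrinciple.
Local Open Scope R_scope.

Definition continuous_on_rect (a b a' b' : R) (u : R -> R -> R) : Prop :=
  forall x y, a <= x <= b -> a' <= y <= b' -> forall e, 0 < e ->
  exists d, 0 < d /\ forall x' y', a <= x' <= b -> a' <= y' <= b' ->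
    Rabs (x' - x) < d -> Rabs (y' - y) < d -> Rabs (u x' y' - u x y) < e.

(** The gauge handed to the compactness lemma encodes the size of [u]: it is at most 1/(1+|u|) at
    its own point. A uniform positive lower bound d for the gauges then gives |u| <= 1/d at the
    centres, hence u <= 1 + 1/d everywhere. *)
Lemma continuous_on_rect_bounded (a b a' b' : R) (u : R -> R -> R) :
  continuous_on_rect a b a' b' u ->
  exists B, forall x y, a <= x <= b -> a' <= y <= b' -> u x y <= B.
Proof.
move=> hu.
pose Q x y (d : posreal) := a <= x <= b -> a' <= y <= b' ->
  d * (1 + Rabs (u x y)) <= 1 /\
  forall x' y', a <= x' <= b -> a' <= y' <= b' ->
    Rabs (x' - x) < d -> Rabs (y' - y) < d -> Rabs (u x' y' - u x y) < 1.
have ex x y : exists d, Q x y d.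
  case: (excluded_middle_informative (a <= x <= b /\ a' <= y <= b')); last first.
    by move=> n; exists (mkposreal 1 Rlt_0_1) => h1 h2; case: n.
  move=> [hx hy]; have [d [d0 hd]] := hu x y hx hy 1 Rlt_0_1.
  have p : 0 < / (1 + Rabs (u x y)).
    by apply: Rinv_0_lt_compat; have := Rabs_pos (u x y); lra.
  exists (mkposreal _ (Rmin_pos _ _ d0 p)) => _ _ /=; split.
    apply: (Rle_trans _ (/ (1 + Rabs (u x y)) * (1 + Rabs (u x y)))).
      apply: Rmult_le_compat_r; first by have := Rabs_pos (u x y); lra.
      exact: Rmin_r.
    by apply: Req_le; field; have := Rabs_pos (u x y); lra.
  move=> x' y' hx' hy' h1 h2; apply: hd => //.
    exact: Rlt_le_trans h1 (Rmin_l _ _).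
  exact: Rlt_le_trans h2 (Rmin_l _ _).
pose de x y := proj1_sig (constructive_indefinite_description _ (ex x y)).
have hde x y : Q x y (de x y) := proj2_sig (constructive_indefinite_description _ (ex x y)).
have [d hd] := compactness_value_2d a b a' b' de.
have d0 := cond_pos d.
exists (1 + / d) => x y hx hy.
apply: Rnot_lt_le => hlt; apply: (hd x y hx hy) => -[s [t [hs [ht [h1 [h2 h3]]]]]].
have [k1 k2] := hde s t hs ht.
have k3 := k2 x y hx hy h1 h2.
have k4 : d * Rabs (u s t) <= 1.
  by have := Rabs_pos (u s t); nra.
have k5 : Rabs (u s t) <= / d.
  apply: (Rmult_le_reg_l d) => //; rewrite Rinv_r; lra.
move: k3 k5 hlt; rewrite /Rabs; case: Rcase_abs; case: Rcase_abs => *; lra.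
Qed.

(** If the supremum M were not attained, 1/(M - u) would be continuous, hence bounded by some K, and
    M - 1/K would be a smaller upper bound. *)
Lemma continuous_on_rect_max (a b a' b' : R) (u : R -> R -> R) :
  a <= b -> a' <= b' -> continuous_on_rect a b a' b' u ->
  exists x y, a <= x <= b /\ a' <= y <= b' /\
    forall x' y', a <= x' <= b -> a' <= y' <= b' -> u x' y' <= u x y.
Proof.
move=> ab ab' hu.
pose E v := exists x y, a <= x <= b /\ a' <= y <= b' /\ v = u x y.
have [B hB] := continuous_on_rect_bounded _ _ _ _ _ hu.
have Eb : bound E by exists B => v [x [y [hx [hy ->]]]]; apply: hB.
have Ene : exists v, E v by exists (u a a'), a, a'; split; [lra | split; [lra|]].
have [M [M1 M2]] := completeness E Eb Ene.
have le x y : a <= x <= b -> a' <= y <= b' -> u x y <= M.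
  by move=> hx hy; apply: M1; exists x, y.
case: (excluded_middle_informative
  (exists x y, a <= x <= b /\ a' <= y <= b' /\ u x y = M)).
  move=> [x [y [hx [hy e]]]]; exists x, y; split=> //; split=> // x' y' hx' hy'.
  by rewrite e; apply: le.
move=> nex; exfalso.
have lt x y : a <= x <= b -> a' <= y <= b' -> u x y < M.
  move=> hx hy; case: (Rle_lt_or_eq_dec _ _ (le x y hx hy)) => // e.
  by case: nex; exists x, y.
have hw : continuous_on_rect a b a' b' (fun x y => / (M - u x y)).
  move=> x y hx hy e e0.
  have g0 : 0 < M - u x y by have := lt x y hx hy; lra.
  set g := M - u x y in g0 *.
  (* The first term keeps g' > g/2, so g g' > g^2/2; the second then makes |g - g'| / (g g') smaller
     than e/2. *)
  have p1 : 0 < Rmin (g / 2) (e * (g * g) / 4).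
    by apply: Rmin_pos; [lra | have := Rmult_lt_0_compat _ _ g0 g0; nra].
  have [d [d0 hd]] := hu x y hx hy _ p1.
  exists d; split=> // x' y' hx' hy' h1 h2.
  have h3 := hd x' y' hx' hy' h1 h2.
  have h4 := Rlt_le_trans _ _ _ h3 (Rmin_l _ _).
  have h5 := Rlt_le_trans _ _ _ h3 (Rmin_r _ _).
  set g' := M - u x' y'.
  have e1 : u x' y' - u x y = g - g' by rewrite /g /g'; ring.
  rewrite e1 in h4 h5.
  have g'0 : g / 2 < g' by have := Rle_abs (g - g'); lra.
  have -> : / g' - / g = (g - g') * / (g * g') by field; lra.
  have gg : 0 < g * g' by apply: Rmult_lt_0_compat; lra.
  rewrite Rabs_mult (Rabs_pos_eq (/ _)); last by apply: Rlt_le; apply: Rinv_0_lt_compat.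
  apply/Rlt_div_l => //.
  have h6 : g * (g / 2) < g * g' by apply: Rmult_lt_compat_l.
  have h7 := Rmult_lt_compat_l _ _ _ e0 h6.
  have h8 : 0 < e * (g * g) by do 2?apply: Rmult_lt_0_compat.
  lra.
have [K hK] := continuous_on_rect_bounded _ _ _ _ _ hw.
have Kp : 0 < K.
  apply: Rlt_le_trans (hK a a' ltac:(lra) ltac:(lra)).
  by apply: Rinv_0_lt_compat; have := lt a a' ltac:(lra) ltac:(lra); lra.
have : M <= M - / K.
  apply: M2 => v [x [y [hx [hy ->]]]].
  have h1 := hK x y hx hy; have h2 := lt x y hx hy.
  have : / K <= M - u x y.
    rewrite -(Rinv_inv (M - u x y)); apply: Rinv_le_contravar => //.
    by apply: Rinv_0_lt_compat; lra.
  lra.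
by have := Rinv_0_lt_compat _ Kp; lra.
Qed.

Local Open Scope C_scope.

(** Unlike [jet], this uses the actual value [F p], so it implies continuity. The cubic error is
    what the four-point average needs, its main terms being of size s^2. *)
Definition has_2jets (F : C -> C) : Prop :=
  forall p, exists (c1 c2 : C) (M d : R), 0 < d /\ forall h : C, Cmod h < d ->
    Cmod (F (p + h) - (F p + c1 * h + c2 * (h * h))) <= M * Cmod h ^ 3.

Lemma has_2jets_scal (s : C) (F : C -> C) : has_2jets F -> has_2jets (fun t => s * F t).
Proof.
move=> hF p; have [c1 [c2 [M [d [d0 hd]]]]] := hF p.
exists (s * c1), (s * c2), (Cmod s * M)%R, d; split=> // h hh.
have -> : s * F (p + h) - (s * F p + s * c1 * h + s * c2 * (h * h))
  = s * (F (p + h) - (F p + c1 * h + c2 * (h * h))) by ring.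
rewrite Cmod_mult Rmult_assoc; apply: Rmult_le_compat_l; first exact: Cmod_ge_0.
exact: hd.
Qed.

Lemma has_2jets_continuous (F : C -> C) (p : C) (e : R) : has_2jets F -> 0 < e ->
  exists d, 0 < d /\ forall t, Cmod (t - p) < d -> Cmod (F t - F p) < e.
Proof.
move=> hF e0; have [c1 [c2 [M [d [d0 hd]]]]] := hF p.
pose K := (Cmod c1 + Cmod c2 + Rabs M + 1)%R.
have K0 : 0 < K.
  by rewrite /K; have := Cmod_ge_0 c1; have := Cmod_ge_0 c2; have := Rabs_pos M; lra.
exists (Rmin d (Rmin 1 (e / K))); split.
  by apply: Rmin_pos => //; apply: Rmin_pos; [lra | apply: Rdiv_lt_0_compat].
move=> t ht.
have h1 := Rlt_le_trans _ _ _ ht (Rmin_l _ _).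
have h2 := Rlt_le_trans _ _ _ ht (Rle_trans _ _ _ (Rmin_r _ _) (Rmin_l _ _)).
have h3 := Rlt_le_trans _ _ _ ht (Rle_trans _ _ _ (Rmin_r _ _) (Rmin_r _ _)).
set h := t - p in h1 h2 h3.
have et : t = p + h by rewrite /h; ring.
have h4 := hd h h1; rewrite -et in h4.
have -> : F t - F p = (F t - (F p + c1 * h + c2 * (h * h))) + (c1 * h + c2 * (h * h)) by ring.
apply: Rle_lt_trans (Cmod_triangle _ _) _.
have h5 := Cmod_triangle (c1 * h) (c2 * (h * h)).
rewrite !Cmod_mult in h5.
have hp := Cmod_ge_0 h.
have h6 : Cmod h * Cmod h <= Cmod h by nra.
have h7 : M * Cmod h ^ 3 <= Rabs M * Cmod h.
  apply: (Rle_trans _ (Rabs M * Cmod h ^ 3)).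
    by apply: Rmult_le_compat_r; [apply: pow_le | apply: Rle_abs].
  by apply: Rmult_le_compat_l; [apply: Rabs_pos | rewrite /=; nra].
have h8 : Cmod h * K < e.
  apply: (Rlt_le_trans _ (e / K * K)); first exact: Rmult_lt_compat_r.
  by apply: Req_le; field; lra.
have h9 := Rmult_le_compat_l _ _ _ (Cmod_ge_0 c2) h6.
rewrite /K in h8; lra.
Qed.

(** Compactness is available for rectangles, so the maximum is taken over the square of half-side
    rho. The part of the square outside the open disc of radius rho lies in the annulus; this is why
    the bound is assumed on an annulus and not on a circle. *)
Lemma has_2jets_re_max (F : C -> C) (c : C) (rho e : R) :
  has_2jets F -> 0 < rho ->
  (forall t, rho <= Cmod (t - c) <= 2 * rho -> Re (F t) <= e) ->
  forall t, Cmod (t - c) <= rho -> Re (F t) <= e.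
Proof.
move=> hF r0 hb t0 ht0; apply: Rnot_lt_le => hgt.
(* On the square the added term is at most 2 eta rho^2, a quarter of the gap Re F(t0) - e. Hence [v]
   stays below Re F(t0) wherever the annulus bound applies, and its maximum is interior. *)
pose eta := ((Re (F t0) - e) / (8 * (rho * rho)))%R.
have rr : 0 < rho * rho by nra.
have eta0 : 0 < eta by apply: Rdiv_lt_0_compat; lra.
have etaE : (eta * (8 * (rho * rho)) = Re (F t0) - e)%R by rewrite /eta; field; lra.
pose v (x y : R) := (Re (F (c + (x, y))%C) + eta * (x * x + y * y))%R.
have cv : continuous_on_rect (- rho) rho (- rho) rho v.
  move=> x y hx hy e' e'0.
  have p : 0 < e' / 2 by lra.
  have [d [d0 hd]] := has_2jets_continuous F (c + (x, y))%C (e' / 2) hF p.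
  have q0 : 0 < e' / 2 / (8 * (eta * rho)).
    by apply: Rdiv_lt_0_compat => //; have := Rmult_lt_0_compat _ _ eta0 r0; lra.
  exists (Rmin (d / 2) (e' / 2 / (8 * (eta * rho)))); split; first by apply: Rmin_pos; lra.
  move=> x' y' hx' hy' h1 h2.
  have h3 := Rlt_le_trans _ _ _ h1 (Rmin_l _ _).
  have h4 := Rlt_le_trans _ _ _ h1 (Rmin_r _ _).
  have h5 := Rlt_le_trans _ _ _ h2 (Rmin_l _ _).
  have h6 := Rlt_le_trans _ _ _ h2 (Rmin_r _ _).
  have h7 : Cmod (F (c + (x', y'))%C - F (c + (x, y))%C) < e' / 2.
    apply: hd; apply: Rle_lt_trans (Cmod_le_Re_Im _) _.
    have -> : c + (x', y') - (c + (x, y)) = ((x' - x)%R, (y' - y)%R).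
      by apply: C_eq; rewrite /=; ring.
    rewrite /Re /Im /=; lra.
  have h8 := re_le_Cmod (F (c + (x', y'))%C - F (c + (x, y))%C).
  rewrite /v.
  have -> : (Re (F (c + (x', y'))%C) + eta * (x' * x' + y' * y') -
     (Re (F (c + (x, y))%C) + eta * (x * x + y * y)) =
     Re (F (c + (x', y')) - F (c + (x, y)))%C +
     eta * ((x' - x) * (x' + x) + (y' - y) * (y' + y)))%R.
    by rewrite /Re /=; ring.
  apply: Rle_lt_trans (Rabs_triang _ _) _.
  rewrite Rabs_mult (Rabs_pos_eq eta); last lra.
  set q := (e' / 2 / (8 * (eta * rho)))%R in q0 h4 h6.
  have eq : (eta * (q * (2 * rho) + q * (2 * rho)) = e' / 4)%R by rewrite /q; field; lra.
  have h9 : Rabs ((x' - x) * (x' + x) + (y' - y) * (y' + y)) <= q * (2 * rho) + q * (2 * rho).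
    apply: Rle_trans (Rabs_triang _ _) _; rewrite !Rabs_mult.
    by apply: Rplus_le_compat; apply: Rmult_le_compat; try apply: Rabs_pos;
      try lra; apply: Rabs_le; lra.
  have := Rmult_le_compat_l _ _ _ (Rlt_le _ _ eta0) h9; lra.
have rl : - rho <= rho by lra.
have [x1 [y1 [hx1 [hy1 hmax]]]] := continuous_on_rect_max _ _ _ _ v rl rl cv.
have m0 : Re (F t0) <= v x1 y1.
  have a1 := re_le_Cmod (t0 - c); have a2 := im_le_Cmod (t0 - c).
  have b1 := Rabs_le_between (Re (t0 - c)) rho.
  have b2 := Rabs_le_between (Im (t0 - c)) rho.
  have := hmax (Re (t0 - c)) (Im (t0 - c)) ltac:(apply/b1; lra) ltac:(apply/b2; lra).
  rewrite {1}/v.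
  have -> : c + (Re (t0 - c), Im (t0 - c)) = t0.
    by apply: C_eq; rewrite /Re /Im /=; ring.
  have nn (X Y : R) : 0 <= eta * (X * X + Y * Y) by apply: Rmult_le_pos; nra.
  by have := nn (Re (t0 - c)) (Im (t0 - c)); lra.
have bd : forall x y : R, - rho <= x <= rho -> - rho <= y <= rho -> rho <= Cmod (x, y) -> v x y < v x1 y1.
  move=> x y hx hy hr.
  have h1 : Cmod (x, y) <= 2 * rho.
    apply: Rle_trans (Cmod_le_Re_Im _) _; rewrite /Re /Im /=.
    by have := Rabs_le x rho ltac:(lra); have := Rabs_le y rho ltac:(lra); lra.
  have h2 : Re (F (c + (x, y))%C) <= e.
    apply: hb; have -> : c + (x, y) - c = (x, y) by ring.
    by split.
  have h3 : x * x + y * y <= 2 * (rho * rho) by nra.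
  have := Rmult_le_compat_l _ _ _ (Rlt_le _ _ eta0) h3.
  rewrite {1}/v; lra.
have ix : Rabs x1 < rho.
  apply: Rnot_le_lt => hh; have := bd x1 y1 hx1 hy1.
  have := re_le_Cmod (x1, y1); rewrite /Re /=; move=> h1 h2.
  by have := h2 ltac:(lra); lra.
have iy : Rabs y1 < rho.
  apply: Rnot_le_lt => hh; have := bd x1 y1 hx1 hy1.
  have := im_le_Cmod (x1, y1); rewrite /Im /=; move=> h1 h2.
  by have := h2 ltac:(lra); lra.
set p := c + (x1, y1).
have [c1 [c2 [M [d [d0 hd]]]]] := hF p.
(* In this order: the expansion at p is valid, M s stays below eta, and the four neighbours of the
   maximum remain in the square. *)
pose s := Rmin (Rmin (d / 2) (eta / (Rabs M + 1) / 2)) (Rmin (rho - Rabs x1) (rho - Rabs y1)).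
have M1 : 0 < Rabs M + 1 by have := Rabs_pos M; lra.
have em : 0 < eta / (Rabs M + 1) by apply: Rdiv_lt_0_compat.
have s0 : 0 < s by rewrite /s; do !apply: Rmin_pos; lra.
have s1 : s <= d / 2 by rewrite /s; apply: Rle_trans (Rmin_l _ _) (Rmin_l _ _).
have s2 : s <= eta / (Rabs M + 1) / 2 by rewrite /s; apply: Rle_trans (Rmin_l _ _) (Rmin_r _ _).
have s3 : s <= rho - Rabs x1 by rewrite /s; apply: Rle_trans (Rmin_r _ _) (Rmin_l _ _).
have s4 : s <= rho - Rabs y1 by rewrite /s; apply: Rle_trans (Rmin_r _ _) (Rmin_r _ _).
have mods h : Cmod h = s ->
    Re (F p) + Re (c1 * h + c2 * (h * h))%C - M * s ^ 3 <= Re (F (p + h)).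
  move=> hs; have := hd h ltac:(lra); rewrite hs => h1.
  have := Rle_trans _ _ _ (re_le_Cmod _) h1.
  set X := F p + _ + _; set Y := F (p + h).
  have -> : Re (Y - X) = (Re Y - Re X)%R by [].
  have -> : Re X = (Re (F p) + Re (c1 * h + c2 * (h * h))%C)%R by rewrite /X /Re /=; ring.
  by move=> h2; have := Rabs_le_between (Re Y - (Re (F p) + Re (c1 * h + c2 * (h * h))%C)) (M * s ^ 3); move=> [h3 _]; have := h3 h2; lra.
have k1 := mods (s, 0%R).
have k2 := mods ((- s)%R, 0%R).
have k3 := mods (0%R, s).
have k4 := mods (0%R, (- s)%R).
have ms (x y : R) : (x * x + y * y = s * s)%R -> Cmod (x, y) = s.
  move=> hh; rewrite /Cmod /=.
  have -> : (x * (x * 1) + y * (y * 1) = s * s)%R by rewrite -hh; ring.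
  by rewrite sqrt_square //; lra.
have {}k1 := k1 (ms s 0%R ltac:(ring)).
have {}k2 := k2 (ms (- s)%R 0%R ltac:(ring)).
have {}k3 := k3 (ms 0%R s ltac:(ring)).
have {}k4 := k4 (ms 0%R (- s)%R ltac:(ring)).
have pE (x y : R) : p + (x, y) = c + ((x1 + x)%R, (y1 + y)%R).
  by rewrite /p; apply: C_eq; rewrite /Re /Im /=; ring.
rewrite !pE in k1 k2 k3 k4.
have ax := Rabs_le_between x1 (rho - s); have {}ax := proj1 ax ltac:(lra).
have ay := Rabs_le_between y1 (rho - s); have {}ay := proj1 ay ltac:(lra).
have l1 := hmax (x1 + s)%R (y1 + 0)%R ltac:(lra) ltac:(lra).
have l2 := hmax (x1 + - s)%R (y1 + 0)%R ltac:(lra) ltac:(lra).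
have l3 := hmax (x1 + 0)%R (y1 + s)%R ltac:(lra) ltac:(lra).
have l4 := hmax (x1 + 0)%R (y1 + - s)%R ltac:(lra) ltac:(lra).
rewrite /v -/p in l1 l2 l3 l4.
(* The increments s, -s, is, -is sum to 0, and so do their squares. Adding the four comparisons with
   the maximum leaves eta s^2 <= M s^3, against the choice of [s]. *)
have sumP : (Re (c1 * (s, 0%R) + c2 * ((s, 0%R) * (s, 0%R)))%C +
  Re (c1 * ((- s)%R, 0%R) + c2 * (((- s)%R, 0%R) * ((- s)%R, 0%R)))%C +
  Re (c1 * (0%R, s) + c2 * ((0%R, s) * (0%R, s)))%C +
  Re (c1 * (0%R, (- s)%R) + c2 * ((0%R, (- s)%R) * (0%R, (- s)%R)))%C = 0)%R.
  by rewrite /Re /=; ring.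
have fin : eta * (s * s) <= M * s ^ 3 by lra.
have fin2 : eta <= M * s.
  apply: (Rmult_le_reg_r (s * s)); first nra.
  by apply: Rle_trans fin _; apply: Req_le; ring.
have fin3 : s * (Rabs M + 1) <= eta / 2.
  apply: (Rle_trans _ (eta / (Rabs M + 1) / 2 * (Rabs M + 1))).
    by apply: Rmult_le_compat_r; lra.
  by apply: Req_le; field; lra.
have := Rle_abs M; nra.
Qed.

(** The real-part version is applied to F, -F, iF and -iF; |F| <= |Re F| + |Im F| costs the factor
    2. *)
Lemma has_2jets_max (F : C -> C) (c : C) (rho e : R) :
  has_2jets F -> 0 < rho ->
  (forall t, rho <= Cmod (t - c) <= 2 * rho -> Cmod (F t) <= e) ->
  forall t, Cmod (t - c) <= rho -> Cmod (F t) <= 2 * e.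
Proof.
move=> hF r0 hb t ht.
have aux s : Cmod s = 1%R -> Re (s * F t) <= e.
  move=> hs; apply: (has_2jets_re_max (fun t => s * F t) c rho e _ r0 _ t ht).
    exact: has_2jets_scal.
  move=> t' ht'; apply: Rle_trans (Rle_abs _) _; apply: Rle_trans (re_le_Cmod _) _.
  by rewrite Cmod_mult hs Rmult_1_l; apply: hb.
apply: Rle_trans (Cmod_le_Re_Im _) _.
have h1 := aux 1 Cmod_1.
have h2 := aux (- (1)) Cmod_m1.
have h3 := aux Ci Cmod_Ci.
have h4 : Cmod (- Ci) = 1%R by rewrite Cmod_opp Cmod_Ci.
have {}h4 := aux _ h4.
have e1 : Re (1 * F t) = Re (F t) by congr Re; ring.
have e2 : Re (- (1) * F t) = (- Re (F t))%R by rewrite /Re /=; ring.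
have e3 : Re (Ci * F t) = (- Im (F t))%R by rewrite /Re /Im /=; ring.
have e4 : Re (- Ci * F t) = (Im (F t))%R by rewrite /Re /Im /=; ring.
rewrite e1 in h1; rewrite e2 in h2; rewrite e3 in h3; rewrite e4 in h4.
by rewrite /Rabs; case: Rcase_abs; case: Rcase_abs => *; lra.
Qed.

(** [F p] is the limit of [H] at [p]. The expansion of [H] around [p] passes to [F], because F(p+h)
    is in turn a limit of values H(p+h+k) with p+h+k <> p. *)
Lemma jet3_extension (H : C -> C) :
  (forall p, jet 3 (fun h => H (p + h))) ->
  exists F : C -> C, has_2jets F /\ forall p, jetc 2 (F p) (fun h => H (p + h)).
Proof.
move=> hH.
pose F p := proj1_sig (constructive_indefinite_description _ (hH p)).
have hF p : jetc 2 (F p) (fun h => H (p + h)) :=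
  proj2_sig (constructive_indefinite_description _ (hH p)).
exists F; split=> // p.
have [g1 [[c1 [g2 [[c2 [g3 [[M hM] e3]]] e2]]] e1]] := hF p.
have [d [d0 hd]] := near0_and _ _ (near0_and _ _ hM e3) (near0_and _ _ e2 e1).
exists c1, c2, (8 * M)%R, (d / 2)%R; split; first lra.
move=> h hh.
case: (excluded_middle_informative (h = 0)) => [-> | h0].
  have -> : F (p + 0) - (F p + c1 * 0 + c2 * (0 * 0)) = 0.
    by rewrite Cplus_0_r; ring.
  by rewrite Cmod_0 /= Rmult_0_l Rmult_0_r; lra.
have hp : 0 < Cmod h by apply/Cmod_gt_0.
(* The quantity to bound is itself the limit, as k -> 0, of the remainder of [H] at h + k. For |k| <
   |h| one has |h + k| <= 2|h|, which explains the constants 8 M and d/2. *)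
have j : jetc 2 (F (p + h) - (F p + c1 * h + c2 * (h * h)))
    (fun k => H (p + h + k) - (F p + c1 * (h + k) + c2 * ((h + k) * (h + k)))).
  have j2 : jetc 2 (- (F p + c1 * h + c2 * (h * h)))
    (fun k => - (F p + c1 * (h + k) + c2 * ((h + k) * (h + k)))).
    exists (fun k => - (c1 + 2 * c2 * h) + k * (- c2)); split.
      by apply: jet_plus; [apply: jet_const | apply: jet_id_mult; apply: jet_const].
    by apply: near0_true => k _; ring.
  exact: jetc_plus (hF (p + h)) j2.
apply: (jetc_bound _ _ _ _ j).
apply: near0_mono (near0_lt _ hp) => k k0 hk.
have hk0 : h + k <> 0.
  move=> e; have : h = - k by rewrite -(Cplus_0_r (- k)) -e; ring.
  by move=> e'; move: hk; rewrite e' Cmod_opp; lra.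
have hk1 : Cmod (h + k) <= 2 * Cmod h by have := Cmod_triangle h k; lra.
have [[q1 q2] [q3 q4]] := hd (h + k) hk0 ltac:(lra).
rewrite Cplus_assoc in q4; rewrite q4 q3 q2.
set w := h + k in hk0 hk1 q1 *.
have -> : F p + w * (c1 + w * (c2 + w * g3 w)) - (F p + c1 * w + c2 * (w * w))
  = w ^ 3 * g3 w by rewrite /=; ring.
rewrite Cmod_mult Cmod_pow.
have M0 : 0 <= M by apply: Rle_trans q1; apply: Cmod_ge_0.
have := pow_incr _ _ 3 (conj (Cmod_ge_0 w) hk1) => hw.
apply: (Rle_trans _ ((2 * Cmod h) ^ 3 * M)).
  by apply: Rmult_le_compat => //; [apply: pow_le; apply: Cmod_ge_0 | apply: Cmod_ge_0].
by apply: Req_le; rewrite /=; ring.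
Qed.
End MaximumPrinciple.

(** * Sums over the nonzero integers *)

Section Sums.
Local Open Scope R_scope.
Local Open Scope C_scope.

Lemma ex_series_Re (u : nat -> C) :
  ex_series (fun n => Cmod (u n)) -> ex_series (fun n => Rabs (Re (u n))).
Proof.
move=> hu; apply: (ex_series_le (K := R_AbsRing) (V := R_CompleteNormedModule) _ _ _ hu) => n.
by rewrite /norm /= /abs /= Rabs_Rabsolu; apply: re_le_Cmod.
Qed.

Lemma ex_series_Im (u : nat -> C) :
  ex_series (fun n => Cmod (u n)) -> ex_series (fun n => Rabs (Im (u n))).
Proof.
move=> hu; apply: (ex_series_le (K := R_AbsRing) (V := R_CompleteNormedModule) _ _ _ hu) => n.
by rewrite /norm /= /abs /= Rabs_Rabsolu; apply: im_le_Cmod.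
Qed.

Lemma CSeries_ext (u v : nat -> C) : (forall n, u n = v n) -> CSeries u = CSeries v.
Proof. by move=> e; apply: C_eq; apply: Series_ext => n; rewrite e. Qed.

Lemma CSeries_plus (u v : nat -> C) :
  ex_series (fun n => Cmod (u n)) -> ex_series (fun n => Cmod (v n)) ->
  CSeries (fun n => u n + v n) = CSeries u + CSeries v.
Proof.
move=> hu hv; apply: C_eq; rewrite /CSeries /=.
  by rewrite -Series_plus //; apply: ex_series_Rabs; apply: ex_series_Re.
by rewrite -Series_plus //; apply: ex_series_Rabs; apply: ex_series_Im.
Qed.

Lemma CSeries_scal (c : C) (u : nat -> C) :
  ex_series (fun n => Cmod (u n)) -> CSeries (fun n => c * u n) = c * CSeries u.
Proof.
move=> hu.
have hr := ex_series_Rabs _ (ex_series_Re _ hu).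
have hi := ex_series_Rabs _ (ex_series_Im _ hu).
apply: C_eq; rewrite /CSeries /=.
  rewrite -!Series_scal_l -Series_minus //; first by apply: ex_series_scal_l.
  by apply: ex_series_scal_l.
rewrite -!Series_scal_l -Series_plus //; first by apply: ex_series_scal_l.
by apply: ex_series_scal_l.
Qed.

Lemma Cmod_CSeries_le (u : nat -> C) (b : nat -> R) :
  (forall n, Cmod (u n) <= b n) -> ex_series b -> Cmod (CSeries u) <= 2 * Series b.
Proof.
move=> hub hb.
have hu : ex_series (fun n => Cmod (u n)).
  apply: (ex_series_le (K := R_AbsRing) (V := R_CompleteNormedModule) _ _ _ hb) => n.
  by rewrite /norm /= /abs /= Rabs_pos_eq //; apply: Cmod_ge_0.
apply: Rle_trans (Cmod_le_Re_Im _) _.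
have h1 := Series_Rabs _ (ex_series_Re _ hu).
have h2 := Series_Rabs _ (ex_series_Im _ hu).
have h3 : Series (fun n => Rabs (Re (u n))) <= Series b.
  apply: Series_le => // n; split; first exact: Rabs_pos.
  exact: Rle_trans (re_le_Cmod _) (hub n).
have h4 : Series (fun n => Rabs (Im (u n))) <= Series b.
  apply: Series_le => // n; split; first exact: Rabs_pos.
  exact: Rle_trans (im_le_Cmod _) (hub n).
change (Rabs (Series (fun n => Re (u n))) + Rabs (Series (fun n => Im (u n)))
  <= 2 * Series b).
lra.
Qed.

Lemma Series_single (u : nat -> R) (m : nat) :
  (forall n, n <> m -> u n = 0%R) -> Series u = u m.
Proof.
move=> hu; apply: is_series_unique.
apply: (filterlim_ext_loc (fun _ => u m)); last exact: filterlim_const.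
have h n : sum_n u n = if (n < m)%nat then 0%R else u m.
  elim: n => [|n IH].
    by rewrite sum_O; case: ltnP => [/ltP h|]; [apply: hu; lia | rewrite leqn0 => /eqP ->].
  rewrite sum_Sn IH /plus /=; case: (ltngtP n.+1 m) => h.
  - have -> : u n.+1 = 0%R by apply: hu; move/ltP: h; lia.
    by rewrite Rplus_0_r.
  - have -> : u n.+1 = 0%R by apply: hu; move/ltP: h; lia.
    by rewrite Rplus_0_r.
  - by rewrite -h Rplus_0_l.
by exists m => n hn; rewrite h; case: ltnP => // /ltP; lia.
Qed.

Lemma summable_nz_le (f g : Z -> C) (K : R) :
  (forall n, n <> 0%Z -> Cmod (f n) <= K * Cmod (g n)) -> summable_nz g -> summable_nz f.
Proof.
move=> h [h1 h2]; split.
  apply: (ex_series_le (K := R_AbsRing) (V := R_CompleteNormedModule) _ _ _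
    (ex_series_scal_l K _ h1)) => n.
  rewrite /norm /= /abs /= Rabs_pos_eq; last exact: Cmod_ge_0.
  by apply: h; lia.
apply: (ex_series_le (K := R_AbsRing) (V := R_CompleteNormedModule) _ _ _
  (ex_series_scal_l K _ h2)) => n.
rewrite /norm /= /abs /= Rabs_pos_eq; last exact: Cmod_ge_0.
by apply: h; lia.
Qed.

Lemma summable_nz_plus (f g : Z -> C) :
  summable_nz f -> summable_nz g -> summable_nz (fun n => f n + g n).
Proof.
move=> [h1 h2] [k1 k2]; split.
  apply: (ex_series_le (K := R_AbsRing) (V := R_CompleteNormedModule) _ _ _
    (ex_series_plus _ _ h1 k1)) => n.
  rewrite /norm /= /abs /= Rabs_pos_eq; [exact: Cmod_triangle | exact: Cmod_ge_0].
apply: (ex_series_le (K := R_AbsRing) (V := R_CompleteNormedModule) _ _ _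
  (ex_series_plus _ _ h2 k2)) => n.
rewrite /norm /= /abs /= Rabs_pos_eq; [exact: Cmod_triangle | exact: Cmod_ge_0].
Qed.

Lemma sum_nz_ext (f g : Z -> C) :
  (forall n, n <> 0%Z -> f n = g n) -> sum_nz f = sum_nz g.
Proof.
by move=> e; rewrite /sum_nz; congr (_ + _); apply: CSeries_ext => n; apply: e; lia.
Qed.

Lemma sum_nz_plus (f g : Z -> C) : summable_nz f -> summable_nz g ->
  sum_nz (fun n => f n + g n) = sum_nz f + sum_nz g.
Proof.
move=> [? ?] [? ?]; rewrite /sum_nz.
rewrite (CSeries_plus (fun n => f (Z.of_nat n.+1)) (fun n => g (Z.of_nat n.+1))) //.
rewrite (CSeries_plus (fun n => f (- Z.of_nat n.+1)%Z) (fun n => g (- Z.of_nat n.+1)%Z)) //.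
by ring.
Qed.

Lemma sum_nz_scal (c : C) (f : Z -> C) : summable_nz f ->
  sum_nz (fun n => c * f n) = c * sum_nz f.
Proof.
move=> [? ?]; rewrite /sum_nz.
rewrite (CSeries_scal c (fun n => f (Z.of_nat n.+1))) //.
rewrite (CSeries_scal c (fun n => f (- Z.of_nat n.+1)%Z)) //.
by ring.
Qed.

(** [M] depends on the weights alone; with [K] a bound for the denominators this gives estimates
    uniform in the variable t. *)
Lemma sum_nz_bound (w : Z -> C) : summable_nz w ->
  exists M, 0 <= M /\ forall K f,
    (forall n, n <> 0%Z -> Cmod (f n) <= K * Cmod (w n)) -> Cmod (sum_nz f) <= K * M.
Proof.
move=> [h1 h2].
exists (2 * (Series (fun n => Cmod (w (Z.of_nat n.+1))) +
  Series (fun n => Cmod (w (- Z.of_nat n.+1)%Z))))%R; split.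
  have := Series_le (fun _ => 0%R) _ (fun n => conj (Rle_refl _) (Cmod_ge_0 _)) h1.
  have := Series_le (fun _ => 0%R) _ (fun n => conj (Rle_refl _) (Cmod_ge_0 _)) h2.
  rewrite (Series_single (fun=> 0%R) 0) //; lra.
move=> K f hf; apply: Rle_trans (Cmod_triangle _ _) _.
have k1 := Cmod_CSeries_le (fun n => f (Z.of_nat n.+1)) (fun n => K * Cmod (w (Z.of_nat n.+1)))%R
   (fun n => hf (Z.of_nat n.+1) ltac:(lia)) (ex_series_scal_l K _ h1).
have k2 := Cmod_CSeries_le (fun n => f (- Z.of_nat n.+1)%Z) (fun n => K * Cmod (w (- Z.of_nat n.+1)%Z))%R
   (fun n => hf (- Z.of_nat n.+1)%Z ltac:(lia)) (ex_series_scal_l K _ h2).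
rewrite !Series_scal_l in k1 k2; lra.
Qed.

Lemma CSeries_single (u : nat -> C) (m : nat) :
  (forall n, n <> m -> u n = 0) -> CSeries u = u m.
Proof.
by move=> hu; apply: C_eq; rewrite /CSeries /= (Series_single _ m) // => n /hu ->.
Qed.

Lemma sum_nz_single (f : Z -> C) (m : Z) : m <> 0%Z ->
  (forall n, n <> m -> f n = 0) -> sum_nz f = f m.
Proof.
move=> m0 hf; rewrite /sum_nz.
have [hm | hm] : (0 < m)%Z \/ (m < 0)%Z by lia.
  rewrite (CSeries_single _ (Z.to_nat (m - 1))); last by move=> n hn; apply: hf; lia.
  rewrite (CSeries_single _ 0) => [|n _]; last by apply: hf; lia.
  rewrite [f (- _)%Z]hf; last by lia.
  rewrite Cplus_0_r; congr f; lia.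
rewrite (CSeries_single _ 0) => [|n _]; last by apply: hf; lia.
rewrite (CSeries_single _ (Z.to_nat (- m - 1))); last by move=> n hn; apply: hf; lia.
rewrite [f (Z.of_nat 1)]hf; last by lia.
rewrite Cplus_0_l; congr f; lia.
Qed.

(** Turns positive constants found for each index into one common constant: the minimum works since
    [Q] survives shrinking. *)
Lemma fin_pos_bound (I : finType) (Q : I -> R -> Prop) :
  (forall i, exists d, 0 < d /\ Q i d) ->
  (forall i d e, 0 < e -> e <= d -> Q i d -> Q i e) ->
  exists d, 0 < d /\ forall i, Q i d.
Proof.
move=> hQ mono.
have : forall s : seq I, exists d, 0 < d /\ forall i, i \in s -> Q i d.
  elim=> [|i s [d [d0 hd]]]; first by exists 1%R; split; [lra|].
  have [e [e0 he]] := hQ i; exists (Rmin d e); split; first exact: Rmin_pos.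
  move=> j; rewrite inE => /orP [/eqP -> | hj].
    by apply: mono he; [apply: Rmin_pos | apply: Rmin_r].
  by apply: mono (hd j hj); [apply: Rmin_pos | apply: Rmin_l].
move=> /(_ (enum I)) [d [d0 hd]]; exists d; split=> // i.
by apply: hd; rewrite mem_enum.
Qed.

Variable r : nat.
Implicit Types (w p f g : 'I_r -> Z -> C).

Definition Tsum f : C := \big[Cplus/RtoC 0]_(k < r) sum_nz (f k).

Definition Tsummable f : Prop := forall k, summable_nz (f k).

Lemma Tsummable_le f g (K : R) :
  (forall k n, n <> 0%Z -> Cmod (f k n) <= K * Cmod (g k n)) -> Tsummable g -> Tsummable f.
Proof. by move=> h hg k; apply: summable_nz_le (h k) (hg k). Qed.

Lemma Tsum_ext f g : (forall k n, n <> 0%Z -> f k n = g k n) -> Tsum f = Tsum g.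
Proof. by move=> e; apply: eq_bigr => k _; apply: sum_nz_ext; apply: e. Qed.

Lemma Tsum_plus f g : Tsummable f -> Tsummable g ->
  Tsum (fun k n => f k n + g k n) = Tsum f + Tsum g.
Proof.
move=> hf hg; rewrite /Tsum -big_split /=; apply: eq_bigr => k _.
exact: sum_nz_plus.
Qed.

Lemma Tsum_scal (c : C) f : Tsummable f -> Tsum (fun k n => c * f k n) = c * Tsum f.
Proof.
move=> hf; rewrite /Tsum -Csum_scal; apply: eq_bigr => k _.
exact: sum_nz_scal.
Qed.

Lemma Cmod_Csum_le (I : finType) (F : I -> C) (K : R) (M : I -> R) :
  (forall i, Cmod (F i) <= K * M i) ->
  Cmod (\big[Cplus/RtoC 0]_i F i) <= K * \big[Rplus/0%R]_i M i.
Proof.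
move=> h; rewrite unlock /reducebig /=; elim: index_enum => [|i s IH] /=.
  by rewrite Cmod_0; lra.
apply: Rle_trans (Cmod_triangle _ _) _; have := h i; lra.
Qed.

Lemma Tsum_bound w : Tsummable w ->
  exists M, 0 <= M /\ forall K f,
    (forall k n, n <> 0%Z -> Cmod (f k n) <= K * Cmod (w k n)) -> Cmod (Tsum f) <= K * M.
Proof.
move=> hw.
pose c k := constructive_indefinite_description _ (sum_nz_bound _ (hw k)).
exists (\big[Rplus/0%R]_(k < r) proj1_sig (c k)); split.
  rewrite unlock /reducebig /=; elim: index_enum => [|k s IH] /=; first lra.
  by have := proj1 (proj2_sig (c k)); lra.
move=> K f hf; apply: Cmod_Csum_le => k.
by apply: (proj2 (proj2_sig (c k))); apply: hf.
Qed.

Lemma Tsum_single f (k0 : 'I_r) (n0 : Z) : n0 <> 0%Z ->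
  (forall k n, k <> k0 \/ n <> n0 -> f k n = 0) -> Tsum f = f k0 n0.
Proof.
move=> hn hf; rewrite /Tsum (bigD1 k0) //= (sum_nz_single _ n0) //; last first.
  by move=> n ?; apply: hf; right.
rewrite big1 ?Cplus_0_r // => k /eqP hk.
rewrite (sum_nz_single _ n0) //; first by apply: hf; left.
by move=> n _; apply: hf; left.
Qed.

(* The denominator may vanish when the weight does: this is how a single pole is
   taken out of a sum of polar parts. *)
Lemma Cmod_weight_div_le (c t : C) (d : R) : 0 < d -> (c <> 0 -> d <= Cmod t) ->
  Cmod (c / t) <= / d * Cmod c.
Proof.
move=> d0 h; case: (excluded_middle_informative (c = 0)) => [-> | c0].
  by rewrite /Cdiv Cmult_0_l Cmod_0; lra.
have ht := h c0.
have t0 : t <> 0 by apply/Cmod_gt_0; lra.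
rewrite Cmod_div // /Rdiv Rmult_comm; apply: Rmult_le_compat_r; first exact: Cmod_ge_0.
exact: Rinv_le_contravar.
Qed.

(** Termwise 1/(x+h) = 1/x - h/(x (x+h)) with x = p0 - p. The remainder is again a polar sum, with
    weights -w/x, so iterating yields expansions of every order. *)
Lemma Tsum_expand w p (p0 : C) (d : R) :
  Tsummable w -> 0 < d ->
  (forall k n, n <> 0%Z -> w k n <> 0 -> d <= Cmod (p0 - p k n)) ->
  Tsummable (fun k n => - (w k n / (p0 - p k n))) /\
  near0 (fun h => Tsum (fun k n => w k n / (p0 + h - p k n)) =
    Tsum (fun k n => w k n / (p0 - p k n)) +
    h * Tsum (fun k n => - (w k n / (p0 - p k n)) / (p0 + h - p k n))).
Proof.
move=> hw d0 hd.
have hw1 : Tsummable (fun k n => - (w k n / (p0 - p k n))).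
  apply: Tsummable_le hw => k n n0; rewrite Cmod_opp; apply: Cmod_weight_div_le d0 _.
  exact: hd.
split=> //.
apply: near0_mono (near0_lt (d / 2) ltac:(lra)) => h h0 hh.
have far k n : n <> 0%Z -> w k n <> 0 -> d / 2 <= Cmod (p0 + h - p k n).
  move=> n0 w0; have := hd k n n0 w0.
  have := Cmod_sub_rev (p0 - p k n) (- h).
  have -> : p0 - p k n - - h = p0 + h - p k n by ring.
  rewrite Cmod_opp; lra.
have hw2 : Tsummable (fun k n => - (w k n / (p0 - p k n)) / (p0 + h - p k n)).
  apply: Tsummable_le hw1 => k n n0; apply: Cmod_weight_div_le (_ : 0 < d / 2) _; first lra.
  move=> h1; apply: far => // e; apply: h1.
  by rewrite e /Cdiv; ring.
rewrite -Tsum_scal // -Tsum_plus.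
- apply: Tsum_ext => k n n0.
  case: (excluded_middle_informative (w k n = 0)) => [-> | w0].
    by rewrite /Cdiv; ring.
  have h1 : p0 - p k n <> 0 by apply/Cmod_gt_0; have := hd k n n0 w0; lra.
  have h2 : p0 + h - p k n <> 0 by apply/Cmod_gt_0; have := far k n n0 w0; lra.
  by field.
- by apply: Tsummable_le hw => k n n0; apply: Cmod_weight_div_le d0 _; apply: hd.
- apply: (Tsummable_le _ _ (Cmod h)) hw2 => k n n0.
  by rewrite Cmod_mult; lra.
Qed.

Lemma Tsum_jet (N : nat) w p (p0 : C) (d : R) :
  Tsummable w -> 0 < d ->
  (forall k n, n <> 0%Z -> w k n <> 0 -> d <= Cmod (p0 - p k n)) ->
  jet N (fun h => Tsum (fun k n => w k n / (p0 + h - p k n))).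
Proof.
move=> hw d0; elim: N w hw => [|N IH] w hw hd.
  have [M [M0 hM]] := Tsum_bound _ hw.
  exists (/ (d / 2) * M)%R; apply: near0_mono (near0_lt (d / 2) ltac:(lra)) => h h0 hh.
  apply: hM => k n n0; apply: Cmod_weight_div_le; first lra.
  move=> w0; have := hd k n n0 w0.
  have := Cmod_sub_rev (p0 - p k n) (- h).
  have -> : p0 - p k n - - h = p0 + h - p k n by ring.
  rewrite Cmod_opp; lra.
have [hw1 e] := Tsum_expand _ _ _ _ hw d0 hd.
exists (Tsum (fun k n => w k n / (p0 - p k n))),
  (fun h => Tsum (fun k n => - (w k n / (p0 - p k n)) / (p0 + h - p k n))).
split=> //; apply: IH => // k n n0 h1; apply: hd => // e'; apply: h1.
by rewrite e' /Cdiv; ring.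
Qed.

Lemma Tsum_jetc (N : nat) w p (p0 : C) (d : R) :
  Tsummable w -> 0 < d ->
  (forall k n, n <> 0%Z -> w k n <> 0 -> d <= Cmod (p0 - p k n)) ->
  jetc N (Tsum (fun k n => w k n / (p0 - p k n)))
    (fun h => Tsum (fun k n => w k n / (p0 + h - p k n))).
Proof.
move=> hw d0 hd; have [hw1 e] := Tsum_expand _ _ _ _ hw d0 hd.
exists (fun h => Tsum (fun k n => - (w k n / (p0 - p k n)) / (p0 + h - p k n))).
split=> //; apply: Tsum_jet hw1 d0 _ => k n n0 h1; apply: hd => // e'; apply: h1.
by rewrite e' /Cdiv; ring.
Qed.

(** Termwise 1/(t-p) = (1 + p/(t-p))/t. The distance [d] may depend on t: it only serves
    summability. *)
Lemma Tsum_far w p (t : C) (d : R) : t <> 0 -> 0 < d ->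
  Tsummable w -> Tsummable (fun k n => w k n * p k n) ->
  (forall k n, n <> 0%Z -> d <= Cmod (t - p k n)) ->
  Tsum (fun k n => w k n / (t - p k n)) =
  (Tsum w + Tsum (fun k n => w k n * p k n / (t - p k n))) / t.
Proof.
move=> t0 d0 hw hwp hd.
have hs : Tsummable (fun k n => w k n * p k n / (t - p k n)).
  apply: Tsummable_le hwp => k n n0; apply: Cmod_weight_div_le d0 _ => _; exact: hd.
rewrite -Tsum_plus //.
set S := Tsum (fun k n => w k n + _).
have -> : S / t = / t * S by rewrite /Cdiv Cmult_comm.
rewrite -Tsum_scal; last by move=> k; apply: summable_nz_plus.
apply: Tsum_ext => k n n0.
have h1 : t - p k n <> 0 by apply/Cmod_gt_0; have := hd k n n0; lra.
by field.
Qed.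

End Sums.

(** * Lower bounds for |e^s - 1| at a distance from its zeros *)

Section ExponentialBounds.
Local Open Scope R_scope.
Local Open Scope C_scope.

Lemma nearest_period (y : R) : exists n : Z, Rabs (y - 2 * PI * IZR n) <= PI.
Proof.
have p0 := PI_RGT_0.
pose q := (y / (2 * PI) + / 2)%R.
have [h1 h2] := archimed q.
(* Since [up q] exceeds q by at most 1, this rounds y/(2 pi) to a nearest integer. *)
exists (up q - 1)%Z; rewrite minus_IZR.
have e : (y = (q - / 2) * (2 * PI))%R by rewrite /q; field; lra.
by apply: Rabs_le; split; rewrite e; nra.
Qed.

Lemma Re_sub_ipole (s : C) (n : Z) : Re (s - ipole n) = Re s.
Proof. by rewrite ipoleE /Re /=; ring. Qed.

Lemma Im_sub_ipole (s : C) (n : Z) : Im (s - ipole n) = (Im s - 2 * PI * IZR n)%R.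
Proof. by rewrite ipoleE /Im /=; ring. Qed.

(** Only the nearest point 2 pi i m can be close to s, the others being at distance at least pi. The
    condition s <> [ipole n] lets s itself be one of these points. *)
Lemma ipole_dist (s : C) :
  exists d, 0 < d /\ forall n, s <> ipole n -> d <= Cmod (s - ipole n).
Proof.
have p0 := PI_RGT_0.
have [m hm] := nearest_period (Im s).
have far n : n <> m -> PI <= Cmod (s - ipole n).
  move=> hn; apply: Rle_trans (im_le_Cmod _); rewrite Im_sub_ipole.
  have h : 1 <= Rabs (IZR (n - m)).
    by rewrite Rabs_Zabs; apply: IZR_le; lia.
  have h2 : (2 * PI <= Rabs (2 * PI * IZR (n - m)))%R.
    by rewrite Rabs_mult (Rabs_pos_eq (2 * PI)); [nra | lra].
  have := Rabs_triang_inv (2 * PI * IZR (n - m)) (Im s - 2 * PI * IZR m).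
  rewrite minus_IZR in h2 *.
  have -> : (2 * PI * (IZR n - IZR m) - (Im s - 2 * PI * IZR m) = - (Im s - 2 * PI * IZR n))%R by ring.
  by rewrite Rabs_Ropp; lra.
case: (excluded_middle_informative (s = ipole m)) => [e | ne].
  exists PI; split=> // n hn; apply: far => e'; apply: hn; by rewrite e e'.
have hp : 0 < Cmod (s - ipole m).
  by apply/Cmod_gt_0 => e; apply: ne; rewrite -(Cplus_0_l (ipole m)) -e; ring.
exists (Rmin PI (Cmod (s - ipole m))); split; first exact: Rmin_pos.
move=> n hn; case: (Z.eq_dec n m) => [-> | nm]; first exact: Rmin_r.
exact: Rle_trans (Rmin_l _ _) (far n nm).
Qed.

Lemma Cmod_Cexp_sub1_sq (s : C) :
  (Cmod (Cexp s - 1) ^ 2 = (exp (Re s) - 1) ^ 2 + 2 * exp (Re s) * (1 - cos (Im s)))%R.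
Proof.
rewrite Cmod2_alt /Cexp /Re /Im /=.
have := sin2_cos2 (snd s); rewrite /Rsqr => h.
set E := exp _; set c := cos _; set si := sin _.
have hh : (si * si = 1 - c * c)%R by rewrite /si /c; lra.
transitivity (E * E * (c * c) - 2 * E * c + 1 + E * E * (si * si))%R; first ring.
rewrite hh; ring.
Qed.

(** After reducing Im s to y modulo 2 pi, either |y| or |Re s| is at least e. In the first case the
    cosine term of |e^s - 1|^2 is bounded below, in the second |e^s - 1| >= |e^(Re s) - 1| suffices.
    The two bounds serve Re s < 0 and Re s >= 0 in [gfun_bound]. *)
Lemma Cexp_sub1_lower (d : R) : 0 < d -> exists K, 0 < K /\ forall s,
  (forall n, d <= Cmod (s - ipole n)) ->
  K <= Cmod (Cexp s - 1) /\ K * exp (Re s) <= Cmod (Cexp s - 1).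
Proof.
move=> d0; have p0 := PI_RGT_0.
(* As |Re s| + |y| >= d, one of the two is at least d/2. The cap 1 < pi keeps e in the range where
   cos decreases. *)
pose e := Rmin (d / 2) 1.
have e0 : 0 < e by apply: Rmin_pos; lra.
have e1 : e <= 1 by apply: Rmin_r.
have e2 : e <= d / 2 by apply: Rmin_l.
have ePI : e < PI by have := PI2_1; lra.
pose k := ((1 - cos e) / 2)%R.
have ce : cos e < 1 by rewrite -cos_0; apply: cos_decreasing_1; lra.
have k0 : 0 < k by rewrite /k; lra.
have k1 : k <= 1 by have := COS_bound e; rewrite /k; lra.
pose l := (1 - exp (- e))%R.
have l0 : 0 < l.
  by have := exp_increasing (- e) 0 ltac:(lra); rewrite exp_0 /l; lra.
exists (Rmin k l); split; first exact: Rmin_pos.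
move=> s hs; have E0 := exp_pos (Re s).
have [n hn] := nearest_period (Im s).
have hd := Rle_trans _ _ _ (hs n) (Cmod_le_Re_Im _).
rewrite Re_sub_ipole Im_sub_ipole in hd.
set y := (Im s - 2 * PI * IZR n)%R in hn hd.
have yE : cos (Im s) = cos y.
  by rewrite -(cos_2PI_Z y n); congr cos; rewrite /y; ring.
suff h : k * (exp (Re s) + 1) <= Cmod (Cexp s - 1) \/
    (l <= Cmod (Cexp s - 1) /\ l * exp (Re s) <= Cmod (Cexp s - 1)).
  have ml := Rmin_l k l; have mr := Rmin_r k l.
  case: h => [h | [h1 h2]]; split; try lra.
    by have := Rmult_le_compat_r _ _ _ (Rlt_le _ _ E0) ml; nra.
  by have := Rmult_le_compat_r _ _ _ (Rlt_le _ _ E0) ml; nra.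
  by have := Rmult_le_compat_r _ _ _ (Rlt_le _ _ E0) mr; lra.
have [hy | hy] := Rle_lt_dec e (Rabs y).
  left.
  have cy : cos (Im s) <= cos e.
    rewrite yE; have -> : cos y = cos (Rabs y).
      by rewrite /Rabs; case: Rcase_abs => // _; rewrite cos_neg.
    have := Rabs_pos y => ?.
    by apply: cos_decr_1; lra.
  (* With E = e^(Re s), 1 - cos(Im s) >= 2k and k <= 1: (E-1)^2 + 4kE >= k (E-1)^2 + 4kE = k (E+1)^2
     >= k^2 (E+1)^2. *)
  have hsq : k * (exp (Re s) + 1) * (k * (exp (Re s) + 1)) <= Cmod (Cexp s - 1) ^ 2.
    rewrite Cmod_Cexp_sub1_sq; set E := exp _ in E0 *.
    have h1 : 2 * E * (2 * k) <= 2 * E * (1 - cos (Im s)).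
      by apply: Rmult_le_compat_l; rewrite /k; lra.
    have h2 : k * (E - 1) ^ 2 <= 1 * (E - 1) ^ 2.
      by apply: Rmult_le_compat_r => //; apply: pow2_ge_0.
    have h3 : k * ((E + 1) * (E + 1)) * k <= k * ((E + 1) * (E + 1)) * 1.
      by apply: Rmult_le_compat_l => //; nra.
    nra.
  apply: Rnot_lt_le => hlt; have := Cmod_ge_0 (Cexp s - 1); nra.
right.
have hx : e <= Rabs (Re s) by lra.
have hle : Rabs (exp (Re s) - 1) <= Cmod (Cexp s - 1).
  rewrite -(Rabs_pos_eq _ (Cmod_ge_0 (Cexp s - 1))).
  apply: Rsqr_le_abs_0; rewrite 2!Rsqr_pow2 Cmod_Cexp_sub1_sq.
  have := COS_bound (Im s); nra.
have hl := exp_increasing.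
have [x0 | x0] := Rle_lt_dec 0 (Re s).
  rewrite (Rabs_pos_eq (Re s)) // in hx.
  have h1 : exp (- Re s) <= exp (- e).
    case: (Rle_lt_or_eq_dec _ _ hx) => [?| ->]; last lra.
    by apply: Rlt_le; apply: exp_increasing; lra.
  have h2 : (exp (Re s) * exp (- Re s) = 1)%R.
    by rewrite -exp_plus Rplus_opp_r exp_0.
  have h3 := Rmult_le_compat_l _ _ _ (Rlt_le _ _ E0) h1.
  have h4 := Rle_abs (exp (Re s) - 1).
  have h5 : 1 <= exp (Re s).
    rewrite -exp_0; case: (Rle_lt_or_eq_dec _ _ x0) => [?| <-]; last lra.
    by apply: Rlt_le; apply: exp_increasing.
  by rewrite /l in l0 *; split; nra.
rewrite Rabs_left // in hx.
have h1 : exp (Re s) <= exp (- e).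
  case: (Rle_lt_or_eq_dec _ _ hx) => [?| ->]; last by rewrite Ropp_involutive; lra.
  by apply: Rlt_le; apply: exp_increasing; lra.
have h4 := Rabs_maj2 (exp (Re s) - 1).
by rewrite /l in l0 *; split; nra.
Qed.

Lemma Cexp_eq1 (s : C) : Cexp s = 1 -> exists n, s = ipole n.
Proof.
move=> e; apply: NNPP => hn.
have [d [d0 hd]] := ipole_dist s.
have [|K [K0 /(_ s) hK]] := Cexp_sub1_lower d; first exact: d0.
have [|h _] := hK; first by move=> n; apply: hd => e'; apply: hn; exists n.
move: h; rewrite e.
have -> : RtoC 1 - 1 = 0 by ring.
by rewrite Cmod_0; lra.
Qed.

Definition gfun (a s : C) : C := Cexp (a * s) / (Cexp s - 1).

(** For Re s >= 0 the denominator grows like e^(Re s) and the quotient decays with rate 1 - a; for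
    Re s < 0 the denominator is bounded below and the rate is a. The margin [c] is below both. *)
Lemma gfun_bound (d : R) : 0 < d -> exists K, 0 < K /\ forall (a c : R) (s : C), c <= a -> c <= 1 - a ->
  (forall n, d <= Cmod (s - ipole n)) ->
  Cmod (gfun (RtoC a) s) <= K * exp (- c * Rabs (Re s)).
Proof.
move=> d0; have [K [K0 hK]] := Cexp_sub1_lower d d0.
exists (/ K)%R; split; first exact: Rinv_0_lt_compat.
move=> a c s ca ca1 hs; have [h1 h2] := hK s hs.
have hexp x y : x <= y -> exp x <= exp y.
  case/Rle_lt_or_eq_dec => [?| ->]; last lra.
  by apply: Rlt_le; apply: exp_increasing.
have E0 := exp_pos (Re s).
have nz : Cexp s - 1 <> 0 by apply/Cmod_gt_0; lra.
rewrite /gfun Cmod_div // Cmod_Cexp.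
have -> : Re (RtoC a * s) = (a * Re s)%R by rewrite /Re /=; ring.
apply/Rle_div_l; first lra.
have [x0 | x0] := Rle_lt_dec 0 (Re s).
  rewrite Rabs_pos_eq //.
  apply: (Rle_trans _ (/ K * exp (- c * Re s) * (K * exp (Re s)))).
    have -> : (/ K * exp (- c * Re s) * (K * exp (Re s)) = exp (- c * Re s) * exp (Re s))%R.
      by field; lra.
    by rewrite -exp_plus; apply: hexp; nra.
  apply: Rmult_le_compat_l => //; apply: Rlt_le.
  by apply: Rmult_lt_0_compat; [apply: Rinv_0_lt_compat | apply: exp_pos].
rewrite Rabs_left //.
apply: (Rle_trans _ (/ K * exp (- c * - Re s) * K)).
  have -> : (/ K * exp (- c * - Re s) * K = exp (- c * - Re s))%R.
    by field; lra.
  by apply: hexp; nra.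
apply: Rmult_le_compat_l => //; apply: Rlt_le.
by apply: Rmult_lt_0_compat; [apply: Rinv_0_lt_compat | apply: exp_pos].
Qed.
End ExponentialBounds.

(** * Decay estimates *)

Section Decay.
Local Open Scope R_scope.
Local Open Scope C_scope.

Lemma Cmod_prod_le (I : finType) (P : pred I) (f : I -> C) (A : R) : 1 <= A ->
  (forall i, P i -> Cmod (f i) <= A) ->
  Cmod (\big[Cmult/RtoC 1]_(i | P i) f i) <= A ^ size (index_enum I).
Proof.
move=> A1 h; rewrite unlock /reducebig.
elim: (index_enum I) => [|i s IH] /=; first by rewrite Cmod_1; lra.
have As : 1 <= A ^ size s by apply: pow_R1_Rle.
case: (boolP (P i)) => hi; last by nra.
rewrite Cmod_mult; apply: Rmult_le_compat => //; try exact: Cmod_ge_0.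
exact: h.
Qed.

(** One decaying factor makes the whole product decay, the others being merely bounded. *)
Lemma Cmod_prod_small (I : finType) (P : pred I) (f : I -> C) (A : R) (j : I) :
  1 <= A -> P j -> (forall i, P i -> Cmod (f i) <= A) ->
  Cmod (\big[Cmult/RtoC 1]_(i | P i) f i) <= A ^ size (index_enum I) * Cmod (f j).
Proof.
move=> A1 Pj h; rewrite (bigD1 j) //= Cmod_mult Rmult_comm.
apply: Rmult_le_compat_r; first exact: Cmod_ge_0.
by apply: Cmod_prod_le => // i /andP [hi _]; apply: h.
Qed.

Lemma exp_le_compat (x y : R) : x <= y -> exp x <= exp y.
Proof.
case/Rle_lt_or_eq_dec => [?| ->]; last lra.
by apply: Rlt_le; apply: exp_increasing.
Qed.

(** Each power of x is absorbed by half of the remaining exponential: x e^(-bx/2) <= 2/b, from 1 + u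
    <= e^u. *)
Lemma pow_exp_bound (m : nat) (b : R) : 0 < b ->
  exists K, 0 < K /\ forall x, 0 <= x -> x ^ m * exp (- b * x) <= K.
Proof.
elim: m b => [|m IH] b b0.
  exists 1%R; split; first lra.
  move=> x x0; rewrite /= Rmult_1_l -exp_0; apply: exp_le_compat; nra.
have [K [K0 hK]] := IH (b / 2)%R ltac:(lra).
exists (K * (2 / b))%R; split.
  by apply: Rmult_lt_0_compat => //; apply: Rdiv_lt_0_compat; lra.
move=> x x0.
have -> : (x ^ m.+1 * exp (- b * x) = x ^ m * exp (- (b / 2) * x) * (x * exp (- (b / 2) * x)))%R.
  have -> : (- b * x = - (b / 2) * x + - (b / 2) * x)%R by field.
  by rewrite exp_plus /=; ring.
have e0 := exp_pos (- (b / 2) * x).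
apply: Rmult_le_compat; [| by nra | exact: hK |].
  by apply: Rmult_le_pos; [apply: pow_le | lra].
have h1 := exp_ineq1_le (b / 2 * x).
have h2 : (exp (b / 2 * x) * exp (- (b / 2) * x) = 1)%R.
  by rewrite -exp_plus -exp_0; congr exp; ring.
have -> : (2 / b = 2 / b * (exp (b / 2 * x) * exp (- (b / 2) * x)))%R by rewrite h2; field; lra.
rewrite -Rmult_assoc; apply: Rmult_le_compat_r; first lra.
apply: (Rle_trans _ (2 / b * (b / 2 * x))); first by apply: Req_le; field; lra.
by apply: Rmult_le_compat_l; [apply: Rlt_le; apply: Rdiv_lt_0_compat; lra | lra].
Qed.

Lemma summable_nz_decay (f : Z -> C) (K b : R) : 0 < b ->
  (forall n, n <> 0%Z -> Cmod (f n) <= K * exp (- b * Rabs (IZR n))) -> summable_nz f.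
Proof.
move=> b0 hf.
have q0 := exp_pos (- b).
have q1 : exp (- b) < 1 by rewrite -exp_0; apply: exp_increasing; lra.
have hq n : (exp (- b * Rabs (IZR (Z.of_nat n.+1))) = exp (- b) * exp (- b) ^ n)%R.
  have -> : (exp (- b) * exp (- b) ^ n = exp (- b) ^ n.+1)%R by [].
  rewrite -INR_IZR_INZ Rabs_pos_eq; last exact: pos_INR.
  elim: n.+1 => [|k IH]; first by rewrite Rmult_0_r exp_0.
  by rewrite S_INR /= -IH -exp_plus; congr exp; ring.
have hs : ex_series (fun n => K * (exp (- b) * exp (- b) ^ n))%R.
  apply: ex_series_scal_l; apply: ex_series_scal_l; apply: ex_series_geom.
  by rewrite Rabs_pos_eq; lra.
split; apply: (ex_series_le (K := R_AbsRing) (V := R_CompleteNormedModule) _ _ _ hs) => n.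
  rewrite /norm /= /abs /= Rabs_pos_eq; last exact: Cmod_ge_0.
  by rewrite -(hq n); apply: hf; lia.
rewrite /norm /= /abs /= Rabs_pos_eq; last exact: Cmod_ge_0.
rewrite -(hq n) -Rabs_Ropp -opp_IZR; apply: hf; lia.
Qed.

Lemma Cinv_neq0 (x : C) : x <> 0 -> / x <> 0.
Proof. by move=> x0 e; have := Cinv_r _ x0; rewrite e Cmult_0_r => /RtoC_inj; lra. Qed.

Lemma Czpow_neq0 (x : C) (e : Z) : x <> 0 -> Czpow x e <> 0.
Proof.
by move=> x0; case: e => [|q|q] /=; [move=> /RtoC_inj; lra | apply: Cpow_nz |
  apply: Cinv_neq0; apply: Cpow_nz].
Qed.

Lemma Czpow_mult (x y : C) (e : Z) : x <> 0 -> y <> 0 ->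
  Czpow (x * y) e = Czpow x e * Czpow y e.
Proof.
move=> x0 y0; case: e => [|q|q] /=; first ring.
  by rewrite Cpow_mult_l.
by rewrite Cpow_mult_l; field; split; apply: Cpow_nz.
Qed.

Lemma Czpow_succ (x : C) (e : Z) : x <> 0 -> Czpow x (e + 1) = Czpow x e * x.
Proof.
move=> x0; case: (Z_lt_le_dec e (-1)) => h.
  have [q hq] : exists q, e = Zneg (Pos.succ q).
    by case: e h => [|q|q] h; try lia; exists (Pos.pred q); congr Zneg; lia.
  have -> : (e + 1 = Zneg q)%Z by lia.
  rewrite hq /= Pos2Nat.inj_succ Cpow_S.
  by have := Cpow_nz _ (Pos.to_nat q) x0 => ?; field.
case: (Z.eq_dec e (-1)) => [-> | h'].
  by rewrite /= ; field.
case: e h h' => [|q|q] h h'; try lia; first by rewrite /=; ring.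
by rewrite /= Pos2Nat.inj_add Pos2Nat.inj_1 Cpow_add_r Cpow_1_r.
Qed.

Lemma Czpow_nat (x : C) (n : nat) : Czpow x (Z.of_nat n) = x ^ n.
Proof. by case: n => [//|n] /=; rewrite SuccNat2Pos.id_succ. Qed.

Lemma Czpow_opp (x : C) (e : Z) : x <> 0 -> Czpow x (- e) = / Czpow x e.
Proof.
move=> x0; case: e => [|q|q] //=; first by field.
by have := Cpow_nz _ (Pos.to_nat q) x0 => ?; field.
Qed.

Lemma Cmod_Czpow_IZR (n e : Z) : n <> 0%Z ->
  Cmod (Czpow (RtoC (IZR n)) e) <= Rabs (IZR n) ^ Z.abs_nat e.
Proof.
move=> n0.
have h1 : 1 <= Rabs (IZR n) by rewrite Rabs_Zabs; apply: IZR_le; lia.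
have nz : RtoC (IZR n) <> 0 by apply/Cmod_gt_0; rewrite Cmod_R; lra.
case: e => [|q|q] /=; first by rewrite Cmod_1; lra.
  by rewrite Cmod_pow Cmod_R; lra.
rewrite Cmod_inv; last exact: Cpow_nz.
rewrite Cmod_pow Cmod_R.
have := pow_R1_Rle _ (Pos.to_nat q) h1 => h2.
apply: (Rle_trans _ (/ 1)); last lra.
by apply: Rinv_le_contravar; lra.
Qed.
End Decay.

(** * Partial fractions *)

Section PartialFractions.
Local Open Scope R_scope.
Local Open Scope C_scope.

Lemma Carg_scale (c : R) (w : C) : 0 < c -> 0 < Im w -> Carg (RtoC c * w) = Carg w.
Proof.
move=> c0 w0.
have eR : Re (RtoC c * w) = (c * Re w)%R by rewrite /Re /=; ring.
have eI : Im (RtoC c * w) = (c * Im w)%R by rewrite /Im /=; ring.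
have m0 : 0 < Cmod w by have := im_le_Cmod w; have := Rle_abs (Im w); lra.
have eM : Cmod (RtoC c * w) = (c * Cmod w)%R by rewrite Cmod_mult Cmod_R Rabs_pos_eq; lra.
rewrite /Carg eR eI eM.
have -> : (c * Re w / (c * Cmod w) = Re w / Cmod w)%R by field; lra.
have ? : 0 < c * Im w by apply: Rmult_lt_0_compat.
by case: Rle_dec => //= ?; case: Rle_dec => //= ?; lra.
Qed.

(** * Poles and residues of E *)

Variables (r : nat) (omega : 'I_r -> C) (a : 'I_r -> R).
Hypothesis r_ge2 : (2 <= r)%nat.
Hypothesis omega_upper : forall k, 0 < Im (omega k).
Hypothesis omega_arg : forall j k : 'I_r, (j < k)%nat -> Carg (omega j) < Carg (omega k).
Hypothesis a_bounds : forall k, 0 < a k < 1.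

Lemma omega_neq0 k : omega k <> 0.
Proof. by move=> e; have := omega_upper k; rewrite e /=; lra. Qed.

(** A real ratio would be positive, since both numbers lie in the upper half plane, and a positive
    multiple has the same argument. *)
Lemma omega_ratio_Im j k : j <> k -> Im (omega j / omega k) <> 0%R.
Proof.
move=> jk e.
pose c := Re (omega j / omega k).
have h : omega j = RtoC c * omega k.
  have -> : RtoC c = omega j / omega k by apply: C_eq; rewrite ?e.
  by field; apply: omega_neq0.
have c0 : 0 < c.
  have := omega_upper j; rewrite h.
  have -> : Im (RtoC c * omega k) = (c * Im (omega k))%R by rewrite /Im /=; ring.
  by have := omega_upper k => ? ?; nra.
have ea : Carg (omega j) = Carg (omega k) by rewrite h; apply: Carg_scale.
case: (ltngtP (nat_of_ord j) (nat_of_ord k)) => hjk.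
- by have := omega_arg j k hjk; lra.
- by have := omega_arg k j hjk; lra.
- by apply: jk; apply: val_inj.
Qed.

Definition pole (k : 'I_r) (n : Z) : C := ipole n / omega k.

Lemma omega_pole k n : omega k * pole k n = ipole n.
Proof. by rewrite /pole; field; apply: omega_neq0. Qed.

Lemma ipole_neq0 n : n <> 0%Z -> ipole n <> 0.
Proof.
move=> n0 e; have : Im (ipole n) = 0%R by rewrite e.
rewrite ipoleE /Im /= => /Rmult_integral [h | /eq_IZR_R0 //].
by have := PI_RGT_0; lra.
Qed.

Lemma pole_neq0 k n : n <> 0%Z -> pole k n <> 0.
Proof.
by move=> n0 e; apply: (ipole_neq0 _ n0); rewrite -(omega_pole k) e; ring.
Qed.

(** The real part is -2 pi n Im(omega_j/omega_k). This growth makes the residues decay, keeps the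
    poles of different factors apart and isolates remote poles. *)
Lemma Re_omega_pole : exists b, 0 < b /\ forall j k n, j <> k ->
  b * Rabs (IZR n) <= Rabs (Re (omega j * pole k n)).
Proof.
have p0 := PI_RGT_0.
have hE j k n : Re (omega j * pole k n) = (- (2 * PI * Im (omega j / omega k)) * IZR n)%R.
  have -> : omega j * pole k n = ipole n * (omega j / omega k).
    by rewrite /pole; field; apply: omega_neq0.
  by rewrite ipoleE /Re /Im /=; ring.
pose Q (jk : 'I_r * 'I_r) d := jk.1 <> jk.2 ->
   d <= Rabs (- (2 * PI * Im (omega jk.1 / omega jk.2))).
have [|jk d e e0 ed h /h|b [b0 hb]] := @fin_pos_bound ('I_r * 'I_r)%type Q.
- move=> [j k]; case: (classic (j = k)) => [e | jk].
    by exists 1%R; split; [lra|].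
  exists (Rabs (- (2 * PI * Im (omega j / omega k)))); split; last by move=> _ /=; lra.
  apply: Rabs_pos_lt; have := omega_ratio_Im _ _ jk => h.
  by apply: Ropp_neq_0_compat; apply: Rmult_integral_contrapositive; split; lra.
- lra.
exists b; split=> // j k n jk; rewrite hE Rabs_mult.
apply: Rmult_le_compat_r; first exact: Rabs_pos.
exact: hb (j, k) jk.
Qed.

Lemma a_margin : exists c, 0 < c /\ forall j, c <= a j /\ c <= 1 - a j.
Proof.
apply: fin_pos_bound => [j | j d e e0 ed]; last lra.
exists (Rmin (a j) (1 - a j)); split; first by apply: Rmin_pos; have := a_bounds j; lra.
by split; [apply: Rmin_l | apply: Rmin_r].
Qed.

Lemma omega_size : exists d, 0 < d /\ forall j, d <= Cmod (omega j) /\ d * Cmod (omega j) <= 1.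
Proof.
apply: fin_pos_bound => [j | j d e e0 ed]; last first.
  by move=> [h1 h2]; split; [lra|]; have := Cmod_ge_0 (omega j); nra.
have p : 0 < Cmod (omega j) by apply/Cmod_gt_0; apply: omega_neq0.
exists (Rmin (Cmod (omega j)) (/ Cmod (omega j))); split.
  by apply: Rmin_pos => //; apply: Rinv_0_lt_compat.
split; first exact: Rmin_l.
apply: (Rle_trans _ (/ Cmod (omega j) * Cmod (omega j))).
  by apply: Rmult_le_compat_r; [lra | apply: Rmin_r].
by apply: Req_le; field; lra.
Qed.

Definition Efun (t : C) : C := \big[Cmult/RtoC 1]_(j < r) gfun (RtoC (a j)) (omega j * t).

Definition residue (k : 'I_r) (n : Z) : C :=
  Cexp (RtoC (a k) * ipole n) / omega k *
  \big[Cmult/RtoC 1]_(j < r | j != k) gfun (RtoC (a j)) (omega j * pole k n).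

Lemma other_index (k : 'I_r) : exists j : 'I_r, j != k.
Proof.
have r0 : (0 < r)%nat := ltnW r_ge2.
case: (eqVneq (Ordinal r0) k) => [<- | ne]; last by exists (Ordinal r0).
by exists (Ordinal r_ge2).
Qed.

Lemma Re_far (s : C) (d : R) : d <= Rabs (Re s) -> forall n, d <= Cmod (s - ipole n).
Proof.
by move=> h n; apply: Rle_trans h _; rewrite -(Re_sub_ipole s n); apply: re_le_Cmod.
Qed.

(** The factor of index k contributes modulus 1/|omega_k|; a second index, available because r >= 2,
    supplies the exponential decay. *)
Lemma residue_decay : exists K b, 0 < b /\ 0 < K /\ forall k n, n <> 0%Z ->
  Cmod (residue k n) <= K * exp (- b * Rabs (IZR n)).
Proof.
have [b [b0 hb]] := Re_omega_pole.
have [c [c0 hc]] := a_margin.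
have [d [d0 hd]] := omega_size.
(* The distance [b] is admissible: for i <> k and n <> 0 the point omega_i [pole k n] has real part
   of size at least b|n| >= b. *)
have [K0 [K00 hK]] := gfun_bound b b0.
pose K := Rmax K0 1.
have K1 : 1 <= K by apply: Rmax_r.
have KK : K0 <= K by apply: Rmax_l.
pose L := (K ^ size (index_enum 'I_r))%R.
have L0 : 1 <= L by apply: pow_R1_Rle.
exists (/ d * L * K0)%R, (c * b)%R; split; first exact: Rmult_lt_0_compat.
have id0 := Rinv_0_lt_compat _ d0.
split; first by do !apply: Rmult_lt_0_compat; lra.
move=> k n n0.
have n1 : 1 <= Rabs (IZR n) by rewrite Rabs_Zabs; apply: IZR_le; lia.
have [j jk] := other_index k.
have g1 i : i != k -> Cmod (gfun (RtoC (a i)) (omega i * pole k n))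
    <= K0 * exp (- (c * b) * Rabs (IZR n)).
  move=> /eqP ik; have h := hb i k n ik.
  apply: Rle_trans (hK (a i) c _ _ _ _) _; try by have := hc i; lra.
    by apply: Re_far; nra.
  apply: Rmult_le_compat_l; first lra.
  by apply: exp_le_compat; have := Rmult_le_compat_l _ _ _ (Rlt_le _ _ c0) h; lra.
have g2 i : i != k -> Cmod (gfun (RtoC (a i)) (omega i * pole k n)) <= K.
  move=> ik; apply: Rle_trans (g1 i ik) _.
  have : exp (- (c * b) * Rabs (IZR n)) <= 1.
    rewrite -exp_0; apply: exp_le_compat.
    have cb := Rmult_lt_0_compat _ _ c0 b0.
    by have := Rmult_le_pos _ _ (Rlt_le _ _ cb) (Rabs_pos (IZR n)); lra.
  by have := exp_pos (- (c * b) * Rabs (IZR n)); nra.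
have := @Cmod_prod_small _ (fun i => i != k) (fun i => gfun (RtoC (a i)) (omega i * pole k n)) K j K1 jk g2.
rewrite -/L => h.
rewrite /residue /Cdiv !Cmod_mult Cmod_Cexp Cmod_inv; last exact: omega_neq0.
have -> : Re (RtoC (a k) * ipole n) = 0%R by rewrite ipoleE /Re /=; ring.
rewrite exp_0 Rmult_1_l !Rmult_assoc; apply: Rmult_le_compat.
- by apply: Rlt_le; apply: Rinv_0_lt_compat; have := hd k; lra.
- exact: Cmod_ge_0.
- by apply: Rinv_le_contravar => //; have := hd k; lra.
apply: Rle_trans h _; apply: Rmult_le_compat_l; [lra | exact: g1].
Qed.

Lemma pole_unit k n : pole k n = RtoC (IZR n) * pole k 1.
Proof. by rewrite /pole /ipole; field; apply: omega_neq0. Qed.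

(** Half of the exponential decay absorbs the factor |n|^|e|, and the other half is summed as a
    geometric series. *)
Lemma residue_summable (e : Z) : Tsummable r (fun k n => residue k n * Czpow (pole k n) e).
Proof.
have [K [b [b0 [K0 hK]]]] := residue_decay.
have [M [M0 hM]] := pow_exp_bound (Z.abs_nat e) (b / 2) ltac:(lra).
move=> k; apply: (summable_nz_decay _ (K * M * Cmod (Czpow (pole k 1) e)) (b / 2)); first lra.
move=> n n0.
have nz : RtoC (IZR n) <> 0 by move=> /RtoC_inj /eq_IZR_R0.
rewrite pole_unit Czpow_mult //; last by apply: pole_neq0.
rewrite (Cmod_mult (residue k n)) (Cmod_mult (Czpow _ _)).
have h1 := hK k n n0.
have h2 := Cmod_Czpow_IZR n e n0.
have h3 := hM (Rabs (IZR n)) (Rabs_pos _).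
set P := Cmod (Czpow (pole k 1) e).
have P0 : 0 <= P by apply: Cmod_ge_0.
have e2 : (exp (- b * Rabs (IZR n)) = exp (- (b / 2) * Rabs (IZR n)) * exp (- (b / 2) * Rabs (IZR n)))%R.
  by rewrite -exp_plus; congr exp; field.
rewrite e2 in h1; set X := exp _ in h1 h3 *.
have X0 : 0 < X by apply: exp_pos.
apply: (Rle_trans _ (K * (X * X) * (Rabs (IZR n) ^ Z.abs_nat e * P))).
  apply: Rmult_le_compat => //; first exact: Cmod_ge_0.
    by apply: Rmult_le_pos => //; apply: Cmod_ge_0.
  by apply: Rmult_le_compat_r.
have -> : (K * (X * X) * (Rabs (IZR n) ^ Z.abs_nat e * P) = (K * P * X) * (Rabs (IZR n) ^ Z.abs_nat e * X))%R by ring.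
have -> : (K * M * P * X = (K * P * X) * M)%R by ring.
by apply: Rmult_le_compat_l => //; do !apply: Rmult_le_pos; lra.
Qed.

Lemma pole_dist (t : C) : exists d, 0 < d /\ forall k n, t <> pole k n -> d <= Cmod (t - pole k n).
Proof.
have [||d [d0 hd]] := @fin_pos_bound 'I_r
  (fun k d => forall n, t <> pole k n -> d <= Cmod (t - pole k n)).
- move=> k; have [d [d0 hd]] := ipole_dist (omega k * t).
  have p : 0 < Cmod (omega k) by apply/Cmod_gt_0; apply: omega_neq0.
  exists (d / Cmod (omega k))%R; split; first exact: Rdiv_lt_0_compat.
  move=> n hn; apply/Rle_div_l => //.
  rewrite Rmult_comm -Cmod_mult.
  have -> : omega k * (t - pole k n) = omega k * t - ipole n by rewrite -(omega_pole k); ring.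
  apply: hd => e; apply: hn; rewrite /pole -e; field; exact: omega_neq0.
- by move=> k d e e0 ed h n /h; lra.
by exists d.
Qed.

Lemma regular_pole k n (j : 'I_r) : n <> 0%Z -> j <> k -> Cexp (omega j * pole k n) <> 1.
Proof.
move=> n0 jk /Cexp_eq1 [m e].
have [b [b0 hb]] := Re_omega_pole.
have := hb j k n jk; rewrite e ipoleE /Re /= Rabs_R0.
have : 1 <= Rabs (IZR n) by rewrite Rabs_Zabs; apply: IZR_le; lia.
nra.
Qed.

(** * Local expansions of E at regular points, at nonzero poles and at 0 *)

Definition regular (t : C) : Prop := t <> 0 /\ forall j, Cexp (omega j * t) <> 1.

Lemma regular_not_pole (t : C) k n : regular t -> t <> pole k n.
Proof. by move=> [_ h] e; apply: (h k); rewrite e omega_pole Cexp_ipole. Qed.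

Lemma singular_pole (t : C) : t <> 0 -> ~ regular t -> exists k n, n <> 0%Z /\ t = pole k n.
Proof.
move=> t0 h; apply: NNPP => h2; apply: h; split=> // j /Cexp_eq1 [n e].
apply: h2; exists j, n; split.
  move=> n0; apply: (Cmult_neq_0 _ _ (omega_neq0 j) t0).
  by rewrite e n0 ipoleE; apply: C_eq; rewrite /=; ring.
by rewrite /pole -e; field; apply: omega_neq0.
Qed.

Lemma RtoC_a_neq0 j : RtoC (a j) <> 0.
Proof. by move=> /RtoC_inj; have := a_bounds j; lra. Qed.

Lemma gfun_jet_regular (N : nat) (j : 'I_r) (p : C) : Cexp (omega j * p) <> 1 ->
  jetc N (gfun (RtoC (a j)) (omega j * p)) (fun h => gfun (RtoC (a j)) (omega j * (p + h))).
Proof.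
move=> h1.
have w0 := omega_neq0 j.
apply: jetc_mult.
  have := jetc_scal N (Cexp (RtoC (a j) * (omega j * p))) _ _
    (jetc_Cexp N (RtoC (a j) * omega j) (Cmult_neq_0 _ _ (RtoC_a_neq0 j) w0)).
  rewrite Cmult_1_r; apply: jetc_ext; apply: near0_true => h _.
  by rewrite -Cexp_add; congr Cexp; ring.
apply: jetc_inv.
  by move=> e; apply: h1; rewrite -[RHS]Cplus_0_r -e; ring.
have := jetc_plus N _ _ _ _ (jetc_scal N (Cexp (omega j * p)) _ _ (jetc_Cexp N (omega j) w0))
  (jetc_const N (- (1))).
rewrite Cmult_1_r; apply: jetc_ext; apply: near0_true => h _.
by rewrite -Cexp_add; congr (Cexp _ + _); ring.
Qed.

(** The denominator at p + h equals e^(omega_j h) - 1, as at the origin, so it has a simple zero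
    with slope omega_j. The case p = 0 is included and is used for the pole of order r. *)
Lemma gfun_jet_pole (N : nat) (j : 'I_r) (p : C) : Cexp (omega j * p) = 1 ->
  jetc N (Cexp (RtoC (a j) * (omega j * p)) / omega j)
    (fun h => h * gfun (RtoC (a j)) (omega j * (p + h))).
Proof.
move=> h1.
have w0 := omega_neq0 j.
have j1 : jetc N (Cexp (RtoC (a j) * (omega j * p)))
    (fun h => Cexp (RtoC (a j) * (omega j * (p + h)))).
  have := jetc_scal N (Cexp (RtoC (a j) * (omega j * p))) _ _
    (jetc_Cexp N (RtoC (a j) * omega j) (Cmult_neq_0 _ _ (RtoC_a_neq0 j) w0)).
  rewrite Cmult_1_r; apply: jetc_ext; apply: near0_true => h _.
  by rewrite -Cexp_add; congr Cexp; ring.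
have j2 := jetc_Cexp_sub1 N _ w0.
have := jetc_mult _ _ _ _ _ j1 (jetc_inv _ _ _ w0 j2).
apply: jetc_ext.
have nz : near0 (fun h => (Cexp (omega j * h) - 1) / h <> 0).
  apply: near0_mono (jetc_neq0 _ _ _ w0 j2) => h _ hh e.
  by move: hh; rewrite e Cmod_0; move/Cmod_gt_0: w0; lra.
apply: near0_mono nz => h h0 hz.
have e : Cexp (omega j * (p + h)) = Cexp (omega j * h).
  have -> : omega j * (p + h) = omega j * p + omega j * h by ring.
  by rewrite Cexp_add h1 Cmult_1_l.
rewrite /gfun e.
have z : Cexp (omega j * h) - 1 <> 0.
  by move=> e'; apply: hz; rewrite e' /Cdiv Cmult_0_l.
by field.
Qed.

Lemma Efun_jet_regular (N : nat) (p : C) : regular p ->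
  jetc N (Efun p) (fun h => Efun (p + h)).
Proof. by move=> [_ hp]; apply: jetc_prod => j _; apply: gfun_jet_regular. Qed.

Lemma Efun_jet_pole (N : nat) k n : n <> 0%Z ->
  jetc N (residue k n) (fun h => h * Efun (pole k n + h)).
Proof.
move=> n0.
have j1 : jetc N (Cexp (RtoC (a k) * ipole n) / omega k)
    (fun h => h * gfun (RtoC (a k)) (omega k * (pole k n + h))).
  have := gfun_jet_pole N k (pole k n); rewrite omega_pole; apply; exact: Cexp_ipole.
have j2 : jetc N (\big[Cmult/RtoC 1]_(j < r | j != k) gfun (RtoC (a j)) (omega j * pole k n))
  (fun h => \big[Cmult/RtoC 1]_(j < r | j != k) gfun (RtoC (a j)) (omega j * (pole k n + h))).
  apply: jetc_prod => j /eqP jk; apply: gfun_jet_regular; exact: regular_pole.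
apply: jetc_ext (jetc_mult _ _ _ _ _ j1 j2); apply: near0_true => h _.
by rewrite /Efun [in RHS](bigD1 k) //= Cmult_assoc.
Qed.

Lemma Cpow_prod (I : finType) (h : C) (f : I -> C) :
  \big[Cmult/RtoC 1]_i (h * f i) = h ^ #|I| * \big[Cmult/RtoC 1]_i f i.
Proof.
rewrite big_split /=; congr (_ * _).
rewrite big_const; elim: #|I| => [//|m /= ->]; by [].
Qed.

Lemma Efun_jet_0 (N : nat) : jet N (fun h => h ^ r * Efun h).
Proof.
apply: jet_S; apply: (jetc_jet _ (\big[Cmult/RtoC 1]_(j < r) (1 / omega j))).
apply: (jetc_ext _ _ (fun h => \big[Cmult/RtoC 1]_(j < r) (h * gfun (RtoC (a j)) (omega j * h)))).
  by apply: near0_true => h _; rewrite Cpow_prod card_ord.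
apply: jetc_prod => j _.
have := gfun_jet_pole N j 0; rewrite !Cmult_0_r Cexp_0 => /(_ erefl).
by apply: jetc_ext; apply: near0_true => h _; rewrite Cplus_0_l.
Qed.

(** * The polar sums, the principal part at 0 and the entire difference *)

Definition moment (e : Z) : C := Tsum r (fun k n => residue k n * Czpow (pole k n) e).

Definition Sfun (e : Z) (t : C) : C :=
  Tsum r (fun k n => residue k n * Czpow (pole k n) e / (t - pole k n)).

Lemma pole_inj k n k' n' : n' <> 0%Z -> pole k n = pole k' n' -> k = k' /\ n = n'.
Proof.
move=> n0 e; have ek : k = k'.
  apply: NNPP => kk; apply: (regular_pole k' n' k) => //.
  by rewrite -e omega_pole Cexp_ipole.
split=> //; have : ipole n = ipole n' by rewrite -(omega_pole k) e ek omega_pole.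
rewrite !ipoleE => -[h]; apply: eq_IZR.
apply: (Rmult_eq_reg_l (2 * PI)) => //; have := PI_RGT_0; lra.
Qed.

Lemma Sfun_jetc (N : nat) (e : Z) (p : C) : (forall k n, n <> 0%Z -> p <> pole k n) ->
  jetc N (Sfun e p) (fun h => Sfun e (p + h)).
Proof.
move=> hp; have [d [d0 hd]] := pole_dist p.
apply: (Tsum_jetc _ _ _ _ _ d); first exact: residue_summable.
  exact: d0.
by move=> k n n0 _; apply: hd; apply: hp.
Qed.

(** The weights are split into [w1], supported at the given pole, and [w2], zero there. Distinct
    pairs (k, n) give distinct poles, so the [w2] sum is regular at this point. *)
Lemma Sfun_jet_pole (N : nat) k0 n0 : n0 <> 0%Z ->
  exists G, jet N G /\
    near0 (fun h => Sfun 0 (pole k0 n0 + h) = residue k0 n0 / h + G h).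
Proof.
move=> n00; set p0 := pole k0 n0.
have [d [d0 hd]] := pole_dist p0.
pose at0 k n := (k == k0) && Z.eqb n n0.
pose w1 k n := if at0 k n then residue k n * Czpow (pole k n) 0 else RtoC 0.
pose w2 k n := if at0 k n then RtoC 0 else residue k n * Czpow (pole k n) 0.
have at0P k n : at0 k n = false -> p0 <> pole k n.
  move=> h e; have [e1 e2] := pole_inj k n k0 n0 n00 (esym e).
  by move: h; rewrite /at0 e1 e2 eqxx Z.eqb_refl.
have hs := residue_summable 0.
have hw2 : Tsummable r w2.
  apply: (Tsummable_le r _ _ 1) hs => k n _; rewrite /w2; case: (at0 k n); last lra.
  by rewrite Cmod_0 Rmult_1_l; apply: Cmod_ge_0.
exists (fun h => Tsum r (fun k n => w2 k n / (p0 + h - pole k n))); split.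
  apply: (Tsum_jet _ _ _ _ _ d) => // k n _.
  rewrite /w2; case e: (at0 k n) => // _; apply: hd; exact: at0P.
apply: near0_mono (near0_lt (d / 2) ltac:(lra)) => h h0 hh.
have far k n : at0 k n = false -> d / 2 <= Cmod (p0 + h - pole k n).
  move=> /at0P /hd; have := Cmod_sub_rev (p0 - pole k n) (- h).
  have -> : p0 - pole k n - - h = p0 + h - pole k n by ring.
  rewrite Cmod_opp; lra.
have h00 : 0 < Cmod h by apply/Cmod_gt_0.
pose K := Rmin (d / 2) (Cmod h).
have K0 : 0 < K by apply: Rmin_pos; lra.
have farK k n : K <= Cmod (p0 + h - pole k n).
  case e: (at0 k n); last exact: Rle_trans (Rmin_l _ _) (far k n e).
  move: e => /andP [/eqP -> /Z.eqb_eq ->]; rewrite -/p0.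
  have -> : p0 + h - p0 = h by ring.
  exact: Rmin_r.
have s1 : Tsummable r (fun k n => w1 k n / (p0 + h - pole k n)).
  apply: (Tsummable_le r _ _ (/ K)) hs => k n _; rewrite /w1; case e: (at0 k n).
    by apply: Cmod_weight_div_le.
  rewrite /Cdiv Cmult_0_l Cmod_0; apply: Rmult_le_pos; last exact: Cmod_ge_0.
  by apply: Rlt_le; apply: Rinv_0_lt_compat.
have s2 : Tsummable r (fun k n => w2 k n / (p0 + h - pole k n)).
  by apply: (Tsummable_le r _ _ (/ K)) hw2 => k n _; apply: Cmod_weight_div_le.
have -> : Sfun 0 (p0 + h) = Tsum r (fun k n => w1 k n / (p0 + h - pole k n)) +
    Tsum r (fun k n => w2 k n / (p0 + h - pole k n)).
  rewrite -Tsum_plus //; apply: Tsum_ext => k n _.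
  by rewrite /w1 /w2; case: (at0 k n); rewrite /Cdiv; ring.
congr (_ + _); rewrite (Tsum_single _ _ k0 n0) //.
  rewrite /w1 /at0 eqxx Z.eqb_refl /= -/p0.
  have -> : p0 + h - p0 = h by ring.
  by field.
move=> k n hkn; rewrite /w1; case e: (at0 k n); last by rewrite /Cdiv Cmult_0_l.
by move: e => /andP [/eqP ek /Z.eqb_eq en]; case: hkn.
Qed.

(** The sum of c_i t^(i-m) over i < m. Multiplying by t releases the last coefficient, that of 1/t,
    as a constant and lowers [m] by one. *)
Definition Pfun (c : nat -> C) (m : nat) (t : C) : C := polyn c m t / t ^ m.

Lemma Pfun_jetc (N : nat) (c : nat -> C) (m : nat) (p : C) : p <> 0 ->
  jetc N (Pfun c m p) (fun h => Pfun c m (p + h)).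
Proof.
move=> p0; apply: jetc_mult; first exact: jetc_polyn.
by apply: jetc_inv; [apply: Cpow_nz | apply: jetc_pow].
Qed.

Lemma Efun_principal_part (N : nat) :
  exists c, jet N (fun h => Efun h - Pfun c r h).
Proof.
have [c [g [jg hg]]] := jet_polyn_expansion _ _ _ (Efun_jet_0 (r + N)).
exists c; apply: jet_ext jg; apply: near0_mono hg => h h0 e.
have hr := Cpow_nz _ r h0.
rewrite /Pfun; have -> : Efun h = h ^ r * Efun h / h ^ r by field.
by rewrite e; field.
Qed.

Definition Hfun (c : nat -> C) (t : C) : C := Efun t - Sfun 0 t - Pfun c r t.

Lemma Hfun_jetc (N : nat) c p : regular p -> jetc N (Hfun c p) (fun h => Hfun c (p + h)).
Proof.
move=> rp.
have j1 := Efun_jet_regular N p rp.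
have j2 := Sfun_jetc N 0 p (fun k n _ => regular_not_pole p k n rp).
have j3 := Pfun_jetc N c r p (proj1 rp).
have := jetc_plus _ _ _ _ _ (jetc_plus _ _ _ _ _ j1 (jetc_scal _ (- (1)) _ _ j2))
  (jetc_scal _ (- (1)) _ _ j3).
have -> : Efun p + - (1) * Sfun 0 p + - (1) * Pfun c r p = Hfun c p by rewrite /Hfun; ring.
by apply: jetc_ext; apply: near0_true => h _; rewrite /Hfun; ring.
Qed.

(** At 0 the principal part has been removed and the polar sum is regular; at a nonzero pole the
    terms residue/h of E and of the polar sum cancel. *)
Lemma Hfun_jet (N : nat) c p : jet N (fun h => Efun h - Pfun c r h) ->
  jet N (fun h => Hfun c (p + h)).
Proof.
move=> j0; case: (classic (p = 0)) => [-> | p0].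
  have := Sfun_jetc N 0 0 (fun k n n0 e => pole_neq0 k n n0 (esym e)).
  move=> /jetc_jet /jet_S j1.
  apply: jet_ext (jet_minus _ _ _ j0 j1); apply: near0_true => h _.
  by rewrite /Hfun !Cplus_0_l; ring.
case: (classic (regular p)) => [rp | nrp].
  by apply: jet_S; apply: jetc_jet (Hfun_jetc N c p rp).
have [k [n [n0 ->]]] := singular_pole p p0 nrp.
have [g [jg hg]] := Efun_jet_pole N k n n0.
have [G [jG hG]] := Sfun_jet_pole N k n n0.
have jP := jet_S _ _ (jetc_jet _ _ _ (Pfun_jetc N c r (pole k n) (pole_neq0 k n n0))).
apply: jet_ext (jet_minus _ _ _ (jet_minus _ _ _ jg jG) jP).
apply: near0_and2 hg hG => h h0 e1 e2.
rewrite /Hfun e2; have -> : Efun (pole k n + h) = h * Efun (pole k n + h) / h by field.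
by rewrite e1; field.
Qed.

(** * Decay at a distance from the poles *)

Definition away (t : C) : Prop := forall j n, 1 <= Cmod (omega j * t - ipole n).

Lemma away_regular t : away t -> regular t.
Proof.
move=> h; have k : 'I_r := Ordinal r_ge2.
split.
  move=> t0; have := h k 0%Z; rewrite t0 ipoleE.
  have -> : omega k * 0 - (0%R, (2 * PI * 0)%R) = 0.
    by apply: C_eq; rewrite /Re /Im /=; ring.
  by rewrite Cmod_0; lra.
move=> j /Cexp_eq1 [n e]; have := h j n; rewrite e.
have -> : ipole n - ipole n = 0 by ring.
by rewrite Cmod_0; lra.
Qed.

Lemma away_pole_dist :
  exists d, 0 < d /\ forall t k n, away t -> d <= Cmod (t - pole k n).
Proof.
have [d [d0 hd]] := omega_size; exists d; split=> // t k n /(_ k n).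
have -> : omega k * t - ipole n = omega k * (t - pole k n) by rewrite -(omega_pole k); ring.
rewrite Cmod_mult; have := hd k; have := Cmod_ge_0 (t - pole k n) => h1 [h2 h3] h4.
have h5 := Rmult_le_compat_l _ _ _ (Rlt_le _ _ d0) h4.
have h6 := Rmult_le_compat_r _ _ _ h1 h3.
lra.
Qed.

(** Two indices suffice. With s = omega_1 t and q = omega_0/omega_1 not real, Re s and Re(q s)
    determine Im s; if both were below u = d|t|/(2L), then |s| < L u = d|t|/2, against |s| >=
    d|t|. *)
Lemma Re_omega_lower : exists b, 0 < b /\ forall t, exists j, b * Cmod t <= Rabs (Re (omega j * t)).
Proof.
have [d [d0 hd]] := omega_size.
pose i0 : 'I_r := Ordinal (ltnW r_ge2); pose i1 : 'I_r := Ordinal r_ge2.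
have ne : i0 <> i1 by move=> /(congr1 val).
have hq := omega_ratio_Im i0 i1 ne.
set q := omega i0 / omega i1 in hq.
have q0 := Rabs_pos_lt _ hq.
pose L := (1 + (1 + Rabs (Re q)) / Rabs (Im q))%R.
have L0 : 1 <= L.
  rewrite /L; have : 0 <= (1 + Rabs (Re q)) / Rabs (Im q); last lra.
  by apply: Rdiv_le_0_compat => //; have := Rabs_pos (Re q); lra.
exists (d / (2 * L))%R; split; first by apply: Rdiv_lt_0_compat; lra.
move=> t; apply: NNPP => hn.
have h j : Rabs (Re (omega j * t)) < d / (2 * L) * Cmod t.
  by apply: Rnot_le_lt => ?; apply: hn; exists j.
have h0 := h i0; have h1 := h i1.
set s := omega i1 * t in h1.
have e : omega i0 * t = q * s by rewrite /s /q; field; apply: omega_neq0.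
rewrite e Re_mult in h0.
have hs : d * Cmod t <= Cmod s.
  by rewrite /s Cmod_mult; apply: Rmult_le_compat_r; [apply: Cmod_ge_0 | have := hd i1; lra].
set u := (d / (2 * L) * Cmod t)%R in h0 h1.
have u0 : 0 < u by have := Rabs_pos (Re s); lra.
have hI : Rabs (Im q) * Rabs (Im s) <= Rabs (Re q) * u + u.
  rewrite -Rabs_mult.
  have -> : (Im q * Im s = Re q * Re s - (Re q * Re s - Im q * Im s))%R by ring.
  apply: Rle_trans (Rabs_triang _ _) _; rewrite Rabs_Ropp Rabs_mult.
  have := Rmult_le_compat_l _ _ _ (Rabs_pos (Re q)) (Rlt_le _ _ h1); lra.
have hI2 : Rabs (Im s) <= (1 + Rabs (Re q)) / Rabs (Im q) * u.
  apply: (Rmult_le_reg_l (Rabs (Im q))) => //.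
  have -> : (Rabs (Im q) * ((1 + Rabs (Re q)) / Rabs (Im q) * u) = Rabs (Re q) * u + u)%R.
    by field; lra.
  exact: hI.
have := Cmod_le_Re_Im s.
have Lu : (L * u = u + (1 + Rabs (Re q)) / Rabs (Im q) * u)%R by rewrite /L; ring.
have uE : (2 * (L * u) = d * Cmod t)%R by rewrite /u; field; lra.
have : 0 < L * u by apply: Rmult_lt_0_compat; lra.
lra.
Qed.

Lemma Efun_decay : exists K b, 0 < K /\ 0 < b /\
  forall t, away t -> Cmod (Efun t) <= K * exp (- b * Cmod t).
Proof.
have [b [b0 hb]] := Re_omega_lower.
have [c [c0 hc]] := a_margin.
have [K0 [K00 hK]] := gfun_bound 1 Rlt_0_1.
pose K := Rmax K0 1.
have K1 : 1 <= K by apply: Rmax_r.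
have KK : K0 <= K by apply: Rmax_l.
pose L := (K ^ size (index_enum 'I_r))%R.
have L0 : 1 <= L by apply: pow_R1_Rle.
exists (L * K0)%R, (c * b)%R; split; first by apply: Rmult_lt_0_compat; lra.
split; first exact: Rmult_lt_0_compat.
move=> t ht; have [j hj] := hb t.
have g1 i : Cmod (gfun (RtoC (a i)) (omega i * t)) <= K0 * exp (- c * Rabs (Re (omega i * t))).
  by apply: hK; try (by have := hc i; lra); apply: ht.
have g2 i : true -> Cmod (gfun (RtoC (a i)) (omega i * t)) <= K.
  move=> _; apply: Rle_trans (g1 i) _.
  have : exp (- c * Rabs (Re (omega i * t))) <= 1.
    rewrite -exp_0; apply: exp_le_compat.
    by have := Rmult_le_pos _ _ (Rlt_le _ _ c0) (Rabs_pos (Re (omega i * t))); lra.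
  by have := exp_pos (- c * Rabs (Re (omega i * t))); nra.
have := @Cmod_prod_small _ xpredT (fun i => gfun (RtoC (a i)) (omega i * t)) K j K1 isT g2.
rewrite -/L => h; apply: Rle_trans h _.
rewrite Rmult_assoc; apply: Rmult_le_compat_l; first lra.
apply: Rle_trans (g1 j) _; apply: Rmult_le_compat_l; first lra.
by apply: exp_le_compat; have := Rmult_le_compat_l _ _ _ (Rlt_le _ _ c0) hj; lra.
Qed.

Lemma Sfun_bounded e : exists M, 0 <= M /\ forall t, away t -> Cmod (Sfun e t) <= M.
Proof.
have [d [d0 hd]] := away_pole_dist.
have [M [M0 hM]] := Tsum_bound r _ (residue_summable e).
exists (/ d * M)%R; split.
  by apply: Rmult_le_pos => //; apply: Rlt_le; apply: Rinv_0_lt_compat.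
by move=> t ht; apply: hM => k n n0; apply: Cmod_weight_div_le => // _; apply: hd.
Qed.

Lemma Sfun_succ (e : Z) (t : C) : t <> 0 -> (forall k n, n <> 0%Z -> t <> pole k n) ->
  t * Sfun e t = moment e + Sfun (e + 1) t.
Proof.
move=> t0 tp; have [d [d0 hd]] := pole_dist t.
have eE k n : n <> 0%Z -> residue k n * Czpow (pole k n) (e + 1)
    = residue k n * Czpow (pole k n) e * pole k n.
  by move=> n0; rewrite Czpow_succ ?Cmult_assoc //; apply: pole_neq0.
rewrite /Sfun /moment (Tsum_far _ _ _ _ d) //.
- have -> : Tsum r (fun k n => residue k n * Czpow (pole k n) (e + 1) / (t - pole k n)) =
      Tsum r (fun k n => residue k n * Czpow (pole k n) e * pole k n / (t - pole k n)).
    by apply: Tsum_ext => k n n0; rewrite eE.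
  by field.
- exact: residue_summable.
- apply: (Tsummable_le r _ _ 1) (residue_summable (e + 1)) => k n n0.
  by rewrite eE // Rmult_1_l; lra.
- by move=> k n n0; apply: hd; apply: tp.
Qed.

(** By [Sfun_succ], t S_e is a constant plus S_(e+1), and every polar sum is bounded on the [away]
    set. *)
Lemma Sfun_decay e : exists K, 0 <= K /\ forall t, away t -> Cmod (Sfun e t) <= K / Cmod t.
Proof.
have [M [M0 hM]] := Sfun_bounded (e + 1).
exists (Cmod (moment e) + M)%R; split; first by have := Cmod_ge_0 (moment e); lra.
move=> t ht; have [t0 _] := away_regular t ht.
have tp : 0 < Cmod t by apply/Cmod_gt_0.
apply/Rle_div_r => //; rewrite Rmult_comm -Cmod_mult Sfun_succ //.
  by apply: Rle_trans (Cmod_triangle _ _) _; have := hM t ht; lra.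
by move=> k n _; apply: regular_not_pole; apply: away_regular.
Qed.

Lemma Pfun_decay c m : exists K, 0 <= K /\ forall t, 1 <= Cmod t -> Cmod (Pfun c m t) <= K / Cmod t.
Proof.
have [K [K0 hK]] : exists K, 0 <= K /\
    forall t, 1 <= Cmod t -> Cmod (polyn c m t) * Cmod t <= K * Cmod t ^ m.
  elim: m => [|m [K [K0 hK]]].
    exists 0%R; split; first lra.
    by move=> t _; rewrite /polyn big_ord0 Cmod_0; lra.
  exists (K + Cmod (c m))%R; split; first by have := Cmod_ge_0 (c m); lra.
  move=> t t1; have h := hK t t1.
  have tm : 0 < Cmod t ^ m by apply: pow_lt; lra.
  rewrite polynS; have := Cmod_triangle (polyn c m t) (c m * t ^ m).
  rewrite (Cmod_mult (c m)) Cmod_pow => h2.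
  have h3 := Rmult_le_compat_r _ _ _ (Rle_trans _ _ _ Rle_0_1 t1) h2.
  have h4 : K * Cmod t ^ m <= K * Cmod t ^ m * Cmod t.
    have : 0 <= K * Cmod t ^ m by apply: Rmult_le_pos; lra.
    by move=> h5; have := Rmult_le_compat_l _ _ _ h5 t1; lra.
  rewrite /=; lra.
exists K; split=> // t t1.
have t0 : t <> 0 by apply/Cmod_gt_0; lra.
rewrite /Pfun Cmod_div; last exact: Cpow_nz.
rewrite Cmod_pow; apply/Rle_div_l; first by apply: pow_lt; lra.
have -> : (K / Cmod t * Cmod t ^ m = K * Cmod t ^ m / Cmod t)%R by field; lra.
by apply/Rle_div_r; [lra | apply: hK].
Qed.

Lemma Hfun_decay c : exists K, 0 <= K /\
  forall t, away t -> 1 <= Cmod t -> Cmod (Hfun c t) <= K / Cmod t.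
Proof.
have [KE [b [KE0 [b0 hE]]]] := Efun_decay.
have [KS [KS0 hS]] := Sfun_decay 0.
have [KP [KP0 hP]] := Pfun_decay c r.
have [KX [KX0 hX]] := pow_exp_bound 1 b b0.
exists (KE * KX + KS + KP)%R; split; first by have := Rmult_lt_0_compat _ _ KE0 KX0; lra.
move=> t ht t1.
have h1 : Cmod (Efun t) <= KE * KX / Cmod t.
  apply: Rle_trans (hE t ht) _.
  apply: (proj1 (Rle_div_r _ (KE * KX) (Cmod t) _)); first lra.
  rewrite Rmult_assoc; apply: Rmult_le_compat_l; first lra.
  have := hX (Cmod t) ltac:(lra); rewrite pow_1; lra.
have h2 := hS t ht; have h3 := hP t t1.
rewrite /Hfun; apply: Rle_trans (Cmod_triangle _ _) _; rewrite Cmod_opp.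
have := Cmod_triangle (Efun t) (- Sfun 0 t); rewrite Cmod_opp => h4.
have -> : ((KE * KX + KS + KP) / Cmod t = KE * KX / Cmod t + KS / Cmod t + KP / Cmod t)%R.
  by field; lra.
by rewrite /Cminus; lra.
Qed.

(** * Vanishing of the entire difference *)

Lemma Cmod_ipole n : Cmod (ipole n) = (2 * PI * Rabs (IZR n))%R.
Proof.
have p0 := PI_RGT_0.
rewrite /ipole !Cmod_mult Cmod_Ci !Cmod_R (Rabs_pos_eq 2) ?(Rabs_pos_eq PI); lra.
Qed.

Lemma ipole_sub n m : ipole n - ipole m = ipole (n - m).
Proof. by rewrite /ipole minus_IZR RtoC_minus; ring. Qed.

(** A point violating [away] through (k, n) is within rho = 1/|omega_k| of [pole k n]. On the
    annulus omega_k t' is at distance between 1 and 2 from 2 pi i n, hence more than 1 from the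
    other 2 pi i m; for j <> k, omega_j t' has large real part because |n| is large. *)
Lemma near_pole_annulus (R0 : R) : exists R1, forall t, R1 <= Cmod t -> ~ away t ->
  exists p rho, 0 < rho /\ Cmod (t - p) <= rho /\
    forall t', rho <= Cmod (t' - p) <= 2 * rho -> away t' /\ R0 <= Cmod t'.
Proof.
have p1 := PI_4; have p2 := PI2_3_2; have p0 := PI_RGT_0.
have [d [d0 hd]] := omega_size.
have [b [b0 hb]] := Re_omega_pole.
have dd : 0 < d * d by apply: Rmult_lt_0_compat.
(* For |n| >= N, |Re(omega_j [pole k n])| >= 1 + 2/d^2, and moving inside the annulus changes
   omega_j t' by at most (1/d)(2/d). *)
pose N := ((1 + 2 / (d * d)) / b)%R.
have N0 : 0 < N.
  by apply: Rdiv_lt_0_compat => //; have := Rdiv_lt_0_compat 2 (d * d) ltac:(lra) dd; lra.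
(* The first bound pays for |t - t'| <= 3 rho <= 3/d. The second forces 2 pi |n| >= 8 N, hence |n|
   >= N, since pi <= 4. *)
exists (Rmax (R0 + 3 / d) ((1 + 8 * N) / d)) => t ht nt.
have ht1 := Rle_trans _ _ _ (Rmax_l _ _) ht.
have ht2 := Rle_trans _ _ _ (Rmax_r _ _) ht.
have [k [n hkn]] : exists k n, Cmod (omega k * t - ipole n) < 1.
  apply: NNPP => h; apply: nt => k n; apply: Rnot_lt_le => h'.
  by apply: h; exists k, n.
have [wk1 wk2] := hd k.
pose rho := (/ Cmod (omega k))%R.
have rho0 : 0 < rho by apply: Rinv_0_lt_compat; lra.
have rhoE : (Cmod (omega k) * rho = 1)%R by rewrite /rho; field; lra.
have rhod : rho <= / d by apply: Rinv_le_contravar.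
have wsub s m : omega k * s - ipole m = omega k * (s - pole k m).
  by rewrite -(omega_pole k); ring.
exists (pole k n), rho; split=> //.
have htp : Cmod (t - pole k n) <= rho.
  apply: (Rmult_le_reg_l (Cmod (omega k))); first lra.
  by rewrite rhoE -Cmod_mult -wsub; lra.
split=> // t' [ht'1 ht'2].
have nN : N <= Rabs (IZR n).
  have h1 := Cmod_sub_rev (omega k * t) (ipole n).
  rewrite Cmod_mult Cmod_ipole in h1.
  have h2 := Rmult_le_compat_r _ _ _ (Cmod_ge_0 t) wk1.
  have h3 : 1 + 8 * N <= d * Cmod t.
    have := Rmult_le_compat_l _ _ _ (Rlt_le _ _ d0) ht2.
    have -> : (d * ((1 + 8 * N) / d) = 1 + 8 * N)%R by field; lra.
    lra.
  have h4 := Rmult_le_compat_r _ _ _ (Rabs_pos (IZR n)) p1.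
  lra.
have bN : 1 + 2 / (d * d) <= b * Rabs (IZR n).
  have := Rmult_le_compat_l _ _ _ (Rlt_le _ _ b0) nN.
  by have -> : (b * N = 1 + 2 / (d * d))%R by rewrite /N; field; lra.
split; last first.
  have h1 : Cmod (t - t') <= 3 / d.
    have -> : t - t' = (t - pole k n) + - (t' - pole k n) by ring.
    apply: Rle_trans (Cmod_triangle _ _) _; rewrite Cmod_opp /Rdiv; lra.
  have := Cmod_sub_rev t (t - t').
  have -> : t - (t - t') = t' by ring.
  lra.
move=> j m; case: (classic (j = k)) => [-> | jk].
  rewrite wsub Cmod_mult.
  case: (Z.eq_dec m n) => [-> | mn].
    have := Rmult_le_compat_l _ _ _ (Cmod_ge_0 (omega k)) ht'1; lra.
  rewrite -Cmod_mult -wsub.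
  have -> : omega k * t' - ipole m = ipole (n - m) - - (omega k * t' - ipole n).
    by rewrite -ipole_sub; ring.
  have := Cmod_sub_rev (ipole (n - m)) (- (omega k * t' - ipole n)).
  rewrite Cmod_opp Cmod_ipole (wsub t' n) Cmod_mult.
  have h1 : 1 <= Rabs (IZR (n - m)) by rewrite Rabs_Zabs; apply: IZR_le; lia.
  have h2 := Rmult_le_compat_l _ _ _ (Cmod_ge_0 (omega k)) ht'2.
  have h3 := Rmult_le_compat_l (2 * PI) _ _ ltac:(lra) h1.
  lra.
apply: Re_far.
have -> : omega j * t' = omega j * pole k n - - (omega j * (t' - pole k n)) by ring.
have h1 := hb j k n jk.
have h2 : Cmod (omega j * (t' - pole k n)) <= 2 / (d * d).
  rewrite Cmod_mult.
  have h3 : Cmod (omega j) <= / d.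
    apply: (Rmult_le_reg_l d) => //; rewrite Rinv_r; last lra.
    by have := hd j; lra.
  apply: (Rle_trans _ (/ d * (2 * / d))).
    by apply: Rmult_le_compat; try exact: Cmod_ge_0; lra.
  by apply: Req_le; field; lra.
have h3 := re_le_Cmod (omega j * (t' - pole k n)).
have := Rabs_triang_inv (Re (omega j * pole k n)) (- Re (omega j * (t' - pole k n))).
rewrite Rabs_Ropp.
have -> : Re (omega j * pole k n - - (omega j * (t' - pole k n))) =
  (Re (omega j * pole k n) - - Re (omega j * (t' - pole k n)))%R by [].
lra.
Qed.

(* Liouville: [Hfun c] extends to an entire function vanishing at infinity. *)
Lemma partial_fractions : exists c, forall t, regular t ->
  Efun t = Sfun 0 t + Pfun c r t.
Proof.
have [c hc] := Efun_principal_part 3.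
exists c.
have [F [hF hF2]] := jet3_extension (Hfun c) (fun p => Hfun_jet 3 c p hc).
have FH p : regular p -> F p = Hfun c p.
  by move=> rp; apply: jetc_unique (hF2 p) (Hfun_jetc 2 c p rp).
have [K [K0 hK]] := Hfun_decay c.
(* Where [away] holds this is the decay of [Hfun]; near a remote pole the bound comes from the
   surrounding annulus and doubles. *)
have small e : 0 < e -> exists R1, 0 < R1 /\ forall t, R1 <= Cmod t -> Cmod (F t) <= 2 * e.
  move=> e0.
  have hA t : Rmax 1 (K / e) <= Cmod t -> away t -> Cmod (F t) <= e.
    move=> ht at'.
    have t1 := Rle_trans _ _ _ (Rmax_l _ _) ht.
    have t2 := Rle_trans _ _ _ (Rmax_r _ _) ht.
    rewrite FH; last exact: away_regular.
    apply: Rle_trans (hK t at' t1) _.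
    apply/Rle_div_l; first lra.
    by move/Rle_div_l: t2; rewrite Rmult_comm; apply.
  have [R1 hR] := near_pole_annulus (Rmax 1 (K / e)).
  exists (Rmax R1 (Rmax 1 (K / e))); split.
    by apply: Rlt_le_trans (Rmax_r _ _); apply: Rlt_le_trans (Rmax_l _ _); lra.
  move=> t ht.
  have t1 := Rle_trans _ _ _ (Rmax_l _ _) ht.
  have t2 := Rle_trans _ _ _ (Rmax_r _ _) ht.
  case: (classic (away t)) => [at' | nat']; first by have := hA t t2 at'; lra.
  have [p [rho [rho0 [htp hann]]]] := hR t t1 nat'.
  apply: (has_2jets_max F p rho e hF rho0 _ t htp) => t' ht'.
  by have [h1 h2] := hann t' ht'; apply: hA.
have F0 t : F t = 0.
  apply: Cmod_eq_0; apply: Rle_antisym; last exact: Cmod_ge_0.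
  apply: Rnot_lt_le => tpos.
  (* The maximum principle is used twice, near poles and on a large disc, each time losing a factor
     2: |F t| <= 4 |F t| / 8 is then absurd. *)
  have [R1 [R10 hR1]] := small (Cmod (F t) / 8)%R ltac:(lra).
  have rho0 : 0 < Rmax R1 (Cmod t) by apply: Rlt_le_trans (Rmax_l _ _).
  have := has_2jets_max F 0 (Rmax R1 (Cmod t)) (2 * (Cmod (F t) / 8)) hF rho0.
  have e s : s - 0 = s by ring.
  move=> /(_ _ t); rewrite e => h.
  have : Cmod (F t) <= 2 * (2 * (Cmod (F t) / 8)).
    apply: h; last exact: Rmax_r.
    move=> s; rewrite e => -[hs _]; apply: hR1.
    by apply: Rle_trans hs; apply: Rmax_l.
  lra.
move=> t rt; have := FH t rt; rewrite F0 /Hfun => h.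
have -> : Efun t = Efun t - Sfun 0 t - Pfun c r t + (Sfun 0 t + Pfun c r t) by ring.
by rewrite -h; ring.
Qed.

(** * Moments of the residues from the behaviour at infinity *)

Lemma ray_away : exists x0, forall x, x0 <= x -> away (0%R, (- x)%R).
Proof.
have [||d [d0 hd]] := @fin_pos_bound 'I_r (fun k d => d <= Im (omega k)).
- by move=> k; exists (Im (omega k)); split; [exact: omega_upper | lra].
- by move=> k d e; lra.
exists (/ d)%R => x hx j; apply: Re_far.
have id0 := Rinv_0_lt_compat _ d0.
have -> : Re (omega j * (0%R, (- x)%R)) = (x * Im (omega j))%R by rewrite /Re /Im /=; ring.
rewrite Rabs_pos_eq; last by have := omega_upper j; nra.
apply: (Rle_trans _ (/ d * d)); first by apply: Req_le; field; lra.
by apply: Rmult_le_compat; have := hd j; lra.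
Qed.

Lemma Pfun_shift c m (t : C) : t <> 0 ->
  t * Pfun c m t = (if m is m'.+1 then c m' else RtoC 0) + Pfun c m.-1 t.
Proof.
move=> t0; rewrite /Pfun; case: m => [|m] /=.
  by rewrite /polyn big_ord0; field.
by rewrite polynS; have := Cpow_nz _ m t0 => ?; field.
Qed.

(** Multiplying the identity by t produces the constant [moment e] plus the coefficient released by
    [Pfun]. All other terms tend to 0 along -iR, so the constant vanishes and the identity of the
    next order remains. For e >= r the truncated [r - e] is 0 and no coefficient is released. *)
Lemma moment_step c (e : nat) :
  (forall t, regular t -> t ^ e * Efun t = Sfun (Z.of_nat e) t + Pfun c (r - e) t) ->
  moment (Z.of_nat e) = - (if (r - e)%nat is m.+1 then c m else RtoC 0) /\
  forall t, regular t ->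
    t ^ e.+1 * Efun t = Sfun (Z.of_nat e.+1) t + Pfun c (r - e.+1) t.
Proof.
move=> hA.
set ce := (if (r - e)%nat is m.+1 then c m else RtoC 0).
have hB t : regular t -> t ^ e.+1 * Efun t =
    moment (Z.of_nat e) + ce + Sfun (Z.of_nat e.+1) t + Pfun c (r - e.+1) t.
  move=> rt; have [t0 _] := rt.
  rewrite Cpow_S -Cmult_assoc hA // Cmult_plus_distr_l Sfun_succ //; last first.
    by move=> k n _; apply: regular_not_pole.
  rewrite Pfun_shift // -/ce -subnS.
  have -> : (Z.of_nat e + 1 = Z.of_nat e.+1)%Z by lia.
  by ring.
suff D0 : moment (Z.of_nat e) + ce = 0.
  split; last by move=> t rt; rewrite hB // D0; ring.
  have -> : moment (Z.of_nat e) = moment (Z.of_nat e) + ce - ce by ring.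
  by rewrite D0; ring.
set D := moment (Z.of_nat e) + ce in hB *.
have [KE [b [KE0 [b0 hE]]]] := Efun_decay.
have [KS [KS0 hS]] := Sfun_decay (Z.of_nat e.+1).
have [KP [KP0 hP]] := Pfun_decay c (r - e.+1).
(* One power more than in t^(e+1) E makes this term O(1/x) like the others, so |D| <= K/x; taking x
   >= (K+1)/|D| contradicts this. *)
have [KX [KX0 hX]] := pow_exp_bound e.+2 b b0.
have [x0 hx0] := ray_away.
pose K := (KE * KX + KS + KP)%R.
have K0 : 0 <= K by rewrite /K; have := Rmult_lt_0_compat _ _ KE0 KX0; lra.
apply: Cmod_eq_0; apply: Rle_antisym; last exact: Cmod_ge_0.
apply: Rnot_lt_le => Dpos.
pose x := Rmax (Rmax x0 1) ((K + 1) / Cmod D).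
have x1 : x0 <= x := Rle_trans _ _ _ (Rmax_l _ _) (Rmax_l _ _).
have x2 : 1 <= x := Rle_trans _ _ _ (Rmax_r _ _) (Rmax_l _ _).
have x3 : (K + 1) / Cmod D <= x := Rmax_r _ _.
have ha := hx0 x x1.
set t : C := (0%R, (- x)%R) in ha.
have ht : Cmod t = x.
  rewrite /t /Cmod /=.
  have -> : (0 * (0 * 1) + - x * (- x * 1) = x * x)%R by ring.
  by rewrite sqrt_square; lra.
have e1 : D = t ^ e.+1 * Efun t - Sfun (Z.of_nat e.+1) t - Pfun c (r - e.+1) t.
  by rewrite hB; [ring | apply: away_regular].
have h1 : Cmod (t ^ e.+1 * Efun t) <= KE * KX / x.
  apply: (proj1 (Rle_div_r _ (KE * KX) x _)); first lra.
  rewrite Cmod_mult Cmod_pow ht.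
  have h := hE t ha; rewrite ht in h.
  have h' := hX x ltac:(lra).
  have xp : 0 <= x ^ e.+1 * x by apply: Rmult_le_pos; [apply: pow_le|]; lra.
  have := Rmult_le_compat_l _ _ _ xp h.
  have := Rmult_le_compat_l _ _ _ (Rlt_le _ _ KE0) h'.
  have -> : (x ^ e.+2 = x ^ e.+1 * x)%R by rewrite /=; ring.
  lra.
have h2 := hS t ha; have h3 := hP t ltac:(lra); rewrite ht in h2 h3.
have h4 : Cmod D <= K / x.
  rewrite e1; apply: Rle_trans (Cmod_triangle _ _) _; rewrite Cmod_opp.
  have := Cmod_triangle (t ^ e.+1 * Efun t) (- Sfun (Z.of_nat e.+1) t); rewrite Cmod_opp => h4.
  have -> : (K / x = KE * KX / x + KS / x + KP / x)%R by rewrite /K; field; lra.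
  by rewrite /Cminus; lra.
have h5 := proj2 (Rle_div_r _ K x ltac:(lra)) h4.
have h6 := proj1 (Rle_div_l _ x (Cmod D) Dpos) x3.
lra.
Qed.

Lemma moments : exists c,
  (forall t, regular t -> Efun t = Sfun 0 t + Pfun c r t) /\
  (forall e : nat, moment (Z.of_nat e) = - (if (r - e)%nat is m.+1 then c m else RtoC 0)).
Proof.
have [c hc] := partial_fractions; exists c; split=> // e.
have : forall t, regular t -> t ^ e * Efun t = Sfun (Z.of_nat e) t + Pfun c (r - e) t.
  elim: e => [|e /moment_step [_ //]] t rt.
  by rewrite /= subn0 -hc //; ring.
by move=> /moment_step [].
Qed.

Lemma moment_ge (m : nat) : (1 <= m)%nat -> moment (Z.of_nat r + Z.of_nat m - 1) = 0.
Proof.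
move=> m1; have [c [_ hc]] := moments.
have := hc (r + m - 1)%nat.
have -> : (r - (r + m - 1) = 0)%nat.
  by apply/eqP; rewrite subn_eq0 -addnBA // leq_addr.
have -> : Z.of_nat (r + m - 1) = (Z.of_nat r + Z.of_nat m - 1)%Z.
  by move/leP: m1; rewrite -plusE -minusE; lia.
by move=> ->; ring.
Qed.

(** * Expansion of t^r E(t) at the origin *)

Definition bcoef (i : nat) : C := - moment (Z.of_nat r - 1 - Z.of_nat i).

(** For K = 0 this is the partial fraction identity, with the principal part rewritten through
    [moments]. Each further coefficient comes from [Sfun_succ] read downwards: S_(-K) =
    -moment(-K-1) + t S_(-K-1). *)
Lemma bcoef_expansion (K : nat) (t : C) : regular t ->
  t ^ r * Efun t = polyn bcoef (r + K) t + t ^ (r + K) * Sfun (- Z.of_nat K) t.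
Proof.
move=> rt; have [t0 _] := rt; elim: K => [|K IH].
  rewrite addn0; have [c [hE hc]] := moments.
  have -> : polyn bcoef r t = polyn c r t.
    apply: eq_bigr => i _; congr (_ * _); rewrite /bcoef.
    have ir := ltn_ord i.
    have -> : (Z.of_nat r - 1 - Z.of_nat i = Z.of_nat (r - i.+1))%Z.
      by move/ltP: ir; rewrite -minusE; lia.
    rewrite hc; have -> : (r - (r - i.+1) = i.+1)%nat by rewrite subKn.
    by ring.
  have := Cpow_nz _ r t0 => tr.
  by rewrite hE // /Pfun [(- Z.of_nat 0)%Z]/=; field.
rewrite IH addnS polynS -Cplus_assoc; congr (_ + _).
have := Sfun_succ (- Z.of_nat K.+1) t t0 (fun k n _ => regular_not_pole t k n rt).
have -> : (- Z.of_nat K.+1 + 1 = - Z.of_nat K)%Z by lia.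
rewrite /bcoef Cpow_S.
have -> : (Z.of_nat r - 1 - Z.of_nat (r + K) = - Z.of_nat K.+1)%Z by rewrite -plusE; lia.
move=> h; have -> : t * t ^ (r + K) * Sfun (- Z.of_nat K.+1) t
  = t ^ (r + K) * (t * Sfun (- Z.of_nat K.+1) t) by ring.
by rewrite h; ring.
Qed.

(** All nonzero poles have modulus at least d, so for |t| <= d/2 the factor (t/pole)^K is at most
    2^(-K); the cap rho <= 1 disposes of t^r. *)
Lemma bcoef_remainder : exists rho M, 0 < rho /\ 0 <= M /\ forall t : C, t <> 0 -> Cmod t <= rho ->
  regular t /\ forall K : nat, Cmod (t ^ (r + K) * Sfun (- Z.of_nat K) t) <= M * (/ 2) ^ K.
Proof.
have [d [d0 hd]] := pole_dist 0.
have hd' k n : n <> 0%Z -> d <= Cmod (pole k n).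
  move=> n0; have := hd k n; have -> : 0 - pole k n = - pole k n by ring.
  by rewrite Cmod_opp; apply=> e; apply: (pole_neq0 k n n0).
have [M [M0 hM]] := Tsum_bound r _ (residue_summable 0).
pose rho := Rmin (d / 2) 1.
have rho0 : 0 < rho by apply: Rmin_pos; lra.
have id0 : 0 < / (d / 2) by apply: Rinv_0_lt_compat; lra.
exists rho, (/ (d / 2) * M)%R; split=> //; split; first by apply: Rmult_le_pos; lra.
move=> t t0 ht.
have ht1 := Rle_trans _ _ _ ht (Rmin_l _ _).
have ht2 := Rle_trans _ _ _ ht (Rmin_r _ _).
have tp : 0 < Cmod t by apply/Cmod_gt_0.
have rt : regular t.
  apply: NNPP => /(singular_pole t t0) [k [n [n0 e]]].
  by have := hd' k n n0; rewrite -e; lra.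
split=> // K.
have far k n : n <> 0%Z -> d / 2 <= Cmod (t - pole k n).
  move=> n0; have := hd' k n n0; have := Cmod_sub_rev (pole k n) t.
  have -> : pole k n - t = - (t - pole k n) by ring.
  by rewrite Cmod_opp; lra.
have hS : Cmod (Sfun (- Z.of_nat K) t) <= / (d / 2) * / d ^ K * M.
  apply: hM => k n n0.
  apply: Rle_trans (Cmod_weight_div_le _ _ (d / 2) _ _) _; first lra.
    by move=> _; apply: far.
  rewrite Rmult_assoc; apply: Rmult_le_compat_l; first lra.
  rewrite (Cmod_mult (residue k n) (Czpow _ (- Z.of_nat K))).
  have pn := pole_neq0 k n n0.
  rewrite Czpow_opp // Czpow_nat Cmod_inv; last exact: Cpow_nz.
  rewrite [Czpow (pole k n) 0]/= Cmult_1_r Cmod_pow Rmult_comm.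
  apply: Rmult_le_compat_r; first exact: Cmod_ge_0.
  apply: Rinv_le_contravar; first exact: pow_lt.
  by apply: pow_incr; split; [lra | apply: hd'].
rewrite Cmod_mult Cmod_pow pow_add.
have h1 : Cmod t ^ r <= 1.
  by rewrite -(pow1 r); apply: pow_incr; lra.
have h2 : Cmod t ^ K <= (d / 2) ^ K by apply: pow_incr; lra.
have e2 : ((d / 2) ^ K = d ^ K * (/ 2) ^ K)%R by rewrite -Rpow_mult_distr.
have dK : 0 < d ^ K by apply: pow_lt.
apply: (Rle_trans _ (1 * (d ^ K * (/ 2) ^ K) * (/ (d / 2) * / d ^ K * M))).
  apply: Rmult_le_compat => //; last 1 first.
  - rewrite -e2; apply: Rmult_le_compat => //; apply: pow_le; lra.
  - by apply: Rmult_le_pos; apply: pow_le; lra.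
  - exact: Cmod_ge_0.
by apply: Req_le; field; lra.
Qed.
End PartialFractions.

(** * Power series *)

Section PowerSeries.
Local Open Scope R_scope.
Local Open Scope C_scope.

Definition pow_series (b : nat -> C) (t l : C) : Prop :=
  forall e, 0 < e -> exists N, forall n, (N <= n)%nat -> Cmod (polyn b n t - l) < e.

Lemma pow_series_is_series (b : nat -> C) (t l : C) :
  is_series (K := C_AbsRing) (V := C_NormedModule) (fun k => b k * t ^ k) l <->
  pow_series b t l.
Proof.
have sE n : sum_n (G := C_NormedModule) (fun k => b k * t ^ k) n = polyn b n.+1 t.
  elim: n => [|n IH].
    by rewrite sum_O polynS /polyn big_ord0 Cplus_0_l.
  by rewrite sum_Sn IH [RHS]polynS.
split.
  move=> h e e0; have e2 : 0 < e / 2 by lra.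
  have [N hN] := h _ (locally_ball (T := C_NormedModule) l (mkposreal _ e2)).
  exists N.+1 => -[//|n] hn; have hn' : (N <= n)%coq_nat by apply/leP.
  have := hN n hn'; rewrite sE => -[h1 h2].
  apply: Rle_lt_trans (Cmod_le_Re_Im _) _.
  change (Rabs (Re (polyn b n.+1 t) - Re l) < e / 2) in h1.
  change (Rabs (Im (polyn b n.+1 t) - Im l) < e / 2) in h2.
  change (Rabs (Re (polyn b n.+1 t) - Re l) + Rabs (Im (polyn b n.+1 t) - Im l) < e).
  lra.
move=> h P [e he]; have [N hN] := h e (cond_pos e).
exists N => n /leP hn; apply: he; rewrite sE.
have hn1 := hN n.+1 (leqW hn).
split.
  exact: Rle_lt_trans (re_le_Cmod _) hn1.
exact: Rle_lt_trans (im_le_Cmod _) hn1.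
Qed.

Lemma is_seriesC_ext (u v : nat -> C) (l : C) : (forall k, u k = v k) ->
  is_series (K := C_AbsRing) (V := C_NormedModule) u l ->
  is_series (K := C_AbsRing) (V := C_NormedModule) v l.
Proof. exact: is_series_ext. Qed.

Lemma polyn_shift (b : nat -> C) (n : nat) (t : C) :
  polyn b n.+1 t = b 0%nat + t * polyn (fun k => b k.+1) n t.
Proof.
elim: n => [|n IH]; first by rewrite polynS /polyn !big_ord0 /=; ring.
by rewrite polynS IH [polyn (fun k => b k.+1) n.+1 t]polynS Cpow_S; ring.
Qed.

Lemma pow_series_shift (b : nat -> C) (t l : C) : t <> 0 -> pow_series b t l ->
  pow_series (fun k => b k.+1) t ((l - b 0%nat) / t).
Proof.
move=> t0 h e e0; have tp : 0 < Cmod t by apply/Cmod_gt_0.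
have [N hN] := h (e * Cmod t)%R (Rmult_lt_0_compat _ _ e0 tp).
exists N => n hn; have := hN n.+1 (leqW hn); rewrite polyn_shift.
have -> : b 0%nat + t * polyn (fun k => b k.+1) n t - l =
  (polyn (fun k => b k.+1) n t - (l - b 0%nat) / t) * t by field.
by rewrite Cmod_mult; apply: Rmult_lt_reg_r.
Qed.

Lemma pow_series_coef_bounded (b : nat -> C) (t l : C) : pow_series b t l ->
  exists M, forall k, Cmod (b k) * Cmod t ^ k <= M.
Proof.
move=> h; have [N hN] := h 1%R Rlt_0_1.
have [M hM] : exists M, forall k, (k < N)%nat -> Cmod (b k) * Cmod t ^ k <= M.
  elim: (N) => [|m [M hM]]; first by exists 0%R.
  exists (Rmax M (Cmod (b m) * Cmod t ^ m)) => k; rewrite ltnS leq_eqVlt => /orP [/eqP -> | hk].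
    exact: Rmax_r.
  exact: Rle_trans (hM k hk) (Rmax_l _ _).
exists (Rmax M 2) => k; case: (ltnP k N) => hk.
  exact: Rle_trans (hM k hk) (Rmax_l _ _).
apply: Rle_trans (Rmax_r _ _).
have h1 := hN k hk; have := hN k.+1 (leqW hk); rewrite polynS => h2.
rewrite -Cmod_pow -Cmod_mult.
have -> : b k * t ^ k = polyn b k t + b k * t ^ k - l + - (polyn b k t - l) by ring.
by apply: Rle_trans (Cmod_triangle _ _) _; rewrite Cmod_opp; lra.
Qed.

(** On half the radius the terms are dominated by M 2^(-k), whose sum is 2 M. *)
Lemma pow_series_bounded (b : nat -> C) (t l : C) (s M : R) : 0 < s ->
  (forall k, Cmod (b k) * s ^ k <= M) -> Cmod t <= s / 2 ->
  pow_series b t l -> Cmod l <= 2 * M.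
Proof.
move=> s0 hb ht h.
have hp n : Cmod (polyn b n t) <= 2 * M * (1 - (/ 2) ^ n).
  elim: n => [|n IH]; first by rewrite /polyn big_ord0 Cmod_0 /=; lra.
  rewrite polynS; apply: Rle_trans (Cmod_triangle _ _) _.
  rewrite Cmod_mult Cmod_pow.
  have h1 : Cmod t ^ n <= (s / 2) ^ n.
    by apply: pow_incr; split; [apply: Cmod_ge_0 | ].
  have h2 : ((s / 2) ^ n = s ^ n * (/ 2) ^ n)%R by rewrite -Rpow_mult_distr.
  have h3 := Rmult_le_compat_l _ _ _ (Cmod_ge_0 (b n)) h1.
  have p2 : 0 < (/ 2) ^ n by apply: pow_lt; lra.
  have h4 := Rmult_le_compat_r _ _ _ (Rlt_le _ _ p2) (hb n).
  rewrite /=; rewrite h2 in h3; lra.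
have M0 : 0 <= M.
  apply: Rle_trans (hb 0%nat); apply: Rmult_le_pos; first exact: Cmod_ge_0.
  by rewrite /=; lra.
apply: Rnot_lt_le => hl.
have [N hN] := h (Cmod l - 2 * M)%R ltac:(lra).
have h1 := hN N (leqnn N).
have := Cmod_sub_rev l (- (polyn b N t - l)); rewrite Cmod_opp.
have -> : l - - (polyn b N t - l) = polyn b N t by ring.
have p2 : 0 < (/ 2) ^ N by apply: pow_lt; lra.
have h5 := Rmult_le_pos _ _ M0 (Rlt_le _ _ p2).
have := hp N; lra.
Qed.

(** (f - b_0)/t is the sum of the shifted series. Convergence of that series at the single point s
    bounds its coefficients, hence its sum for |t| <= s/2. *)
Lemma pow_series_jetc (b : nat -> C) (f : C -> C) :
  near0 (fun t => pow_series b t (f t)) -> jetc 0 (b 0%nat) f.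
Proof.
move=> [d [d0 hd]].
exists (fun t => (f t - b 0%nat) / t); split; last by apply: near0_true => h h0; field.
pose s := (d / 2)%R.
have s0 : RtoC s <> 0 by move=> /RtoC_inj; rewrite /s; lra.
have ms : Cmod (RtoC s) = s by rewrite Cmod_R Rabs_pos_eq // /s; lra.
have [M hM] := pow_series_coef_bounded _ _ _
  (pow_series_shift _ _ _ s0 (hd (RtoC s) s0 ltac:(rewrite ms /s; lra))).
rewrite ms in hM.
exists (2 * M)%R, (s / 2)%R; split; first by rewrite /s; lra.
move=> h h0 hh; apply: (pow_series_bounded (fun k => b k.+1) h _ s) => //.
- by rewrite /s; lra.
- by lra.
- by apply: pow_series_shift => //; apply: hd => //; move: hh; rewrite /s; lra.
Qed.

(** The constant coefficient is a limit, hence determined; subtracting it and dividing by t passes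
    to the next one. *)
Lemma pow_series_unique (b b' : nat -> C) (f : C -> C) :
  near0 (fun t => pow_series b t (f t)) -> near0 (fun t => pow_series b' t (f t)) ->
  forall k, b k = b' k.
Proof.
move=> h h' k; elim: k b b' f h h' => [|k IH] b b' f h h'.
  exact: jetc_unique (pow_series_jetc _ _ h) (pow_series_jetc _ _ h').
have e0 : b 0%nat = b' 0%nat.
  exact: jetc_unique (pow_series_jetc _ _ h) (pow_series_jetc _ _ h').
apply: (IH (fun k => b k.+1) (fun k => b' k.+1) (fun t => (f t - b 0%nat) / t)).
  by apply: near0_mono h => t t0; apply: pow_series_shift.
by rewrite e0; apply: near0_mono h' => t t0; apply: pow_series_shift.
Qed.
End PowerSeries.

(** * Multiple Bernoulli polynomials *)

Section MultipleBernoulli.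
Local Open Scope R_scope.
Local Open Scope C_scope.

Lemma Cexp_sum (I : finType) (f : I -> C) :
  Cexp (\big[Cplus/RtoC 0]_i f i) = \big[Cmult/RtoC 1]_i Cexp (f i).
Proof.
rewrite unlock /reducebig; elim: (index_enum I) => [|i s IH] /=; first exact: Cexp_0.
by rewrite -IH -Cexp_add.
Qed.

Lemma Cprod_inv (I : finType) (P : pred I) (f : I -> C) : (forall i, P i -> f i <> 0) ->
  (\big[Cmult/RtoC 1]_(i | P i) / f i = / \big[Cmult/RtoC 1]_(i | P i) f i) /\
  (\big[Cmult/RtoC 1]_(i | P i) f i <> 0).
Proof.
move=> h; rewrite unlock /reducebig; elim: (index_enum I) => [|i s [IH1 IH2]] /=.
  by split; [field | move=> /RtoC_inj; lra].
case: (boolP (P i)) => // hi; have fi := h i hi.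
by rewrite IH1; split; [field | apply: Cmult_neq_0].
Qed.

Lemma Czpow_inv (x : C) (e : Z) : x <> 0 -> Czpow (/ x) e = Czpow x (- e).
Proof.
move=> x0; rewrite Czpow_opp //; case: e => [|q|q] /=; first by field.
  by rewrite Cpow_inv.
by rewrite Cpow_inv.
Qed.

Variables (r : nat) (omega : 'I_r -> C) (a : 'I_r -> R) (z : C).
Hypothesis r_ge2 : (2 <= r)%nat.
Hypothesis omega_upper : forall k, 0 < Im (omega k).
Hypothesis omega_arg : forall j k : 'I_r, (j < k)%nat -> Carg (omega j) < Carg (omega k).
Hypothesis a_bounds : forall k, 0 < a k < 1.
Hypothesis z_def : z = \big[Cplus/RtoC 0]_(k < r) (RtoC (a k) * omega k).

Let omega_nz := omega_neq0 r omega omega_upper.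

Lemma Cexp_z (t : C) :
  Cexp (z * t) = \big[Cmult/RtoC 1]_(j < r) Cexp (RtoC (a j) * (omega j * t)).
Proof.
rewrite -Cexp_sum z_def Cmult_comm -Csum_scal; congr Cexp.
by apply: eq_bigr => j _; ring.
Qed.

Lemma bernoulli_generating (t : C) : regular r omega t ->
  t ^ r * Cexp (z * t) / \big[Cmult/RtoC 1]_(j < r) (Cexp (omega j * t) - 1) =
  t ^ r * Efun r omega a t.
Proof.
move=> [t0 ht]; rewrite /Efun /gfun big_split /= -Cexp_z.
have nz (j : 'I_r) : true -> Cexp (omega j * t) - 1 <> 0.
  by move=> _ e; apply: (ht j); rewrite -[RHS]Cplus_0_r -e; ring.
have [-> ?] := Cprod_inv _ _ _ nz.
by rewrite /Cdiv Cmult_assoc.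
Qed.

Lemma bcoef_series : near0 (fun t => pow_series (bcoef r omega a) t (t ^ r * Efun r omega a t)).
Proof.
have [rho [M [rho0 [M0 h]]]] := bcoef_remainder r omega a r_ge2 omega_upper omega_arg a_bounds.
exists rho; split=> // t t0 ht e e0.
have [rt hK] := h t t0 (Rlt_le _ _ ht).
have [N hN] := pow_lt_1_zero (/ 2) ltac:(rewrite Rabs_pos_eq; lra) (e / (M + 1))
  ltac:(apply: Rdiv_lt_0_compat; lra).
exists (r + N)%nat => n hn; rewrite -(subnKC hn) -addnA.
set K := (N + _)%nat.
rewrite (bcoef_expansion r omega a r_ge2 omega_upper omega_arg a_bounds K t rt).
set X := polyn _ _ _; set Y := _ * Sfun _ _ _ _ _.
have -> : X - (X + Y) = - Y by ring.
rewrite Cmod_opp; apply: Rle_lt_trans (hK K) _.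
have := hN K ltac:(rewrite /K -plusE; lia).
have p2 : 0 < (/ 2) ^ K by apply: pow_lt; lra.
rewrite Rabs_pos_eq; last lra.
move=> h1; have h2 : (/ 2) ^ K * (M + 1) < e.
  apply: (Rlt_le_trans _ (e / (M + 1) * (M + 1))).
    by apply: Rmult_lt_compat_r; lra.
  by apply: Req_le; field; lra.
lra.
Qed.

(** The explicit coefficients show that the predicate under [epsilon] is satisfiable; uniqueness
    then identifies whichever sequence [epsilon] returns. *)
Lemma multiple_bernoulliE (m : nat) :
  multiple_bernoulli m z omega = bcoef r omega a m * RtoC (INR (Factorial.fact m)).
Proof.
have fz k : RtoC (INR (Factorial.fact k)) <> 0.
  by move=> /RtoC_inj; apply: INR_fact_neq_0.
have [rho [M [rho0 [_ h]]]] := bcoef_remainder r omega a r_ge2 omega_upper omega_arg a_bounds.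
have reg : near0 (regular r omega).
  by exists rho; split=> // t t0 ht; apply: (h t t0 (Rlt_le _ _ ht)).1.
have ex : exists B, is_multiple_bernoulli omega z B.
  exists (fun k => bcoef r omega a k * RtoC (INR (Factorial.fact k))).
  have [d [d0 hd]] := near0_and _ _ reg bcoef_series.
  exists d; split=> // t t0 ht; have [rt hs] := hd t t0 ht.
  rewrite bernoulli_generating //.
  move/pow_series_is_series: hs; apply: is_seriesC_ext => k.
  by field.
have := epsilon_spec (inhabits (fun _ : nat => RtoC 0)) _ ex.
set B := epsilon _ _ => -[d [d0 hd]].
have hB : near0 (fun t => pow_series (fun k => B k / RtoC (INR (Factorial.fact k))) t
    (t ^ r * Efun r omega a t)).
  have near_d : near0 (fun t : C => t <> 0 /\ Cmod t < d) by exists d.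
  apply: near0_and2 near_d reg => t t0 [_ ht] rt.
  apply/pow_series_is_series; rewrite -bernoulli_generating //.
  by apply: is_seriesC_ext (hd t t0 ht) => k; field.
have e := pow_series_unique _ _ _ hB bcoef_series m.
by rewrite /multiple_bernoulli -/B -e; field.
Qed.

Lemma prod_m1 (k : 'I_r) :
  (- (1)) ^ r = - (1) * \big[Cmult/RtoC 1]_(j < r | j != k) (- (1)).
Proof.
have -> : (- (1)) ^ r = \big[Cmult/RtoC 1]_(j < r) (- (1)).
  rewrite big_const card_ord; elim: (r) => [//|n IH].
  by rewrite Cpow_S IH.
by rewrite (bigD1 k).
Qed.

(** Each of the r-1 factors with j <> k changes sign when e^x - 1 is written as -(1 - e^x), giving
    -(-1)^r. The exponent of omega_k is -e from the power of the pole and -1 from the residue; the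
    exponentials recombine to e^(z pole). *)
Lemma residue_exp_term (e : Z) (k : 'I_r) (n : Z) : n <> 0%Z ->
  residue r omega a k n * Czpow (pole r omega k n) e =
  - ((- (1)) ^ r * Czpow (2 * RtoC PI * Ci) e * Czpow (omega k) (- e - 1)) *
    exp_term omega z e k n.
Proof.
move=> n0; have wk := omega_nz k.
have pi0 : 2 * RtoC PI * Ci <> 0.
  have := ipole_neq0 1 ltac:(lia); rewrite /ipole => h h'; apply: h.
  by rewrite h' Cmult_0_l.
have nz : RtoC (IZR n) <> 0 by move=> /RtoC_inj /eq_IZR_R0.
have eP : Czpow (pole r omega k n) e =
    Czpow (2 * RtoC PI * Ci) e * Czpow (RtoC (IZR n)) e * (Czpow (omega k) (- e - 1) * omega k).
  rewrite /pole /ipole /Cdiv (Czpow_mult (_ * RtoC (IZR n))); [|exact: Cmult_neq_0|exact: Cinv_neq0].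
  rewrite (Czpow_mult _ (RtoC (IZR n))) //.
  by rewrite Czpow_inv // -Czpow_succ //; congr (_ * Czpow _ _); lia.
set p := pole r omega k n in eP *.
have eZ : Cexp (2 * RtoC PI * Ci * RtoC (IZR n) * (z / omega k)) =
    Cexp (RtoC (a k) * ipole n) *
    \big[Cmult/RtoC 1]_(j < r | j != k) Cexp (RtoC (a j) * (omega j * p)).
  have -> : 2 * RtoC PI * Ci * RtoC (IZR n) * (z / omega k) = z * p.
    by rewrite /p /pole /ipole; field.
  by rewrite Cexp_z (bigD1 k) //= /p omega_pole.
have eD : \big[Cmult/RtoC 1]_(j < r | j != k) gfun (RtoC (a j)) (omega j * p) =
    \big[Cmult/RtoC 1]_(j < r | j != k) Cexp (RtoC (a j) * (omega j * p)) *
    (\big[Cmult/RtoC 1]_(j < r | j != k) (- (1)) *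
     \big[Cmult/RtoC 1]_(j < r | j != k)
      / (1 - Cexp (2 * RtoC PI * Ci * RtoC (IZR n) * (omega j / omega k)))).
  rewrite -!big_split; apply: eq_bigr => j /eqP jk /=.
  have -> : 2 * RtoC PI * Ci * RtoC (IZR n) * (omega j / omega k) = omega j * p.
    by rewrite /p /pole /ipole; field.
  have h1 := regular_pole r omega omega_upper omega_arg k n j n0 jk.
  rewrite -/p in h1; rewrite /gfun; field; split.
    by move=> h; apply: h1; rewrite -[LHS]Cplus_0_r -h; ring.
  by move=> h; apply: h1; rewrite -[RHS]Cplus_0_r -h; ring.
rewrite /residue -/p eD eP /exp_term eZ (prod_m1 k).
by field.
Qed.

Lemma exp_term_summable (e : Z) (k : 'I_r) : summable_nz (exp_term omega z e k).
Proof.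
have := residue_summable r omega a r_ge2 omega_upper omega_arg a_bounds e k.
pose c := - ((- (1)) ^ r * Czpow (2 * RtoC PI * Ci) e * Czpow (omega k) (- e - 1)).
have c0 : c <> 0.
  have m0 : - (1) <> 0 by move=> h; have := f_equal Re h; rewrite /=; lra.
  have pi0 : 2 * RtoC PI * Ci <> 0.
    have := ipole_neq0 1 ltac:(lia); rewrite /ipole => h h'; apply: h.
    by rewrite h' Cmult_0_l.
  have -> : c = - (1) * ((- (1)) ^ r * Czpow (2 * RtoC PI * Ci) e * Czpow (omega k) (- e - 1)).
    by rewrite /c; ring.
  by do !apply: Cmult_neq_0 => //; try apply: Czpow_neq0 => //; apply: Cpow_nz.
apply: (summable_nz_le _ _ (Cmod (/ c))) => n n0.
rewrite residue_exp_term // -/c -Cmod_mult.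
have -> : / c * (c * exp_term omega z e k n) = exp_term omega z e k n by field.
lra.
Qed.

Lemma moment_exp_term (e : Z) :
  - moment r omega a e = (- (1)) ^ r * Czpow (2 * RtoC PI * Ci) e *
    \big[Cplus/RtoC 0]_(k < r) (Czpow (omega k) (- e - 1) * sum_nz (exp_term omega z e k)).
Proof.
rewrite /moment /Tsum -Csum_scal.
have -> : forall x, - x = - (1) * x by move=> x; ring.
rewrite -Csum_scal; apply: eq_bigr => k _.
rewrite (sum_nz_ext _ _ (residue_exp_term e k)) sum_nz_scal; last exact: exp_term_summable.
by ring.
Qed.
End MultipleBernoulli.

Theorem corollary5p6 (r : nat) (omega : 'I_r -> C) (a : 'I_r -> R) (z : C)
    (r_ge2 : (2 <= r)%nat)
    (omega_upper : forall k : 'I_r, (0 < Im (omega k))%R)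
    (omega_arg : forall j k : 'I_r, (j < k)%nat -> (Carg (omega j) < Carg (omega k))%R)
    (a_bounds : forall k : 'I_r, (0 < a k < 1)%R)
    (z_def : z = \big[Cplus/RtoC 0]_(k < r) (RtoC (a k) * omega k)%C) :
  (forall m : nat,
     let e := (Z.of_nat r - 1 - Z.of_nat m)%Z in
     (forall k : 'I_r, summable_nz (exp_term omega z e k)) /\
     multiple_bernoulli m z omega =
       (Cpow (- (1)) r * Czpow (2 * RtoC PI * Ci) e
        * RtoC (INR (Factorial.fact m))
        * \big[Cplus/RtoC 0]_(k < r)
            (Czpow (omega k) (Z.of_nat m - Z.of_nat r)
             * sum_nz (exp_term omega z e k)))%C)
  /\
  (forall m : nat, (1 <= m)%nat ->
     let e := (Z.of_nat r + Z.of_nat m - 1)%Z in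
     (forall k : 'I_r, summable_nz (exp_term omega z e k)) /\
     \big[Cplus/RtoC 0]_(k < r)
       (Czpow (omega k) (- (Z.of_nat r + Z.of_nat m))
        * sum_nz (exp_term omega z e k))%C = RtoC 0).
Proof.
split=> m.
  split=> [k|].
    exact: (exp_term_summable r omega a).
  (* With e = r-1-m the exponent -e-1 of omega_k becomes m-r. *)
  rewrite (multiple_bernoulliE r omega a) // /bcoef (moment_exp_term r omega a z) //.
  have -> : (- (Z.of_nat r - 1 - Z.of_nat m) - 1 = Z.of_nat m - Z.of_nat r)%Z by lia.
  by rewrite -!Cmult_assoc; congr (_ * (_ * _))%C; apply: Cmult_comm.
move=> m1; split=> [k|]; first exact: (exp_term_summable r omega a).
have := moment_exp_term r omega a z r_ge2 omega_upper omega_arg a_bounds z_def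
  (Z.of_nat r + Z.of_nat m - 1).
rewrite moment_ge //.
have -> : (- (Z.of_nat r + Z.of_nat m - 1) - 1 = - (Z.of_nat r + Z.of_nat m))%Z by lia.
set S := \big[_/_]_(k < r) _; set c := (_ * Czpow _ _)%C => h.
(* The vanishing moment is the required sum times a sign and a power of 2 pi i, which can be
   cancelled. *)
have c0 : c <> 0%C.
  apply: Cmult_neq_0.
    by apply: Cpow_nz => /(f_equal Re) /=; lra.
  apply: Czpow_neq0.
  have := ipole_neq0 1 ltac:(lia); rewrite /ipole => h1 h2; apply: h1.
  by rewrite h2 Cmult_0_l.
have -> : S = (/ c * (c * S))%C by field.
by rewrite -h; ring.
Qed.
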